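(* Let $\omega$ be a continuous non-decreasing function on $[0,+\infty)$ with $\omega(0)=0$. Suppose that $\omega(2\delta)<2\omega(\delta)$ for all sufficiently small $\delta>0$. Let $\chi^{-1}$ be the function inverse to $\chi(\delta)=\delta\,\omega(\delta)$ and, for $y>1$, put $$\Theta_1(y)=\frac{y}{\log y}\,\chi^{-1}\bigg(\frac{(\log y)^2}{y}\bigg),\qquad \Theta_p(y)=\bigg(\int_1^y(\chi^{-1}(1/\tau))^p\,d\tau\bigg)^{1/p}\quad (p>1).$$ Then there exists a nowhere linear $C^{1,\omega}$-diffeomorphism $h$ of the circle $\mathbb T$ such that $$\|e^{inh}\|_{A_p(\mathbb T)}=O(\Theta_p(|n|)),\qquad |n|\to\infty,\quad n\in\mathbb Z,$$ for all $p$, $1\leq p<2$.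
   Context: $\mathbb T=\mathbb R/2\pi\mathbb Z$; functions on $\mathbb T$ are identified with $2\pi$-periodic functions on $\mathbb R$. A map of the circle into itself is a function $\varphi:\mathbb R\to\mathbb R$ satisfying $\varphi(t+2\pi)=\varphi(t)\ (\mathrm{mod}\ 2\pi)$ for all $t$. It is $C^1$-smooth if $\varphi\in C^1(\mathbb R)$, and $C^{1,\omega}$-smooth if $\varphi$ is differentiable on $\mathbb R$ and $\sup_{|t_1-t_2|\le\delta}|\varphi'(t_1)-\varphi'(t_2)|=O(\omega(\delta))$ as $\delta\to+0$. It is a homeomorphism of the circle if it is continuous and one-to-one mod $2\pi$, a diffeomorphism if it is a homeomorphism and both it and its inverse are $C^1$-smooth, and a $C^{1,\omega}$-diffeomorphism if it is a diffeomorphism that is $C^{1,\omega}$-smooth. A function is nowhere linear if it is not linear (i.e. not of the form $at+b$) on any interval. Fourier coefficients: $\widehat f(k)=\frac1{2\pi}\int_0^{2\pi}f(t)e^{-ikt}\,dt$, $k\in\mathbb Z$. $A_1(\mathbb T)$ is the space of continuous functions $f$ on $\mathbb T$ with $\{\widehat f(k)\}\in l^1$; for $1<p\le 2$, $A_p(\mathbb T)$ is the space of integrable functions $f$ on $\mathbb T$ with $\{\widehat f(k)\}\in l^p$. The norm is $\|f\|_{A_p(\mathbb T)}=\big(\sum_{k\in\mathbb Z}|\widehat f(k)|^p\big)^{1/p}$. *)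

(* Defs.v *)
From mathcomp Require Export all_boot all_order all_algebra.
From mathcomp Require Export complex.
From mathcomp Require Export all_classical all_reals all_analysis.
Export Order.TTheory GRing.Theory Num.Theory.
Export numFieldNormedType.Exports.

Set Implicit Arguments.
Unset Strict Implicit.
Unset Printing Implicit Defensive.

Local Open Scope classical_set_scope.
Local Open Scope complex_scope.
Local Open Scope ring_scope.

Section circle_maps.
Variable R : realType.
Implicit Types (f g h w : R -> R) (a b d t : R).

Definition eq_mod2pi a b : Prop := exists z : int, a = b + z%:~R * (2 * pi).

(* Self-maps of the circle are represented by functions on the line; two
   functions that agree mod 2pi represent the same map. *)
Definition circle_map f : Prop := forall t, eq_mod2pi (f (t + 2 * pi)) (f t).

Definition circle_inverse f g : Prop :=
  (forall t, eq_mod2pi (g (f t)) t) /\ (forall t, eq_mod2pi (f (g t)) t).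

Definition C1_smooth f : Prop :=
  (forall t, derivable f t 1) /\ continuous (derive1 f).

Definition modulus_of_continuity f d : \bar R :=
  ereal_sup [set `|f u.1 - f u.2|%:E | u in [set u : R * R | `|u.1 - u.2| <= d]].

Definition C1w_smooth w f : Prop :=
  (forall t, derivable f t 1) /\
  exists C : R, \forall d \near 0^'+,
    (modulus_of_continuity (derive1 f) d <= (C * w d)%:E)%E.

(* Surjectivity is not required: a continuous map of the circle that is
   one-to-one mod 2pi is automatically onto. *)
Definition circle_homeo h : Prop :=
  [/\ circle_map h, continuous h
    & forall s t, eq_mod2pi (h s) (h t) -> eq_mod2pi s t].

Definition circle_diffeo h : Prop :=
  [/\ circle_homeo h, C1_smooth h
    & exists g, [/\ circle_map g, circle_inverse h g & C1_smooth g]].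

Definition circle_C1w_diffeo w h : Prop := circle_diffeo h /\ C1w_smooth w h.

Definition nowhere_linear f : Prop :=
  forall a b, a < b ->
    ~ exists c0 c1, forall t, t \in `]a, b[ -> f t = c1 * t + c0.

End circle_maps.

Section fourier.
Variable R : realType.
Local Notation mu := (@lebesgue_measure R).
Implicit Types (f : R -> R[i]) (k n : int) (p t : R).

(* e^{it} *)
Definition cis t : R[i] := cos t +i* sin t.

Definition cintegral (D : set R) f : R[i] :=
  (\int[mu]_(t in D) complex.Re (f t)) +i* (\int[mu]_(t in D) complex.Im (f t)).

Definition fourier_coeff f k : R[i] :=
  ((2 * pi)^-1)%:C *
    cintegral `[0, 2 * pi] (fun t => f t * cis (- (k%:~R * t))).

(* Extended-real valued: for a continuous 2pi-periodic f, membership in the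
   space A_p amounts to this quantity being finite. *)
Definition A_norm p f : \bar R :=
  ((\esum_(k in [set: int])
      (ComplexField.Normc.normc (fourier_coeff f k) `^ p)%:E) `^ p^-1)%E.

Definition exp_i (n : int) (h : R -> R) : R -> R[i] :=
  fun t => cis (n%:~R * h t).

End fourier.

Section theta.
Variable R : realType.
Local Notation mu := (@lebesgue_measure R).
Implicit Types (w : R -> R) (p y d : R).

Definition chi w d : R := d * w d.

(* Inverse of chi restricted to [0, +oo); the default value 0 is only taken
   off the range of chi. *)
Definition chi_inv w : R -> R :=
  'pinv_(fun=> 0) [set d : R | 0 <= d] (chi w).

Definition Theta w p y : R :=
  if p == 1 then y / ln y * chi_inv w ((ln y) ^+ 2 / y)
  else (\int[mu]_(tau in `[1, y]) (chi_inv w (tau^-1) `^ p)) `^ p^-1.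

End theta.

(* Main.v *)
(** Pick scales [delta k] with [w (delta k) = c / 2 ^ k]; the doubling hypothesis
    gives [2 * delta k.+1 < delta k].  Let [psi] be the Cantor function whose i-th
    generation consists of [2 ^ i] intervals of length [delta (k + i)]: its modulus
    of continuity is [O(w)].  Four reflected copies of [psi] form an odd bump with
    zero integral.  We take [h' = 1 + gamma], [gamma] being a sum of bumps with
    rapidly decreasing amplitudes, the m-th one supported in the m-th rational
    interval, at a place where the sum of the earlier ones is constant (such places
    are dense since [psi] is locally constant on a dense open set).  Thus [gamma] is
    constant on no interval.  Writing [h_m] for the map obtained from the first m
    bumps, [e^{i n h_{m+1}} - e^{i n h_m}] lives on the m-th block, where [h_m] is
    linear, so that its Fourier coefficients are differences of integrals of
    [cos (n A B(t) - theta t + a)] and [cos (- theta t + a)], [theta] running over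
    a translate of the integers.

    On a quarter of a block the phase has the monotone derivative
    [N psi - theta], and van der Corput's lemma bounds the integral by [4 / rho]
    plus the measure of the set [|N psi - theta| <= rho].  Outside the intervals of
    generation i, [psi] takes its values in the multiples of [2 ^ -i].  For [p > 1],
    choosing i according to the distance from [theta] to these multiples of
    [N 2 ^ -i], and summing over frequencies, gives
    [sum_i 2 ^ i delta (L + i) ^ (p - 1)], comparable to the integral defining
    [Theta_p ^ p].  For [p = 1] a single generation suffices, with [delta j] close to
    [chi^-1 ((ln n) ^ 2 / n)].  All bounds decay geometrically in m. *)
Require Import Defs.
From mathcomp Require Import ring lra zify measurable_realfun.

Set Implicit Arguments.
Unset Strict Implicit.
Unset Printing Implicit Defensive.

Local Open Scope classical_set_scope.
Local Open Scope ring_scope.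

(** * Cantor functions *)

Section cantor.
Variables (R : realType) (delta : nat -> R).

(** The bump is odd so that its primitive has compact support: the map changes on the block only,
    and at both ends of the block the old and the new phase agree in value and in slope. This is why
    the difference with the linear phase is estimated. Each integral alone decays like
    [1 / |theta|], which is not summable, but the equal boundary terms cancel and leave
    [O(N / theta ^ 2)]. The exponent [p = 1] needs its own argument because the sum of
    [min(e, 1 / d)] over the frequencies diverges logarithmically. With one generation the resonant
    sets are not measured frequency by frequency but in total: a point is resonant for [O(rho)]
    frequencies only, and it must lie in one of [2 ^ i] short intervals. One map has to serve all
    [p] at once. For [p > 1] the amplitude condition [A m <= c / 2 ^ (L m)] does not involve [p],
    which enters only the constants and the ratio of the decay; the case [p = 1] adds a single
    further upper bound on the amplitudes. *)

Definition gap k : R := delta k - delta k.+1.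

(* The two intervals of the next generation start at [0] and at [gap k]; each
   of them has length [delta k.+1]. *)
Fixpoint cantor_step (n k : nat) (t : R) : R :=
  if n is n'.+1 then
    (cantor_step n' k.+1 t + cantor_step n' k.+1 (t - gap k)) / 2
  else if delta k <= t then 1 else 0.

Definition cantor (k : nat) (t : R) : R :=
  limn (fun n => cantor_step n k t).

Hypothesis delta_gt0 : forall k, 0 < delta k.
Hypothesis delta_half : forall k, 2 * delta k.+1 < delta k.

Lemma delta_ltS k : delta k.+1 < delta k.
Proof. by have := delta_gt0 k.+1; have := delta_half k; lra. Qed.

Lemma delta_le i j : (i <= j)%N -> delta j <= delta i.
Proof.
move=> /subnK <-; elim: (j - i)%N => [|n IHn]; first by [].
by rewrite addSn (le_trans (ltW (delta_ltS _))).
Qed.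

Lemma cantor_step_ge0 n k t : 0 <= cantor_step n k t.
Proof.
elim: n k t => [|n IHn] k t /=; first by case: ifP; lra.
by have := IHn k.+1 t; have := IHn k.+1 (t - gap k); lra.
Qed.

Lemma cantor_step_le1 n k t : cantor_step n k t <= 1.
Proof.
elim: n k t => [|n IHn] k t /=; first by case: ifP; lra.
by have := IHn k.+1 t; have := IHn k.+1 (t - gap k); lra.
Qed.

Lemma cantor_step_mono n k s t :
  s <= t -> cantor_step n k s <= cantor_step n k t.
Proof.
elim: n k s t => [|n IHn] k s t st /=.
  by case: ifP => ks; case: ifP => kt; lra.
have := IHn k.+1 _ _ st.
have : s - gap k <= t - gap k by lra.
by move=> /(IHn k.+1); lra.
Qed.

Lemma cantor_step_eq0 n k t : t <= 0 -> cantor_step n k t = 0.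
Proof.
elim: n k t => [|n IHn] k t t0 /=.
  by rewrite leNgt (le_lt_trans t0 (delta_gt0 k)).
have := delta_ltS k => dk; rewrite !IHn //; first lra.
by rewrite /gap; lra.
Qed.

Lemma cantor_step_eq1 n k t : delta k <= t -> cantor_step n k t = 1.
Proof.
elim: n k t => [|n IHn] k t kt /=; first by rewrite kt.
have := delta_ltS k => dk; rewrite !IHn //; first lra.
  by rewrite /gap; lra.
by lra.
Qed.

(** The recursion starts from the lowest admissible profile, the jump at the right end [delta k], so
    refining can only raise the value. Monotonicity then gives convergence without a uniform
    estimate. *)
Lemma cantor_step_ndecr k t : nondecreasing_seq (fun n => cantor_step n k t).
Proof.
apply/nondecreasing_seqP => n; elim: n k t => [|n IHn] k t.
  rewrite [leLHS]/=; case: ifP => kt; last exact: cantor_step_ge0.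
  by rewrite cantor_step_eq1.
have := IHn k.+1 t; have := IHn k.+1 (t - gap k).
by rewrite /=; lra.
Qed.

Lemma cvg_cantor k t : cantor_step n k t @[n --> \oo] --> cantor k t.
Proof.
apply: nondecreasing_is_cvgn; first exact: cantor_step_ndecr.
by exists 1 => _ [n _ <-]; exact: cantor_step_le1.
Qed.

Arguments cvg_cantor : clear implicits.

Lemma cantor_rec k t :
  cantor k t = (cantor k.+1 t + cantor k.+1 (t - gap k)) / 2.
Proof.
have cS := cvg_cantor k t; rewrite -cvg_shiftS /= in cS.
apply: (cvg_unique _ cS); first exact: norm_hausdorff.

by apply: cvgMr_tmp; apply: cvgD; exact: cvg_cantor.
Qed.

Lemma cantor_ge0 k t : 0 <= cantor k t.
Proof.
apply: limr_ge; first exact: cvg_cantor.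
by near=> n; exact: cantor_step_ge0.
Unshelve. all: by end_near. Qed.

Lemma cantor_le1 k t : cantor k t <= 1.
Proof.
apply: limr_le; first exact: cvg_cantor.
by near=> n; exact: cantor_step_le1.
Unshelve. all: by end_near. Qed.

Lemma cantor_mono k s t : s <= t -> cantor k s <= cantor k t.
Proof.
move=> st; apply: ler_lim; try exact: cvg_cantor.
by near=> n; exact: cantor_step_mono.
Unshelve. all: by end_near. Qed.

Lemma cantor_eq0 k t : t <= 0 -> cantor k t = 0.
Proof.
move=> t0; rewrite /cantor; under eq_fun do rewrite cantor_step_eq0 //.
exact: lim_cst.
Qed.

Lemma cantor_eq1 k t : delta k <= t -> cantor k t = 1.
Proof.
move=> t0; rewrite /cantor; under eq_fun do rewrite cantor_step_eq1 //.
exact: lim_cst.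
Qed.

Lemma cantor_lo i k t : t <= delta (k + i)%N -> cantor k t <= 2 ^- i.
Proof.
elim: i k t => [|i IHi] k t tk; first by rewrite expr0 invr1 cantor_le1.
rewrite cantor_rec [cantor _ (t - _)]cantor_eq0; last first.
  have := delta_half k; have : delta (k + i.+1)%N <= delta k.+1.
    by apply: delta_le; lia.
  by rewrite /gap; lra.
have := IHi k.+1 t; rewrite addSnnS => /(_ tk); rewrite exprS invfM; lra.
Qed.

Lemma cantor_hi i k t :
  delta k - delta (k + i)%N <= t -> 1 - 2 ^- i <= cantor k t.
Proof.
elim: i k t => [|i IHi] k t tk.
  by rewrite expr0 invr1 subrr cantor_ge0.
have dk := delta_half k; have dki : delta (k + i.+1)%N <= delta k.+1.
  by apply: delta_le; lia.
rewrite cantor_rec [cantor _ t]cantor_eq1; last lra.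
have := IHi k.+1 (t - gap k); rewrite addSnnS exprS invfM /gap.
have -> : (delta k.+1 - delta (k + i.+1)%N <= t - (delta k - delta k.+1)) by lra.
by move=> /(_ isT); lra.
Qed.

(** If only one half varies, the averaging supplies the new factor [1 / 2]. The constant 2 comes
    from pairs that straddle the gap, where both summands vary, each by at most [2 ^- i]. *)
Lemma cantor_mod_le i k s t : s <= t -> t - s <= delta (k + i)%N ->
  cantor k t - cantor k s <= 2 * 2 ^- i.
Proof.
elim: i k s t => [|i IHi] k s t st tk.
  by rewrite expr0 invr1; have := cantor_ge0 k s; have := cantor_le1 k t; lra.
have dk := delta_half k; have dki : delta (k + i.+1)%N <= delta k.+1.
  by apply: delta_le; lia.
rewrite !(cantor_rec k); rewrite -!addSnnS in tk dki.
have I1 := IHi _ _ _ st tk.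
have st' : s - gap k <= t - gap k by lra.
have /(IHi _ _ _ st') I2 : t - gap k - (s - gap k) <= delta (k.+1 + i)%N by lra.
rewrite !exprS !invfM.
have [t0|t0] := lerP t (gap k).
  rewrite [cantor _ (t - _)]cantor_eq0; last lra.
  by rewrite [cantor _ (s - _)]cantor_eq0; last lra; lra.
have [s1|s1] := lerP (delta k.+1) s.
  rewrite [cantor _ t]cantor_eq1; last lra.
  by rewrite [cantor _ s]cantor_eq1; last lra; lra.
have gk : delta k.+1 < gap k by rewrite /gap; lra.
have tlo : t - gap k <= delta (k.+1 + i)%N by lra.
have shi : delta k.+1 - delta (k.+1 + i)%N <= s by lra.
have := cantor_lo tlo; have := cantor_hi shi.
rewrite [cantor _ t]cantor_eq1; last lra.
rewrite [cantor _ (s - _)]cantor_eq0; last lra.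
by lra.
Qed.

Lemma cantor_mod i k s t : `|s - t| <= delta (k + i)%N ->
  `|cantor k s - cantor k t| <= 2 * 2 ^- i.
Proof.
have H x y : x <= y -> `|x - y| <= delta (k + i)%N ->
    `|cantor k x - cantor k y| <= 2 * 2 ^- i.
  move=> xy; rewrite distrC ger0_norm ?subr_ge0// => xyi.
  by rewrite distrC ger0_norm ?subr_ge0 ?cantor_mono// cantor_mod_le.
have [/H//|/H] := orP (le_total s t).
by rewrite (distrC t) (distrC (cantor k t)).
Qed.

(** Points where [psi] lies strictly between two consecutive multiples of [2 ^- i] belong to a
    single interval of generation [i]: comparing [l] with [2 ^ i] decides between the left and the
    right half. This is what bounds the length of a near-resonant set. *)
Lemma cantor_cell i k (l : nat) s t :
  l%:R < 2 ^+ i * cantor k s -> 2 ^+ i * cantor k s < l.+1%:R ->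
  l%:R < 2 ^+ i * cantor k t -> 2 ^+ i * cantor k t < l.+1%:R ->
  `|s - t| <= delta (k + i)%N.
Proof.
elim: i k l s t => [|i IHi] k l s t.
  rewrite expr0 !mul1r addn0 => ls sl lt tl.
  have l0 : l = 0%N.
    apply/eqP; rewrite -leqn0 leqNgt; apply/negP => l1.
    have : (1 : R) <= l%:R by rewrite ler1n.
    by have := cantor_le1 k s; lra.
  rewrite {}l0 in ls sl lt tl.
  have in0 x : 0 < cantor k x -> cantor k x < 1 -> 0 < x < delta k.
    move=> x0 x1; apply/andP; split; rewrite ltNge; apply/negP.
    by move/(cantor_eq0 k); lra.
  by move/cantor_eq1; lra.
  have /andP[? ?] := in0 _ ls sl; have /andP[? ?] := in0 _ lt tl.
  by rewrite ler_norml; lra.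
have dk := delta_half k.
have gk : delta k.+1 < gap k by rewrite /gap; lra.
have p0 : 0 < 2 ^+ i :> R by rewrite exprn_gt0.
rewrite !(cantor_rec k) !exprS -!addSnnS.
have E x : 2 * 2 ^+ i * ((cantor k.+1 x + cantor k.+1 (x - gap k)) / 2) =
  2 ^+ i * cantor k.+1 x + 2 ^+ i * cantor k.+1 (x - gap k) by field.
rewrite !E => ls sl lt tl.
have [li|li] := ltnP l (2 ^ i).
  have Z x : 2 ^+ i * cantor k.+1 x + 2 ^+ i * cantor k.+1 (x - gap k) < l.+1%:R ->
      cantor k.+1 (x - gap k) = 0.
    move=> xl; apply: cantor_eq0; rewrite leNgt; apply/negP => x0.
    have x1 : 0 <= 2 ^+ i * cantor k.+1 (x - gap k).
      by rewrite mulr_ge0 ?cantor_ge0// ltW.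
    have : l.+1%:R <= 2 ^+ i :> R by rewrite -natrX ler_nat.
    by move: xl; rewrite cantor_eq1; [lra|lra].
  have zs := Z _ sl; have zt := Z _ tl.
  rewrite zs zt !mulr0 !addr0 in ls sl lt tl.
  exact: IHi ls sl lt tl.
have Z x : l%:R < 2 ^+ i * cantor k.+1 x + 2 ^+ i * cantor k.+1 (x - gap k) ->
    cantor k.+1 x = 1.
  move=> xl; apply: cantor_eq1; rewrite leNgt; apply/negP => x0.
  have x1 : 2 ^+ i * cantor k.+1 x <= 2 ^+ i.
    by rewrite ler_piMr ?cantor_le1// ltW.
  have : 2 ^+ i <= l%:R :> R by rewrite -natrX ler_nat.
  by move: xl; rewrite [cantor _ (x - _)]cantor_eq0; [lra|lra].
have zs := Z _ ls; have zt := Z _ lt.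
rewrite zs zt !mulr1 in ls sl lt tl.
have El (a : R) : a - (l - 2 ^ i)%:R = a - l%:R + 2 ^+ i.
  by rewrite natrB// natrX; ring.
have : l.+1%:R = l%:R + 1 :> R by rewrite -[l.+1]addn1 natrD.
move=> El1.
have := IHi k.+1 (l - 2 ^ i)%N (s - gap k) (t - gap k).
have -> : s - gap k - (t - gap k) = s - t by ring.
apply.
- by rewrite natrB// natrX; lra.
- by rewrite -[(l - 2 ^ i).+1]addn1 natrD natrB// natrX; lra.
- by rewrite natrB// natrX; lra.
- by rewrite -[(l - 2 ^ i).+1]addn1 natrD natrB// natrX; lra.
Qed.

(** An interval longer than those of generation [i] is contained in none of them; followed down
    through the halves, it meets a gap or one of the two outer rays, where the function is
    constant. *)
Lemma cantor_locally_cst i k a b : a < b -> delta (k + i)%N < b - a ->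
  exists a' b', [/\ a <= a', a' < b', b' <= b &
    forall s t, a' < s < b' -> a' < t < b' -> cantor k s = cantor k t].
Proof.
elim: i k a b => [|i IHi] k a b ab kab.
  rewrite addn0 in kab; have [a0|a0] := ltrP a 0.
    exists a, (Num.min b 0); split=> //; first by rewrite lt_min ab.
      by rewrite ge_min lexx.
    move=> s t; rewrite !lt_min => /and3P[_ _ s0] /and3P[_ _ t0].
    by rewrite !cantor_eq0// ltW.
  exists (Num.max a (delta k)), b; split=> //; first by rewrite le_max lexx.
    by rewrite gt_max ab; lra.
  move=> s t; rewrite !gt_max => /andP[/andP[_ ?] _] /andP[/andP[_ ?] _].
  by rewrite !cantor_eq1// ltW.
have dk := delta_half k.
have gk : delta k.+1 < gap k by rewrite /gap; lra.
have dk0 := delta_gt0 k.+1.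
have [ag|ag] := ltrP a (gap k); last first.
  have := IHi k.+1 (a - gap k) (b - gap k).
  case; [lra|by rewrite addSnnS; lra|move=> a' [b' [aa' ab' bb' H]]].
  exists (a' + gap k), (b' + gap k); split; [lra|lra|lra|move=> s t sab tab].
  rewrite !(cantor_rec k) [cantor k.+1 s]cantor_eq1; last lra.
  rewrite [cantor k.+1 t]cantor_eq1; last lra.
  by congr ((_ + _) / _); apply: H; lra.
have [bd|bd] := lerP b (delta k.+1).
  have := IHi k.+1 a b ab.
  case; [by rewrite addSnnS; lra|move=> a' [b' [aa' ab' bb' H]]].
  exists a', b'; split=> // s t sab tab.
  rewrite !(cantor_rec k) ![cantor k.+1 (_ - _)]cantor_eq0; try lra.
  by congr ((_ + _) / _); apply: H; lra.
exists (Num.max a (delta k.+1)), (Num.min b (gap k)); split.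
- by rewrite le_max lexx.
- by rewrite gt_max !lt_min ab bd ag gk.
- by rewrite ge_min lexx.
move=> s t; rewrite !gt_max !lt_min.
move=> /andP[/andP[_ ?] /andP[_ ?]] /andP[/andP[_ ?] /andP[_ ?]].
rewrite !(cantor_rec k) ![cantor k.+1 (_ - _)]cantor_eq0; try lra.
by rewrite [cantor k.+1 s]cantor_eq1 1?[cantor k.+1 t]cantor_eq1//; lra.
Qed.

End cantor.

(** * Van der Corput's lemma *)

Section calculus.
Variable R : realType.
Implicit Types (f g P Phi w : R -> R) (a b t : R).

Lemma is_derive_continuous f t l : is_derive t 1 f l -> {for t, continuous f}.
Proof. by move=> [df _]; exact/differentiable_continuous/derivable1_diffP. Qed.

Lemma mvt_ex f f' a b : a <= b ->
  (forall t, a <= t <= b -> is_derive t 1 f (f' t)) ->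
  exists2 c, a <= c <= b & f b - f a = f' c * (b - a).
Proof.
move=> ab df; have [] := @MVT_segment R f f' a b ab.
- by move=> t; rewrite in_itv/= => /andP[? ?]; apply: df; rewrite !ltW.
- apply: continuous_in_subspaceT => t; rewrite inE/= in_itv/= => /df.
  exact: is_derive_continuous.
by move=> c; rewrite in_itv/= => cab fE; exists c.
Qed.

Lemma mvt_bound f f' a b M : a <= b ->
  (forall t, a <= t <= b -> is_derive t 1 f (f' t)) ->
  (forall t, a <= t <= b -> `|f' t| <= M) ->
  `|f b - f a| <= M * (b - a).
Proof.
move=> ab df fM; have [c cab ->] := mvt_ex ab df.
by rewrite normrM (ger0_norm (_ : 0 <= b - a)) ?subr_ge0// ler_wpM2r ?subr_ge0// fM.
Qed.

Lemma mvt_cst f a b : a <= b ->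
  (forall t, a <= t <= b -> is_derive t 1 f 0) -> f a = f b.
Proof.
move=> ab df; have [c _ /eqP] := mvt_ex ab df.
by rewrite mul0r subr_eq0 => /eqP ->.
Qed.

Section van_der_corput.
Variables (P Phi w : R -> R).

(* The boundary term [sin Phi / w] is an approximate primitive of [cos Phi];
   the error is controlled by the variation of [1 / w] alone. *)
Let Z t := P t - (w t)^-1 * sin (Phi t).

(** In the application [w] is built from a Cantor function, so integration by parts must not
    differentiate it. Instead [1 / w] is frozen at its value in [y]: the change of the factor at [x]
    accounts for the summand 1, the mismatch of the derivatives for [L * (y - x)]. *)
Lemma vdc_increment x y L : x <= y ->
  (forall t, x <= t <= y -> is_derive t 1 P (cos (Phi t))) ->
  (forall t, x <= t <= y -> is_derive t 1 Phi (w t)) ->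
  (forall t, x <= t <= y -> w t != 0) ->
  (forall t, x <= t <= y -> `|w t| <= L) ->
  (forall s t, x <= s -> s <= t -> t <= y -> (w s)^-1 <= (w t)^-1) ->
  `|Z y - Z x| <= ((w y)^-1 - (w x)^-1) * (1 + L * (y - x)).
Proof.
move=> xy dP dPhi w0 wL wm.
have -> : Z y - Z x = (P y - (w y)^-1 * sin (Phi y)
  - (P x - (w y)^-1 * sin (Phi x))) - ((w y)^-1 - (w x)^-1) * sin (Phi x).
  by rewrite /Z; ring.
have gxy : 0 <= (w y)^-1 - (w x)^-1 by rewrite subr_ge0 wm.
rewrite mulrDr mulr1 [leRHS]addrC (le_trans (ler_normB _ _))// lerD//; last first.
  rewrite normrM ger0_norm// ler_piMr// ler_norml.
  by rewrite sin_geN1 sin_le1.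
pose F t := P t - (w y)^-1 * sin (Phi t).
rewrite mulrA -[X in `|X|]/(F y - F x).
apply: (@mvt_bound F (fun t => cos (Phi t) * (w t) * ((w t)^-1 - (w y)^-1))) => //.
  move=> t txy; have := dP t txy; have := dPhi t txy => dPhit dPt.
  apply: is_derive_eq; rewrite /GRing.scale /= mulrBr mulfK ?w0//.
  by ring.
move=> t /[dup] txy /andP[xt ty]; rewrite -mulrA normrM.
rewrite -[leRHS]mul1r ler_pM//; first by rewrite ler_norml cos_geN1 cos_le1.
rewrite normrM mulrC ler_pM// ?wL//.
rewrite distrC ger0_norm ?subr_ge0 ?wm// lerD2l lerN2 wm//.
Qed.

(** Under bisection the increments of [1 / w] telescope, whereas the excess [L * (y - x)] is halved
    each time and disappears in the limit. *)
Lemma vdc_bisect k x y L : x <= y -> 0 <= L ->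
  (forall t, x <= t <= y -> is_derive t 1 P (cos (Phi t))) ->
  (forall t, x <= t <= y -> is_derive t 1 Phi (w t)) ->
  (forall t, x <= t <= y -> w t != 0) ->
  (forall t, x <= t <= y -> `|w t| <= L) ->
  (forall s t, x <= s -> s <= t -> t <= y -> (w s)^-1 <= (w t)^-1) ->
  `|Z y - Z x| <= ((w y)^-1 - (w x)^-1) * (1 + L * (y - x) * 2 ^- k).
Proof.
elim: k x y => [|k IHk] x y xy L0 dP dPhi w0 wL wm.
  by rewrite expr0 invr1 mulr1; exact: vdc_increment.
pose z := (x + y) / 2; have [xz zy] : x <= z /\ z <= y by rewrite /z; lra.
have H1 := IHk x z xz L0; have H2 := IHk z y zy L0.
have yz : y - z = (y - x) / 2 by rewrite /z; field.
have zx : z - x = (y - x) / 2 by rewrite /z; field.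
rewrite yz in H2; rewrite zx in H1.
have E : L * ((y - x) / 2) * 2 ^- k = L * (y - x) * 2 ^- k.+1.
  by rewrite exprS invfM; ring.
rewrite E in H1 H2.
have -> : Z y - Z x = (Z y - Z z) + (Z z - Z x) by ring.
rewrite (le_trans (ler_normD _ _))//.
rewrite (_ : _^-1 - _ = ((w y)^-1 - (w z)^-1) + ((w z)^-1 - (w x)^-1)); last ring.
rewrite mulrDl lerD//.
  apply: H2 => [t /andP[? ?]|t /andP[? ?]|t /andP[? ?]|t /andP[? ?]|s t zs st ty].
  - by apply: dP; lra.
  - by apply: dPhi; lra.
  - by apply: w0; lra.
  - by apply: wL; lra.
  - by apply: wm => //; lra.
apply: H1 => [t /andP[? ?]|t /andP[? ?]|t /andP[? ?]|t /andP[? ?]|s t zs st ty].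
- by apply: dP; lra.
- by apply: dPhi; lra.
- by apply: w0; lra.
- by apply: wL; lra.
- by apply: wm => //; lra.
Qed.

Lemma vdc_mono x y L : x <= y ->
  (forall t, x <= t <= y -> is_derive t 1 P (cos (Phi t))) ->
  (forall t, x <= t <= y -> is_derive t 1 Phi (w t)) ->
  (forall t, x <= t <= y -> w t != 0) ->
  (forall t, x <= t <= y -> `|w t| <= L) ->
  (forall s t, x <= s -> s <= t -> t <= y -> (w s)^-1 <= (w t)^-1) ->
  `|Z y - Z x| <= (w y)^-1 - (w x)^-1.
Proof.
move=> xy dP dPhi w0 wL wm.
have L0 : 0 <= L by rewrite (le_trans (normr_ge0 (w x)))// wL// lexx.
set D := (w y)^-1 - (w x)^-1.
have : D * (1 + L * (y - x) * 2 ^- k) @[k --> \oo] --> D * (1 + L * (y - x) * 0).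
  apply: cvgMl_tmp; apply: cvgD; first exact: cvg_cst.
  apply: cvgMl_tmp; under eq_fun do rewrite -exprVn.
  by apply: cvg_expr; rewrite ger0_norm; lra.
rewrite mulr0 addr0 mulr1; move=> /(cvgr_to_ge); apply.
by near=> k; exact: vdc_bisect.
Unshelve. all: by end_near. Qed.

End van_der_corput.

End calculus.

Section van_der_corput_monotone.
Variables (R : realType) (P Phi w : R -> R) (a b : R).
Hypothesis dP : forall t, a <= t <= b -> is_derive t 1 P (cos (Phi t)).
Hypothesis dPhi : forall t, a <= t <= b -> is_derive t 1 Phi (w t).
Hypothesis wm : forall s t, a <= s -> s <= t -> t <= b -> w s <= w t.

Lemma vdc_boundary x y : a <= x -> x <= y -> y <= b -> 0 < w x * w y ->
  `|P y - P x - ((w y)^-1 * sin (Phi y) - (w x)^-1 * sin (Phi x))|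
    <= (w x)^-1 - (w y)^-1.
Proof.
move=> ax xy yb wxy.
have wxy1 : (forall t, x <= t <= y -> 0 < w t) \/
            (forall t, x <= t <= y -> w t < 0).
  have [wx|wx] := ltrP 0 (w x); [left|right] => t /andP[xt ty].
    by have := wm ax xt (le_trans ty yb); lra.
  have wy : w y < 0.
    rewrite ltNge; apply/negP => wy; have : w x * w y <= 0.
      exact: mulr_le0_ge0.
    by lra.
  by have := wm (le_trans ax xt) ty yb; lra.
have wn0 t : x <= t <= y -> w t != 0.
  by move=> txy; case: wxy1 => /(_ t txy) => [/gt_eqF ->|/lt_eqF ->].
have in_ t : x <= t <= y -> a <= t <= b.
  by move=> /andP[xt ty]; rewrite (le_trans ax xt) (le_trans ty yb).
(* On an interval of constant sign the inverse of the nondecreasing [w] is nonincreasing, the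
   opposite of what [vdc_mono] asks. Changing the sign of the phase reverses this and leaves the
   cosine unchanged. *)
have H : `|P y - (- w y)^-1 * sin (- Phi y) - (P x - (- w x)^-1 * sin (- Phi x))|
    <= (- w y)^-1 - (- w x)^-1; last first.
  move: H; rewrite !invrN !sinN !mulrNN opprK addrC [leRHS]addrC.
  by congr (`|_| <= _); ring.
apply: (@vdc_mono R P (fun t => - Phi t) (fun t => - w t) x y
  (`|w x| + `|w y|) xy).
- by move=> t /in_ tab; rewrite cosN; exact: dP.
- by move=> t /in_ tab; have := dPhi tab => dPhit; apply: is_derive_eq.
- by move=> t /wn0; rewrite oppr_eq0.
- move=> t /andP[xt ty]; rewrite normrN ler_norml.
  have := wm ax xt (le_trans ty yb); have := wm (le_trans ax xt) ty yb.
  have := ler_norm (w y); have := ler_norm (- w x); rewrite normrN.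
  by have := normr_ge0 (w x); have := normr_ge0 (w y); lra.
- move=> s t xs st ty; rewrite !invrN lerN2.
  have wst : w s <= w t by apply: wm; lra.
  have sxy : x <= s <= y by lra.
  have txy : x <= t <= y by lra.
  case: wxy1 => wxy1.
    by rewrite lef_pV2// posrE wxy1.
  by rewrite lef_nV2// negrE wxy1.
Qed.

Lemma vdc_far x y rho : a <= x -> x <= y -> y <= b -> 0 < rho ->
  rho <= w x \/ w y <= - rho -> `|P y - P x| <= 2 / rho.
Proof.
move=> ax xy yb rho0 wr.
have wxy := wm ax xy yb.
have w0 : 0 < w x * w y.
  case: wr => wr; first by rewrite mulr_gt0; lra.
  by rewrite -mulrNN mulr_gt0; lra.
have := vdc_boundary ax xy yb w0.
set p := P y - P x; set u := (w y)^-1; set v := (w x)^-1.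
have su : `|u * sin (Phi y)| <= `|u|.
  by rewrite normrM ler_piMr// ler_norml sin_geN1 sin_le1.
have sv : `|v * sin (Phi x)| <= `|v|.
  by rewrite normrM ler_piMr// ler_norml sin_geN1 sin_le1.
move=> H.
have : `|p| <= v - u + (`|u| + `|v|).
  rewrite -[p](subrK (u * sin (Phi y) - v * sin (Phi x))).
  rewrite (le_trans (ler_normD _ _))// lerD// (le_trans (ler_normB _ _))//.
  exact: lerD.
move/le_trans; apply.
case: wr => wr.
  have u0 : 0 < u by rewrite invr_gt0; lra.
  have v0 : 0 < v by rewrite invr_gt0; lra.
  have : v <= rho^-1 by rewrite lef_pV2 ?posrE; lra.
  by rewrite !gtr0_norm//; lra.
have u0 : u < 0 by rewrite invr_lt0; lra.
have v0 : v < 0 by rewrite invr_lt0; lra.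
have : - u <= rho^-1 by rewrite -invrN lef_pV2 ?posrE; lra.
by rewrite !ltr0_norm//; lra.
Qed.

Hypothesis wc : forall t, a <= t <= b -> {for t, continuous w}.

(** The alternatives [t = a] and [t = b] cover the levels outside the range of [w], for which one of
    the two sides is empty. *)
Lemma mono_split x : a <= b -> exists2 t, a <= t <= b &
  (t = a \/ forall s, a <= s <= t -> w s <= x) /\
  (t = b \/ forall s, t <= s <= b -> x <= w s).
Proof.
move=> ab; have [xa|xa] := lerP x (w a).
  exists a; rewrite ?lexx//; split; [by left|right] => s /andP[as_ sb].
  by rewrite (le_trans xa)// wm// lexx.
have [bx|bx] := lerP (w b) x.
  exists b; rewrite ?lexx ?andbT//; split; [right|by left] => s /andP[as_ sb].
  by rewrite (le_trans _ bx)// wm// lexx.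
have [||c] := @IVT R w a b x ab.
- apply: continuous_in_subspaceT => t; rewrite inE/= in_itv/=; exact: wc.
- by rewrite ge_min le_max (ltW xa) (ltW bx) orbT.
rewrite in_itv/= => /andP[ac cb] cx; exists c; rewrite ?ac ?cb//.
by split; right => s /andP[? ?]; rewrite -cx wm.
Qed.

(** Each outer part has [|w| >= rho] and costs [2 / rho]; on the middle part the cosine is bounded
    by 1. The middle interval itself is returned, because only the structure of [w] can bound its
    length. *)
Lemma vdc_near rho : a <= b -> 0 < rho -> exists t0 t1,
  [/\ a <= t0, t0 <= t1, t1 <= b, `|P b - P a| <= t1 - t0 + 4 / rho &
    forall s, t0 < s < t1 -> `|w s| <= rho].
Proof.
move=> ab rho0.
have [t0 /andP[at0 t0b] [t0l t0r]] := mono_split (- rho) ab.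
have [t1' /andP[at1' t1'b] [t1l t1r]] := mono_split rho ab.
(* The maximum gives [t0 <= t1] without comparing the two independent splittings. *)
pose t1 := Num.max t0 t1'.
have t01 : t0 <= t1 by rewrite /t1 le_max lexx.
have t1b : t1 <= b by rewrite /t1 ge_max t0b.
have P0 : `|P t0 - P a| <= 2 / rho.
  case: t0l => [->|t0l]; first by rewrite subrr normr0 divr_ge0// ltW.
  by apply: vdc_far => //; right; apply: t0l; rewrite at0 lexx.
have P2 : `|P b - P t1| <= 2 / rho.
  case: t1r => [t1E|t1r].
    rewrite (_ : t1 = b) ?subrr ?normr0; last first.
      by apply/eqP; rewrite eq_le t1b /t1 t1E le_max lexx orbT.
    by rewrite divr_ge0// ltW.
  apply: vdc_far => //; first by rewrite (le_trans at0).
  by left; apply: t1r; rewrite t1b /t1 le_max lexx orbT.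
have P1 : `|P t1 - P t0| <= t1 - t0.
  rewrite -[leRHS]mul1r; apply: (@mvt_bound R P (fun t => cos (Phi t))) => //.
    by move=> t /andP[? ?]; apply: dP; lra.
  by move=> t _; rewrite ler_norml cos_geN1 cos_le1.
exists t0, t1; split=> //.
  rewrite (_ : P b - P a = (P b - P t1) + (P t1 - P t0) + (P t0 - P a)); last ring.
  rewrite (le_trans (ler_normD _ _))//.
  have := ler_normD (P b - P t1) (P t1 - P t0); lra.
move=> s; rewrite /t1 lt_max => /andP[t0s /orP[|st1]].
  by move=> /(lt_trans t0s); rewrite ltxx.
rewrite ler_norml; apply/andP; split.
  case: t0r => [t0E|]; first by move: t0s; rewrite t0E; lra.
  by apply; lra.
case: t1l => [t1E|]; first by move: st1; rewrite t1E; lra.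
by apply; lra.
Qed.

End van_der_corput_monotone.

Section decay_profile.
Variable R : realType.
Implicit Types e d x : R.

(* [kap e d] is [min e (1/d)], with value [e] at [d = 0]. *)
Definition kap e d : R := (Num.max e^-1 d)^-1.

Lemma kap_ge e d x : 0 < e -> 0 <= d -> x <= e -> (0 < d -> x <= d^-1) -> x <= kap e d.
Proof.
move=> e0 d0 xe xd; rewrite /kap; case: (leP e^-1 d) => ed.
  by apply: xd; rewrite (lt_le_trans _ ed)// invr_gt0.
by rewrite invrK.
Qed.

Lemma kap_ge0 e d : 0 < e -> 0 <= kap e d.
Proof. by move=> e0; rewrite invr_ge0 le_max invr_ge0 ltW. Qed.

Lemma kap_le e d : 0 < e -> kap e d <= e.
Proof.
move=> e0; rewrite /kap -[leRHS]invrK lef_pV2 ?posrE ?lt_max ?invr_gt0 ?e0//.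
by rewrite le_max lexx.
Qed.

Lemma kap_le_inv e d : 0 < e -> 0 < d -> kap e d <= d^-1.
Proof.
move=> e0 d0; rewrite /kap lef_pV2 ?posrE// ?lt_max ?d0 ?orbT//.
by rewrite le_max lexx orbT.
Qed.

Lemma kap_ninc e d d' : 0 < e -> d <= d' -> kap e d' <= kap e d.
Proof.
move=> e0 dd; rewrite /kap lef_pV2 ?posrE ?lt_max ?invr_gt0 ?e0//.
by rewrite ge_max !le_max lexx dd orbT.
Qed.

End decay_profile.

(** * Covering by the intervals of one generation *)

Section cantor_covering.
Variables (R : realType) (delta : nat -> R).
Hypothesis delta_gt0 : forall k, 0 < delta k.
Hypothesis delta_half : forall k, 2 * delta k.+1 < delta k.
Local Notation psi := (cantor delta).

(* Left end points of the intervals of generation [i]. *)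
Fixpoint cantor_ends (k i : nat) : seq R :=
  if i is j.+1 then
    cantor_ends k.+1 j ++ [seq a + gap delta k | a <- cantor_ends k.+1 j]
  else [:: 0].

Lemma size_cantor_ends k i : size (cantor_ends k i) = (2 ^ i)%N.
Proof.
by elim: i k => //= i IHi k; rewrite size_cat size_map IHi expnS; lia.
Qed.

(** If neither half has its argument in a covering interval, the average of two multiples of
    [2 ^- i] is a multiple of [2 ^- i.+1]. *)
Lemma cantor_endsP k i t :
  (exists2 a, a \in cantor_ends k i & a <= t <= a + delta (k + i)%N) \/
  exists2 l : nat, (l <= 2 ^ i)%N & 2 ^+ i * psi k t = l%:R.
Proof.
elim: i k t => [|i IHi] k t.
  rewrite addn0 expr0 expn0.
  have [t0|t0] := ltrP t 0.
    by right; exists 0%N => //; rewrite cantor_eq0// ?mulr0// ltW.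
  have [t1|t1] := ltrP (delta k) t.
    by right; exists 1%N => //; rewrite cantor_eq1// ?mulr1// ltW.
  by left; exists 0; rewrite ?mem_head// add0r t0.
have [[a am at_]|[l1 l1i E1]] := IHi k.+1 t.
  by left; exists a; rewrite ?mem_cat ?am// addnS -addSn.
have [[a am at_]|[l2 l2i E2]] := IHi k.+1 (t - gap delta k).
  left; exists (a + gap delta k).
    by rewrite mem_cat; apply/orP; right; apply/mapP; exists a.
  by rewrite addnS -addSn; lra.
right; exists (l1 + l2)%N; first by rewrite expnS; lia.
by rewrite natrD -E1 -E2 (cantor_rec delta_gt0 delta_half k) exprS; field.
Qed.

Lemma delta_le_expn k i : delta (k + i)%N <= delta k * 2 ^- i.
Proof.
elim: i => [|i IHi]; first by rewrite addn0 expr0 invr1 mulr1.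
by rewrite addnS exprS invfM; have := delta_half (k + i)%N; lra.
Qed.

Lemma cantor_continuous k : continuous (psi k).
Proof.
move=> t; apply/cvgrPdist_lt => e e0.
have [i ie] : exists i, 2 * 2 ^- i < e.
  have H : (2 * 2 ^- i @[i --> \oo] --> (2 : R) * 0).
    apply: cvgMl_tmp; under eq_fun do rewrite -exprVn.
    by apply: cvg_expr; rewrite ger0_norm; lra.
  rewrite mulr0 in H; have /cvgrPdist_lt /(_ e e0) [i _ /(_ i (leqnn i))] := H.
  rewrite /= sub0r normrN ger0_norm; first by exists i.
  by rewrite mulr_ge0// invr_ge0 exprn_ge0.
exists (delta (k + i)%N) => //= s ts; apply: le_lt_trans ie.
by apply: cantor_mod => //; exact: ltW.
Qed.

End cantor_covering.

(** * Oscillatory integrals with a Cantor phase derivative *)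

Section quarter.
Variables (R : realType) (delta : nat -> R).
Hypothesis delta_gt0 : forall k, 0 < delta k.
Hypothesis delta_half : forall k, 2 * delta k.+1 < delta k.
Local Notation psi := (cantor delta).
Variables (L : nat) (N theta : R) (P Phi : R -> R).
Hypothesis N0 : 0 <= N.
Hypothesis dP : forall t, 0 <= t <= delta L -> is_derive t 1 P (cos (Phi t)).
Hypothesis dPhi : forall t, 0 <= t <= delta L ->
  is_derive t 1 Phi (N * psi L t - theta).

Local Notation D := (`|P (delta L) - P 0|).
Local Notation w := (fun t => N * psi L t - theta).

Let wm s t : 0 <= s -> s <= t -> t <= delta L -> w s <= w t.
Proof. by move=> _ st _; rewrite lerD2r ler_wpM2l// cantor_mono. Qed.

Let wc t : 0 <= t <= delta L -> {for t, continuous w}.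
Proof.
move=> _; apply: cvgB; last exact: cvg_cst.
by apply: cvgMl_tmp; exact: cantor_continuous.
Qed.

Lemma quarter_trivial : D <= delta L.
Proof.
have := delta_gt0 L => dL; rewrite -[leRHS]mul1r -[X in _ * X]subr0.
apply: (mvt_bound (f' := fun t => cos (Phi t))) => //; first exact: ltW.
by move=> t _; rewrite ler_norml cos_geN1 cos_le1.
Qed.

(** Here [l] is the lattice point nearest to [theta], while [l0] indexes the cell containing
    [theta]; the last two inequalities put both ends of that cell at least as far away as [l]. For
    [theta = N] the distance is 0 and the cell to the right of [N] serves. *)
Lemma lattice_near i : 0 <= theta <= N -> exists l0 l : nat,
  [/\ (l <= 2 ^ i)%N, `|theta - N / 2 ^+ i * l%:R| <= N / 2 ^+ i,
   N / 2 ^+ i * l0%:R + `|theta - N / 2 ^+ i * l%:R| <= theta &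
   theta <= N / 2 ^+ i * l0.+1%:R - `|theta - N / 2 ^+ i * l%:R|].
Proof.
move=> /andP[t0 tN]; set q := N / 2 ^+ i.
have p0 : 0 < 2 ^+ i :> R by rewrite exprn_gt0.
have [q0|q0] := ltrP 0 q; last first.
  have N00 : N = 0.
    apply/eqP; rewrite eq_le N0 andbT leNgt; apply/negP => N1.
    by have := divr_gt0 N1 p0; rewrite ltNge q0.
  have -> : q = 0 by rewrite /q N00 mul0r.
  by exists 0%N, 0%N; rewrite !mul0r subr0 ger0_norm//; split=> //; lra.
have qE : q * 2 ^+ i = N by rewrite /q mulfVK// gt_eqF.
have [tN'|Nt] := ltrP theta N; last first.
  have -> : theta = N by apply/eqP; rewrite eq_le tN.
  exists (2 ^ i)%N, (2 ^ i)%N; rewrite natrX qE subrr normr0; split=> //.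
  - exact: ltW.
  - by rewrite addr0.
  - by rewrite -addn1 natrD natrX mulrDr qE; lra.
have x0 : 0 <= theta / q by rewrite divr_ge0// ltW.
pose l0 := Num.truncn (theta / q).
have := truncn_itv x0; rewrite -/l0 => /andP[l0x xl0].
have l0t : q * l0%:R <= theta by rewrite mulrC -ler_pdivlMr.
have tl0 : theta < q * l0.+1%:R by rewrite mulrC -ltr_pdivrMr.
have l0i : (l0 < 2 ^ i)%N.
  rewrite -(ltr_nat R) natrX -(ltr_pM2l q0) qE; lra.
have l0E : q * l0.+1%:R = q * l0%:R + q by rewrite -addn1 natrD; ring.
have [h|h] := lerP (theta - q * l0%:R) (q * l0.+1%:R - theta).
  exists l0, l0; rewrite ger0_norm ?subr_ge0//; split; [exact: ltnW|lra|lra|lra].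
exists l0, l0.+1; rewrite ler0_norm; last lra.
by split; [by []|lra|lra|lra].
Qed.

Lemma quarter_out : ~~ (0 <= theta <= N) -> exists2 l : nat, (l <= 1)%N &
  0 < `|theta - N * l%:R| /\ D <= 2 / `|theta - N * l%:R|.
Proof.
have dL := delta_gt0 L; have z0 : w 0 = - theta.
  by rewrite cantor_eq0// mulr0 sub0r.
have zd : w (delta L) = N - theta by rewrite cantor_eq1// mulr1.
rewrite negb_and -!ltNge => /orP[t0|tN].
  exists 0%N => //; rewrite mulr0 subr0 ltr0_norm// oppr_gt0; split=> //.
  apply: (vdc_far dP dPhi wm) => //; [exact: ltW|lra|left].
  by rewrite z0.
exists 1%N => //; rewrite mulr1 gtr0_norm ?subr_gt0//; split=> //.
apply: (vdc_far dP dPhi wm) => //; [exact: ltW|lra|right].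
by rewrite zd; lra.
Qed.

(** Van der Corput is applied with [rho] equal to half the distance [d] from [theta] to the lattice.
    On the middle interval [N * psi] then stays strictly inside one lattice cell, so [cantor_cell]
    bounds its length by [delta (L + i)], and [4 / rho] becomes [8 / d]. *)
Lemma quarter_cell i : exists2 l : nat, (l <= 2 ^ i)%N &
  (0 < `|theta - N / 2 ^+ i * l%:R| ->
    D <= delta (L + i)%N + 8 / `|theta - N / 2 ^+ i * l%:R|) /\
  (0 <= theta <= N -> `|theta - N / 2 ^+ i * l%:R| <= N / 2 ^+ i).
Proof.
have p0 : 0 < 2 ^+ i :> R by rewrite exprn_gt0.
have [inN|/[dup] outN /quarter_out [l l1 [d0 Dl]]] := boolP (0 <= theta <= N); last first.
  have E : N / 2 ^+ i * (2 ^ i * l)%N%:R = N * l%:R.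
    by rewrite natrM natrX; field; rewrite gt_eqF.
  exists (2 ^ i * l)%N; first by rewrite -[leqRHS]muln1 leq_mul2l l1 orbT.
  rewrite E; split=> // _; have := delta_gt0 (L + i)%N.
  have di : 0 < `|theta - N * l%:R|^-1 by rewrite invr_gt0.
  by lra.
have [l0 [l [li dq l0t tl0]]] := lattice_near i inN.
exists l => //; split=> // d0.
move: d0 l0t tl0 {dq}; set d := `|_|; set q := N / 2 ^+ i => d0 l0t tl0.
have d20 : 0 < d / 2 by lra.
have [t0 [t1 [t0_ t01 t1_ DP near]]] :=
  vdc_near dP dPhi wm wc (ltW (delta_gt0 L)) d20.
have q0 : 0 < q.
  have : q * l0%:R + d + d <= q * l0.+1%:R by lra.
  by rewrite -addn1 natrD mulrDr mulr1; lra.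
have psE s : 2 ^+ i * psi L s = (N * psi L s) / q.
  rewrite /q; field; rewrite gt_eqF//=; apply/eqP => N00.
  by move: q0; rewrite /q N00 mul0r ltxx.
have cell s : t0 < s < t1 ->
    l0%:R < 2 ^+ i * psi L s /\ 2 ^+ i * psi L s < l0.+1%:R.
  move=> /near; rewrite ler_norml psE => /andP[? ?].
  by rewrite ltr_pdivlMr// ltr_pdivrMr// [_ * q]mulrC [_ * q]mulrC; lra.
have dt : t1 - t0 <= delta (L + i)%N.
  rewrite leNgt; apply/negP => lt.
  (* Only interior points are known to be near-resonant; moving in by a quarter of the excess leaves
     two of them still further apart than [delta (L + i)]. *)
  pose e := (t1 - t0 - delta (L + i)%N) / 4.
  have dLi := delta_gt0 (L + i)%N.
  have e0 : 0 < e by rewrite /e; lra.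
  have s1 : t0 < t0 + e < t1 by rewrite /e; lra.
  have s2 : t0 < t1 - e < t1 by rewrite /e; lra.
  have [a1 a2] := cell _ s1; have [b1 b2] := cell _ s2.
  have := cantor_cell delta_gt0 delta_half b1 b2 a1 a2.
  by rewrite ler_norml /e; lra.
apply: (le_trans DP); rewrite lerD//.
by rewrite invfM invrK mulrA mulrAC -natrM.
Qed.

(** With [d i] the distance to the chosen point of the lattice of generation [i], take the first [i]
    such that [delta (L + i) * d i <= 1]; the hypothesis on [I] makes it exist. At generation [i]
    the term [8 / d i] dominates and gives [9 / d i]; at generation [i.-1] the reverse inequality
    holds and gives [9 * delta (L + i.-1)]. For [i = 0] the trivial bound [delta L] replaces the
    latter. *)
Lemma quarter_multiscale I : N / 2 ^+ I * delta (L + I)%N <= 1 ->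
  exists i l, [/\ (i <= I)%N, (l <= 2 ^ i)%N &
    D <= 9 * kap (delta (L + i.-1)%N) `|theta - N / 2 ^+ i * l%:R|].
Proof.
move=> NI; have dL := delta_gt0 L.
have /choice[f fP] : forall i, exists l : nat, (l <= 2 ^ i)%N /\
  ((0 < `|theta - N / 2 ^+ i * l%:R| ->
    D <= delta (L + i)%N + 8 / `|theta - N / 2 ^+ i * l%:R|) /\
  (0 <= theta <= N -> `|theta - N / 2 ^+ i * l%:R| <= N / 2 ^+ i)).
  by move=> i; have [l li Dl] := quarter_cell i; exists l.
pose d i := `|theta - N / 2 ^+ i * (f i)%:R|.
have d0 i : 0 <= d i by exact: normr_ge0.
have [inN|/[dup] outN /quarter_out [l l1 [dl Dl]]] := boolP (0 <= theta <= N); last first.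
  exists 0%N, l; split=> //; rewrite expr0 divr1 addn0 mulrC -ler_pdivrMr//.
  have D9 : D / 9 <= D by have := normr_ge0 (P (delta L) - P 0); lra.
  apply: kap_ge => //; first by rewrite (le_trans D9) ?quarter_trivial.
  by move=> dl'; rewrite ler_pdivrMr// (le_trans Dl)// mulrC ler_wpM2l ?invr_ge0//; lra.
have ex : exists i, delta (L + i)%N * d i <= 1.
  exists I; rewrite (le_trans _ NI)// mulrC ler_wpM2r//; first exact: ltW.
  by have [_ [_ ->]] := fP I.
case: (ex_minnP ex) => i iP imin.
have iI : (i <= I)%N.
  apply: imin; rewrite (le_trans _ NI)// mulrC ler_wpM2r//; first exact: ltW.
  by have [_ [_ ->]] := fP I.
exists i, (f i); have [fi [Di _]] := fP i; split=> //.
rewrite -/(d i) in Di *; rewrite mulrC -ler_pdivrMr//.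
have dLi := delta_gt0 (L + i)%N.
case: i iP imin iI fi Di dLi => [|i] iP imin iI fi Di dLi.
  rewrite addn0 in iP Di dLi *.
  have D9 : D / 9 <= delta L.
    by have := quarter_trivial; have := normr_ge0 (P (delta L) - P 0); lra.
  apply: kap_ge => // d0'; apply: (le_trans D9).
  by rewrite -[leRHS]mul1r ler_pdivlMr.
have [_ [Di' _]] := fP i; rewrite -/(d i) in Di'.
have dL1 := delta_gt0 (L + i)%N.
have iP' : 1 < delta (L + i)%N * d i.
  rewrite ltNge; apply/negP => /imin; lia.
have di0 : 0 < d i.
  by rewrite lt0r d0 andbT; apply: contraTneq iP' => ->; rewrite mulr0 ltr10.
rewrite /=; apply: kap_ge => //.
  rewrite ler_pdivrMr// (le_trans (Di' di0))//.
  have : (d i)^-1 <= delta (L + i)%N.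
    by rewrite -[leLHS]mul1r ler_pdivrMr// ltW.
  by lra.
move=> di1; rewrite ler_pdivrMr// (le_trans (Di di1))//.
have : delta (L + i.+1)%N <= (d i.+1)^-1.
  by rewrite -[leRHS]mul1r ler_pdivlMr.
by lra.
Qed.

(** The radius is [min(d / 2, rho)], whose inverse is at most [2 / d + 1 / rho]. Radius [d / 2]
    keeps [N * psi] off the lattice, which forces the resonant points into the intervals of
    generation [i]; radius [rho] limits the number of frequencies for which a given point is
    resonant. The length [t1 - t0] is left in the bound, to be summed over the frequencies. If
    [d < 1], the trivial bound [D <= 1] suffices. *)
Lemma quarter_single_scale i rho : 0 < rho -> delta L <= 1 ->
  exists l : nat, exists t0 t1, [/\ (l <= 2 ^ i)%N, t0 <= t1,
    D <= 8 * kap 1 `|theta - N / 2 ^+ i * l%:R| + 4 / rho + (t1 - t0) &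
    forall s, t0 < s < t1 -> `|N * psi L s - theta| <= rho /\
      exists2 a, a \in cantor_ends delta L i & a <= s <= a + delta (L + i)%N].
Proof.
move=> rho0 dL1; have dL := delta_gt0 L.
have p0 : 0 < 2 ^+ i :> R by rewrite exprn_gt0.
have triv (l : nat) : (l <= 2 ^ i)%N ->
    D <= 8 * kap 1 `|theta - N / 2 ^+ i * l%:R| ->
  exists l : nat, exists t0 t1, [/\ (l <= 2 ^ i)%N, t0 <= t1,
    D <= 8 * kap 1 `|theta - N / 2 ^+ i * l%:R| + 4 / rho + (t1 - t0) &
    forall s, t0 < s < t1 -> `|N * psi L s - theta| <= rho /\
      exists2 a, a \in cantor_ends delta L i & a <= s <= a + delta (L + i)%N].
  move=> li H; exists l, 0, 0; split=> //; last by move=> s /andP[s0 s1]; lra.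
  by rewrite subrr addr0 (le_trans H)// lerDl divr_ge0// ltW.
have [inN|/[dup] outN /quarter_out [l l1 [dl Dl]]] := boolP (0 <= theta <= N); last first.
  have E : N / 2 ^+ i * (2 ^ i * l)%N%:R = N * l%:R.
    by rewrite natrM natrX; field; rewrite gt_eqF.
  apply: (@triv (2 ^ i * l)%N); first by rewrite -[leqRHS]muln1 leq_mul2l l1 orbT.
  rewrite E mulrC -ler_pdivrMr//; apply: kap_ge => //.
    by rewrite ler_pdivrMr// (le_trans quarter_trivial); lra.
  by move=> dl'; rewrite ler_pdivrMr// (le_trans Dl)// mulrC ler_wpM2l ?invr_ge0//; lra.
have [l0 [l [li _ l0t tl0]]] := lattice_near i inN.
move: l0t tl0 (triv l li); set d := `|_|; set q := N / 2 ^+ i => l0t tl0 {}triv.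
have [d1|d1] := ltrP d 1.
  apply: triv; rewrite mulrC -ler_pdivrMr//.
  have D8 : D / 8 <= 1 by rewrite ler_pdivrMr// (le_trans quarter_trivial); lra.
  apply: kap_ge => //; first exact: normr_ge0.
  by move=> d0; rewrite (le_trans D8)// invf_ge1 ?ltW.
pose r := Num.min (d / 2) rho.
have r0 : 0 < r by rewrite lt_min rho0 andbT; lra.
have [t0 [t1 [t0_ t01 t1_ DP near]]] :=
  vdc_near dP dPhi wm wc (ltW (delta_gt0 L)) r0.
exists l, t0, t1; split=> //.
  have r_inv : r^-1 <= 2 * d^-1 + rho^-1.
    have := invr_ge0 d; have := invr_ge0 rho; rewrite (ltW rho0) (normr_ge0 _).
    rewrite /r; case: (leP (d / 2) rho) => _ h1 h2; last by lra.
    by rewrite invfM invrK mulrC lerDl.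
  have kd : d^-1 <= kap 1 d.
    apply: kap_ge => //; first exact: normr_ge0.
    by rewrite invf_le1 ?(lt_le_trans ltr01).
  rewrite -/d; lra.
move=> s sin; have ws := near s sin.
have wrho : `|N * psi L s - theta| <= rho.
  by rewrite (le_trans ws)// ge_min lexx orbT.
split=> //; have [//|[l' l'i E]] := cantor_endsP delta_gt0 delta_half L i s.
have NE : N * psi L s = q * l'%:R by rewrite -E /q; field; rewrite gt_eqF.
have wd : `|N * psi L s - theta| <= d / 2 by rewrite (le_trans ws)// ge_min lexx.
move: wd; rewrite NE ler_norml => /andP[w1 w2].
have q0 : 0 < q.
  have : q * l0%:R + d + d <= q * l0.+1%:R by lra.
  by rewrite -addn1 natrD mulrDr mulr1; lra.
have : (l0 < l')%N by rewrite -(ltr_nat R) -(ltr_pM2l q0); lra.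
suff : (l' < l0.+1)%N by rewrite ltnS leqNgt => /negP h /h.
by rewrite -(ltr_nat R) -(ltr_pM2l q0); lra.
Qed.

End quarter.

(** * Sums over integer frequencies *)

Section sums.
Variable R : realType.
Implicit Types (f : R -> R) (x B T e p : R) (ks : seq int).

Lemma sum_uniq_le (F : nat -> R) (s : seq nat) n : uniq s ->
  (forall i, 0 <= F i) -> (forall i, i \in s -> (i < n)%N) ->
  \sum_(i <- s) F i <= \sum_(i < n) F i.
Proof.
move=> us F0 sn; rewrite -(big_mkord xpredT F).
have pe : perm_eq s [seq i <- index_iota 0 n | i \in s].
  apply: uniq_perm => //; first by rewrite filter_uniq// iota_uniq.
  move=> i; rewrite mem_filter mem_index_iota /=.
  by case: (boolP (i \in s)) => // /sn ->.
by rewrite (perm_big _ pe) big_filter big_mkcond/= ler_sum// => i _; case: ifP.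
Qed.

(** On each side of [x] the integers correspond to distinct naturals, [k - ceil x] or [floor x - k],
    which do not exceed the distance to [x]. The two sides give the factor 2. *)
Lemma sum_int_le f x B ks : uniq ks ->
  (forall d, 0 <= f d) -> (forall d d', 0 <= d -> d <= d' -> f d' <= f d) ->
  (forall n, \sum_(l < n) f l%:R <= B) ->
  \sum_(k <- ks) f `|k%:~R - x| <= 2 * B.
Proof.
move=> uks f0 fm fB.
have half (g : int -> nat) (Q : pred int) :
    {in Q &, injective g} ->
    (forall k, Q k -> (g k)%:R <= `|k%:~R - x|) ->
    \sum_(k <- ks | Q k) f `|k%:~R - x| <= B.
  move=> ginj gle; pose s := [seq g k | k <- [seq k <- ks | Q k]].
  apply: (@le_trans _ _ (\sum_(i <- s) f i%:R)).
    by rewrite big_map big_filter ler_sum// => k Qk; rewrite fm// gle.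
  have us : uniq s.
    rewrite map_inj_in_uniq ?filter_uniq// => k k'.
    by rewrite !mem_filter => /andP[Qk _] /andP[Qk' _]; exact: ginj.
  apply: (le_trans (sum_uniq_le (n := (\max_(i <- s) i).+1) us _ _)) => //.
  by move=> i si; rewrite ltnS; apply: leq_bigmax_seq.
rewrite (bigID (fun k : int => x <= k%:~R)) /= mulr_natl mulr2n lerD//.
- apply: (half (fun k => `|k - Num.ceil x|%N)) => [k k'|k xk].
    rewrite !unfold_in /= -!ceil_le_int.
    by move: (Num.ceil x) => c h h'; clear -h h'; lia.
  have h : Num.ceil x <= k by rewrite ceil_le_int.
  rewrite ger0_norm ?subr_ge0//.
  have -> : (`|k - Num.ceil x|%N)%:R = (k - Num.ceil x)%:~R :> R.
    by rewrite -[in RHS](gez0_abs (_ : 0 <= k - Num.ceil x))// subr_ge0.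
  by rewrite intrB lerD2l lerN2 ceil_ge.
- apply: (half (fun k => `|Num.floor x - k|%N)) => [k k'|k xk].
    rewrite !unfold_in /= -!ltNge => h h'.
    have := ltW h; have := ltW h'; rewrite -!floor_ge_int.
    by move: (Num.floor x) => c {}h {}h'; clear -h h'; lia.
  rewrite -ltNge in xk.
  have h : k <= Num.floor x by rewrite floor_ge_int ltW.
  rewrite ltr0_norm ?subr_lt0// opprB.
  have -> : (`|Num.floor x - k|%N)%:R = (Num.floor x - k)%:~R :> R.
    by rewrite -[in RHS](gez0_abs (_ : 0 <= Num.floor x - k))// subr_ge0.
  by rewrite intrB lerD2r floor_le.
Qed.

Lemma powR_telescope p (y : R) : 1 < p -> 0 < y ->
  (y + 1) `^ (- p) <= (y `^ (1 - p) - (y + 1) `^ (1 - p)) / (p - 1).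
Proof.
move=> p1 y0; have y1 : y <= y + 1 by lra.
have [c /andP[yc cy] E] := mvt_ex (f' := fun t => (1 - p) * t `^ (1 - p - 1)) y1
  (fun t ty => is_derive1_powR (1 - p) (lt_le_trans y0 (andP ty).1)).
rewrite ler_pdivlMr ?subr_gt0// -[leRHS]opprB E.
have -> : y + 1 - y = 1 by ring.
have -> : 1 - p - 1 = - p by ring.
rewrite mulr1 -mulNr opprB mulrC ler_wpM2l; [by []|lra|].
rewrite !powRN lef_pV2 ?posrE ?powR_gt0 ?ge0_ler_powR ?nnegrE//; lra.
Qed.

(** A maximum is at least half of the sum, so the terms are at most [(2 / (E + l)) ^ p] with
    [E = 1 / e], and these telescope after comparison with [(E + l) ^ (1 - p)]. The first term is
    absorbed by [e <= 1]. The factor [1 / (p - 1)] is what excludes [p = 1]. *)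
Lemma sum_kap_powR p e n : 1 < p -> 0 < e <= 1 ->
  \sum_(l < n) kap e l%:R `^ p <= 2 `^ p * (1 + (p - 1)^-1) * e `^ (p - 1).
Proof.
move=> p1 /andP[e0 e1]; set E := e^-1.
have E1 : 1 <= E by rewrite invf_ge1.
have le1 (l : nat) : kap e l%:R `^ p <= 2 `^ p * (E + l%:R) `^ (- p).
  have El : 0 < E + l%:R by rewrite ltr_wpDr//; lra.
  have -> : (E + l%:R) `^ (- p) = (E + l%:R)^-1 `^ p.
    by rewrite -powR_inv1 ?ltW// -powRrM mulN1r.
  rewrite -powRM//; last by rewrite invr_ge0 ltW.
  rewrite ge0_ler_powR ?nnegrE ?kap_ge0//; first lra.
    by rewrite mulr_ge0// invr_ge0 ltW.
  rewrite -[2]invrK -invfM /kap lef_pV2 ?posrE; last 2 first.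
    by rewrite lt_max invr_gt0 e0.
    by rewrite mulr_gt0.
  by rewrite -/E; case: (leP E l%:R) => ?; lra.
have step m : \sum_(l < m.+1) (E + l%:R) `^ (- p) <=
    E `^ (- p) + (E `^ (1 - p) - (E + m%:R) `^ (1 - p)) / (p - 1).
  elim: m => [|m IHm]; first by rewrite big_ord1 addr0 subrr mul0r addr0.
  rewrite big_ord_recr /= (le_trans (lerD IHm (lexx _)))//.
  have Em : 0 < E + m%:R by rewrite ltr_wpDr//; lra.
  have := powR_telescope p1 Em; rewrite -addrA natr1; lra.
apply: (@le_trans _ _ (\sum_(l < n.+1) 2 `^ p * (E + l%:R) `^ (- p))).
  rewrite [leRHS]big_ord_recr /= ler_wpDr ?mulr_ge0 ?powR_ge0//.
  by rewrite ler_sum.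
rewrite -mulr_sumr -mulrA ler_wpM2l ?powR_ge0//.
apply: (le_trans (step n)).
have EE q : E `^ (- q) = e `^ q.
  by rewrite /E -powR_inv1 ?ltW// -powRrM mulN1r opprK.
rewrite -[1 - p]opprB !EE [leRHS]mulrDl mul1r lerD//.
  have -> : e `^ p = e `^ (p - 1) * e.
    rewrite -[X in _ * X]powRr1 ?ltW// -powRD ?subrK//.
    by rewrite [e == 0]gt_eqF// implybT.
  by rewrite ler_piMr ?powR_ge0.
rewrite mulrC ler_wpM2l//; first by rewrite invr_ge0; lra.
by rewrite gerBl powR_ge0.
Qed.

Lemma sum_kap1 T n : 1 <= T ->
  \sum_(l < n) (if l%:R <= T then kap 1 l%:R else 0) <= 2 + ln T.
Proof.
move=> T1.
have k1 d : kap 1 d <= 1 :> R by exact: kap_le.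
(* The terms [l = 0] and [l = 1] account for 2; afterwards
   [1 / (m + 2) <= ln (m + 2) - ln (m + 1)]. *)
have H m : \sum_(l < m.+2) kap 1 l%:R <= 2 + ln m.+1%:R :> R.
  elim: m => [|m IHm].
    rewrite 2!big_ord_recr big_ord0 /= ln1.
    by have := k1 0; have := k1 1; lra.
  rewrite big_ord_recr /= (le_trans (lerD IHm (lexx _)))//.
  have m1 : 0 < m.+2%:R :> R by rewrite ltr0n.
  have m0 : 0 < m.+1%:R :> R by rewrite ltr0n.
  rewrite -addrA lerD2l.
  have := @le_ln1Dx R (- (m.+2%:R)^-1).
  have -> : 1 - m.+2%:R^-1 = m.+1%:R / m.+2%:R :> R.
    by apply: (mulIf (lt0r_neq0 m1)); rewrite mulrBl mulVf ?mulfVK ?gt_eqF// -natr1; ring.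
  rewrite ln_div ?posrE// ltrN2 invf_lt1// ltr1n => /(_ isT).
  have := kap_le_inv (ltr01 : 0 < 1 :> R) m1.
  move: (ln m.+1%:R) (ln m.+2%:R) (kap 1 m.+2%:R) (m.+2%:R^-1) => u v y z.
  by clear; lra.
rewrite -big_mkcond; pose M := Num.truncn T.
have MT : M%:R <= T by rewrite truncn_le; lra.
have M1 : (0 < M)%N by rewrite truncn_ge_nat//; lra.
apply: (@le_trans _ _ (\sum_(l < M.+1) kap 1 l%:R)).
  rewrite -(big_mkord (fun l : nat => l%:R <= T) (fun l => kap 1 l%:R)).
  rewrite -big_filter; apply: sum_uniq_le.
  - by rewrite filter_uniq// iota_uniq.
  - by move=> i; exact: kap_ge0.
  - move=> i; rewrite mem_filter => /andP[iT _]; rewrite ltnS.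
    by rewrite truncn_ge_nat//; lra.
rewrite -(prednK M1) in MT *; apply: (le_trans (H _)).
rewrite lerD2l ler_ln ?posrE ?ltr0n//.
by lra.
Qed.

Lemma sum_count T n : 0 <= T ->
  \sum_(l < n) (if l%:R <= T then 1 else 0) <= T + 1.
Proof.
move=> T0; pose M := Num.truncn T.
have MT : M%:R <= T by rewrite truncn_le.
rewrite -big_mkcond.
apply: (@le_trans _ _ (\sum_(l < M.+1) 1)).
  rewrite -(big_mkord (fun l : nat => l%:R <= T) (fun=> 1)) -big_filter.
  apply: (sum_uniq_le (F := fun=> 1)) => //.
  - by rewrite filter_uniq// iota_uniq.
  - move=> i; rewrite mem_filter => /andP[iT _]; rewrite ltnS.
    by rewrite truncn_ge_nat.
by rewrite sumr_const card_ord -[M.+1]addn1 natrD lerD2r.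
Qed.

Lemma sum_invsq T n : 1 <= T ->
  \sum_(l < n) (Num.max T l%:R) ^- 2 <= 8 / T.
Proof.
move=> T1.
have le1 (l : nat) : (Num.max T l%:R) ^- 2 <= 4 * (T + l%:R) ^- 2.
  have Tl : 0 < T + l%:R by rewrite ltr_wpDr//; lra.
  have -> : 4 * (T + l%:R) ^- 2 = ((T + l%:R) / 2) ^- 2.
    by field; rewrite gt_eqF.
  rewrite lef_pV2 ?posrE ?exprn_gt0 ?divr_gt0//; last first.
    by rewrite lt_max; apply/orP; left; lra.
  by rewrite lerXn2r ?nnegrE//; case: (leP T l%:R) => ?; lra.
have step m : \sum_(l < m.+1) (T + l%:R) ^- 2 <= T ^- 2 + T^-1 - (T + m%:R)^-1.
  elim: m => [|m IHm]; first by rewrite big_ord1 addr0 addrK.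
  rewrite big_ord_recr /= (le_trans (lerD IHm (lexx _)))//.
  have Em : 0 < T + m%:R by rewrite ltr_wpDr//; lra.
  rewrite -natr1 addrA; set y := T + m%:R in Em *.
  have y1 : 0 < y + 1 by lra.
  have : y^-1 - (y + 1)^-1 - (y + 1) ^- 2 = (y + 1) ^- 2 / y.
    by field; rewrite !gt_eqF.
  have : 0 <= (y + 1) ^- 2 / y by rewrite divr_ge0 ?invr_ge0 ?exprn_ge0 ?ltW.
  by lra.
apply: (@le_trans _ _ (\sum_(l < n.+1) 4 * (T + l%:R) ^- 2)).
  rewrite [leRHS]big_ord_recr /= ler_wpDr//.
    by rewrite mulr_ge0// invr_ge0 exprn_ge0// addr_ge0//; lra.
  by rewrite ler_sum.
rewrite -mulr_sumr.
have := step n; have : T ^- 2 <= T^-1.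
  have T0 : 0 < T by lra.
  by rewrite lef_pV2 ?posrE ?exprn_gt0// expr2 ler_peMr; lra.
have : 0 <= (T + n%:R)^-1 by rewrite invr_ge0 addr_ge0//; lra.
by lra.
Qed.

(* Fubini: compares the total lengths of two families of intervals through the
   number of intervals covering each point. *)
Lemma interval_count (K J : Type) (ks : seq K) (js : seq J)
    (a b : K -> R) (c d : J -> R) (M : R) :
  0 <= M -> (forall k, a k <= b k) -> (forall j, c j <= d j) ->
  (forall t, \sum_(k <- ks) \1_(`]a k, b k[%classic) t <=
     M * \sum_(j <- js) \1_(`[c j, d j]%classic) t) ->
  \sum_(k <- ks) (b k - a k) <= M * \sum_(j <- js) (d j - c j).
Proof.
move=> M0 ab cd H.
have l1 : (\int[@lebesgue_measure R]_t (\sum_(k <- ks) (\1_(`]a k, b k[%classic) t)%:E) =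
    (\sum_(k <- ks) (b k - a k))%:E)%E.
  rewrite ge0_integral_sum//; first last.
    by move=> k; exact/measurable_EFinP/measurable_indic.
  rewrite -sumEFin; apply: eq_bigr => k _; rewrite integral_indic// setIT.
  rewrite [LHS]lebesgue_measure_itv /= lte_fin; case: ltP => // ba.
  by rewrite (_ : b k = a k) ?subrr//; apply/eqP; rewrite eq_le ab ba.
have l2 : (\int[@lebesgue_measure R]_t (M%:E * \sum_(j <- js) (\1_(`[c j, d j]%classic) t)%:E) =
    (M * \sum_(j <- js) (d j - c j))%:E)%E.
  rewrite ge0_integralZl//; first last.
  - by move=> t _; apply: sume_ge0 => j _; rewrite lee_fin.
  - by apply: emeasurable_sum => k; exact/measurable_EFinP/measurable_indic.
  rewrite ge0_integral_sum//; first last.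
    by move=> k; exact/measurable_EFinP/measurable_indic.
  rewrite EFinM -sumEFin; congr (_ * _)%E; apply: eq_bigr => j _.
  rewrite integral_indic// setIT.
  rewrite [LHS]lebesgue_measure_itv /= lte_fin; case: ltP => // ba.
  by rewrite (_ : d j = c j) ?subrr//; apply/eqP; rewrite eq_le cd ba.
rewrite -lee_fin -l1 -l2; apply: ge0_le_integral => //.
- by move=> t _; apply: sume_ge0 => j _; rewrite lee_fin.
- by apply: emeasurable_sum => k; exact/measurable_EFinP/measurable_indic.
- apply: measurable_funeM.
  by apply: emeasurable_sum => k; exact/measurable_EFinP/measurable_indic.
- by move=> t _; rewrite !sumEFin -EFinM lee_fin.
Qed.

End sums.

Lemma sqr_eq1P (F : idomainType) (v : F) : v ^+ 2 = 1 -> v = 1 \/ v = -1.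
Proof. by move/eqP; rewrite sqrf_eq1 => /orP[]/eqP; [left|right]. Qed.

(** * Estimates on one block *)

Section block.
Variables (R : realType) (delta : nat -> R).
Hypothesis delta_gt0 : forall k, 0 < delta k.
Hypothesis delta_half : forall k, 2 * delta k.+1 < delta k.
Local Notation psi := (cantor delta).

Definition cantor_tent (L : nat) (y : R) : R := psi L (delta L - `|y|).

Definition cantor_bump (L : nat) (y : R) : R :=
  cantor_tent L (y + delta L) - cantor_tent L (y - delta L).

Lemma cantor_tent_eq0 L y : delta L <= `|y| -> cantor_tent L y = 0.
Proof. by move=> yL; rewrite /cantor_tent cantor_eq0//; lra. Qed.

Lemma cantor_bump1 L u : 0 <= u <= delta L ->
  cantor_bump L (- (2 * delta L) + u) = psi L u.
Proof.
have d0 := delta_gt0 L; move=> /andP[u0 uL]; rewrite /cantor_bump.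
rewrite [cantor_tent _ (_ - _)]cantor_tent_eq0 ?subr0; last first.
  by rewrite ler0_norm; lra.
by rewrite /cantor_tent ler0_norm; [congr psi; ring|lra].
Qed.

Lemma cantor_bump2 L u : 0 <= u <= delta L -> cantor_bump L (- u) = psi L u.
Proof.
have d0 := delta_gt0 L; move=> /andP[u0 uL]; rewrite /cantor_bump.
rewrite [cantor_tent _ (_ - _)]cantor_tent_eq0 ?subr0; last first.
  by rewrite ler0_norm; lra.
by rewrite /cantor_tent ger0_norm; [congr psi; ring|lra].
Qed.

Lemma cantor_bump_odd L y : cantor_bump L (- y) = - cantor_bump L y.
Proof.
rewrite /cantor_bump /cantor_tent -(normrN (- y + _)) -(normrN (- y - _)).
by rewrite !opprD !opprK addrC.
Qed.

Lemma cantor_bump3 L u : 0 <= u <= delta L -> cantor_bump L u = - psi L u.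
Proof. by move=> uL; rewrite -[u in LHS]opprK cantor_bump_odd cantor_bump2. Qed.

Lemma cantor_bump4 L u : 0 <= u <= delta L ->
  cantor_bump L (2 * delta L - u) = - psi L u.
Proof.
move=> uL; have -> : 2 * delta L - u = - (- (2 * delta L) + u) by ring.
by rewrite cantor_bump_odd cantor_bump1.
Qed.

Lemma cantor_bump_out L y : 2 * delta L <= `|y| -> cantor_bump L y = 0.
Proof.
have d0 := delta_gt0 L => yL; rewrite /cantor_bump !cantor_tent_eq0 ?subrr//.
  by have := lerB_normD y (- delta L); rewrite normrN (ger0_norm (ltW d0)); lra.
by have := lerB_normD y (delta L); rewrite (ger0_norm (ltW d0)); lra.
Qed.

Lemma cantor_bump_le1 L y : `|cantor_bump L y| <= 1.
Proof.
rewrite /cantor_bump /cantor_tent.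
set a := psi L _; set b := psi L _.
have [a0 a1] : 0 <= a /\ a <= 1 by rewrite cantor_ge0// cantor_le1.
have [b0 b1] : 0 <= b /\ b <= 1 by rewrite cantor_ge0// cantor_le1.
by rewrite ler_norml; lra.
Qed.

Section one_frequency.
Variables (L : nat) (x n A theta : R) (Q Phi Q0 Phi0 : R -> R).
Hypothesis A0 : 0 <= A.
Local Notation N := (`|n| * A).
Local Notation dL := (delta L).
Local Notation I t := (x - 2 * dL <= t <= x + 2 * dL).
Hypothesis dQ : forall t, I t -> is_derive t 1 Q (cos (Phi t)).
Hypothesis dPhi : forall t, I t ->
  is_derive t 1 Phi (n * A * cantor_bump L (t - x) - theta).
Hypothesis dQ0 : forall t, I t -> is_derive t 1 Q0 (cos (Phi0 t)).
Hypothesis dPhi0 : forall t, I t -> is_derive t 1 Phi0 (- theta).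
Hypothesis Phi_l : Phi (x - 2 * dL) = Phi0 (x - 2 * dL).
Hypothesis Phi_r : Phi (x + 2 * dL) = Phi0 (x + 2 * dL).

(* On the quarter [u |-> c + tau * u], [0 <= u <= delta L], the bump is [s * psi]. *)
Definition quarter_data (c tau s : R) :=
  [/\ tau ^+ 2 = 1, s ^+ 2 = 1, (forall u, 0 <= u <= dL -> I (c + tau * u)) &
    forall u, 0 <= u <= dL -> cantor_bump L (c + tau * u - x) = s * psi L u].

Lemma quarter_data1 : quarter_data (x - 2 * dL) 1 1.
Proof.
have d0 := delta_gt0 L; split=> [| |u uL|u uL]; rewrite ?expr1n//; first lra.
by rewrite !mul1r -cantor_bump1//; congr cantor_bump; ring.
Qed.

Lemma quarter_data2 : quarter_data x (-1) 1.
Proof.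
have d0 := delta_gt0 L; split=> [| |u uL|u uL]; rewrite ?sqrrN ?expr1n//; first lra.
by rewrite !mul1r -cantor_bump2//; congr cantor_bump; ring.
Qed.

Lemma quarter_data3 : quarter_data x 1 (-1).
Proof.
have d0 := delta_gt0 L; split=> [| |u uL|u uL]; rewrite ?sqrrN ?expr1n//; first lra.
by rewrite [RHS]mulN1r -cantor_bump3//; congr cantor_bump; ring.
Qed.

Lemma quarter_data4 : quarter_data (x + 2 * dL) (-1) (-1).
Proof.
have d0 := delta_gt0 L; split=> [| |u uL|u uL]; rewrite ?sqrrN ?expr1n//; first lra.
by rewrite [RHS]mulN1r -cantor_bump4//; congr cantor_bump; ring.
Qed.

(** The sign [e] with [e * s * n = |n|]: multiplying the phase by it makes the slope
    [|n| * A * psi - e * theta] nondecreasing along the quarter, at the price of replacing [theta]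
    by [e * theta]. *)
Definition orientation (s : R) : R := if 0 <= n then s else - s.

Lemma orientationE s : s ^+ 2 = 1 -> orientation s * s * n = `|n|.
Proof.
move=> s1; rewrite /orientation; case: (leP 0 n) => n0.
  by rewrite -expr2 s1 mul1r ger0_norm.
by rewrite mulNr -expr2 s1 mulN1r ltr0_norm.
Qed.

Lemma orientation_sq s : s ^+ 2 = 1 -> orientation s ^+ 2 = 1.
Proof. by rewrite /orientation; case: ifP => _ //; rewrite sqrrN. Qed.

(** The factor [tau] undoes the reflection of the parameter and [e] normalizes the sign of the
    slope; the cosine is even and notices neither. *)
Lemma quarter_transport c tau s : quarter_data c tau s ->
  let e := orientation s in
  let P u := tau * Q (c + tau * u) in
  let Psi u := e * tau * Phi (c + tau * u) in
  [/\ forall u, 0 <= u <= dL -> is_derive u 1 P (cos (Psi u)),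
      forall u, 0 <= u <= dL -> is_derive u 1 Psi (N * psi L u - e * theta) &
      `|P dL - P 0| = `|Q (c + tau * dL) - Q c|].
Proof.
move=> [tau1 s1 inI bE] e P Psi.
have e1 : e ^+ 2 = 1 by exact: orientation_sq.
have dlin (u : R) : is_derive u (1 : R) (fun u : R => c + tau * u) tau.
  by apply: is_derive_eq; rewrite /GRing.scale /=; ring.
have cosE v : cos (e * tau * v) = cos v.
  have /sqr_eq1P : (e * tau) ^+ 2 = 1 by rewrite exprMn e1 tau1 mulr1.
  by case=> ->; rewrite ?mul1r ?mulN1r ?cosN.
split.
- move=> u uL; have dq := dQ (inI u uL); rewrite /Psi cosE /P.
  have dc : is_derive u (1 : R) (fun u : R => Q (c + tau * u)) _ :=
    @is_derive1_comp R Q (fun u => c + tau * u) u _ _ dq (dlin u).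
  apply: is_derive_eq; rewrite /GRing.scale /=.
  by rewrite mulrCA -expr2 tau1 mulr1.
- move=> u uL; have dq := dPhi (inI u uL); rewrite /Psi.
  have dc : is_derive u (1 : R) (fun u : R => Phi (c + tau * u)) _ :=
    @is_derive1_comp R Phi (fun u => c + tau * u) u _ _ dq (dlin u).
  apply: is_derive_eq; rewrite /GRing.scale /= bE// -(orientationE s1) -/e.
  transitivity (tau ^+ 2 * (e * s * n * A * psi L u - e * theta)); first ring.
  by rewrite tau1 mul1r; ring.
- rewrite /P mulr0 addr0 -mulrBr normrM.
  by have [->|->] := sqr_eq1P tau1; rewrite ?normrN normr1 mul1r.
Qed.

Lemma block_split : Q (x + 2 * dL) - Q (x - 2 * dL) =
  (Q (x - 2 * dL + 1 * dL) - Q (x - 2 * dL)) - (Q (x + -1 * dL) - Q x) +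
  (Q (x + 1 * dL) - Q x) - (Q (x + 2 * dL + -1 * dL) - Q (x + 2 * dL)).
Proof.
have -> : x - 2 * dL + 1 * dL = x + -1 * dL by ring.
have -> : x + 2 * dL + -1 * dL = x + 1 * dL by ring.
by ring.
Qed.

Local Notation Dq c tau := (`|Q (c + tau * dL) - Q c|).
Local Notation Y :=
  (Q (x + 2 * dL) - Q (x - 2 * dL) - (Q0 (x + 2 * dL) - Q0 (x - 2 * dL))).

Lemma block_flat e : 0 < e -> dL <= e ->
  `|Q0 (x + 2 * dL) - Q0 (x - 2 * dL)| <= 4 * kap e `|theta|.
Proof.
move=> e0 dLe; have d0 := delta_gt0 L.
have lr : x - 2 * dL <= x + 2 * dL by lra.
rewrite [leRHS]mulrC -ler_pdivrMr//; apply: kap_ge => //.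
  rewrite ler_pdivrMr//.
  have := mvt_bound (f' := fun t => cos (Phi0 t)) (M := 1) lr dQ0.
  have -> : 1 * (x + 2 * dL - (x - 2 * dL)) = dL * 4 by ring.
  move=> H; apply: (@le_trans _ _ (dL * 4)); last by rewrite ler_wpM2r.
  by apply: H => t _; rewrite ler_norml cos_geN1 cos_le1.
move=> t0; rewrite ler_pdivrMr//.
have w := @vdc_far R Q0 Phi0 (fun=> - theta) _ _ dQ0 dPhi0
  (fun _ _ _ _ _ => lexx _) _ _ _ (lexx _) lr (lexx _) t0.
apply: (@le_trans _ _ (2 / `|theta|)); last first.
  by rewrite mulrC ler_wpM2l ?invr_ge0//; lra.
apply: w; have [t1|t1] := lerP 0 theta.
  by right; rewrite ger0_norm.
by left; rewrite ltr0_norm.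
Qed.

Lemma block_le_quarters e : 0 < e -> dL <= e -> `|Y| <=
  Dq (x - 2 * dL) 1 + Dq x (-1) + Dq x 1 + Dq (x + 2 * dL) (-1) +
  4 * kap e `|theta|.
Proof.
move=> e0 dLe; rewrite (le_trans (ler_normB _ _))// lerD ?block_flat//.
rewrite block_split (le_trans (ler_normB _ _))// lerD//.
rewrite (le_trans (ler_normD _ _))// lerD//.
by rewrite (le_trans (ler_normB _ _)).
Qed.

(** The phases agree at the left end and their slopes differ by at most [N], so they differ by at
    most [4 * dL * N] on the block, whose length is [4 * dL]. *)
Lemma block_trivial : `|Y| <= 16 * dL ^+ 2 * N.
Proof.
have d0 := delta_gt0 L; have n0 := normr_ge0 n.
have N0 : 0 <= N by rewrite mulr_ge0.
pose D t := Phi t - Phi0 t.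
have dD t : I t -> is_derive t 1 D (n * A * cantor_bump L (t - x)).
  move=> tI; have h1 := dPhi tI; have h0 := dPhi0 tI.
  by apply: is_derive_eq; ring.
have DN t : I t -> `|D t| <= N * (4 * dL).
  move=> /[dup] tI /andP[lt tr].
  have Dl : D (x - 2 * dL) = 0 by rewrite /D Phi_l subrr.
  rewrite -[D t]subr0 -Dl.
  apply: (@le_trans _ _ (N * (t - (x - 2 * dL)))); last first.
    by rewrite ler_wpM2l//; lra.
  apply: (mvt_bound (f' := fun t => n * A * cantor_bump L (t - x))) => // u /andP[lu ut].
    by apply: dD; lra.
  rewrite !normrM (ger0_norm A0) -[leRHS]mulr1 ler_wpM2l//.
  exact: cantor_bump_le1.
pose q t := Q t - Q0 t.
have -> : Y = q (x + 2 * dL) - q (x - 2 * dL) by rewrite /q; ring.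
have -> : 16 * dL ^+ 2 * N = (N * (4 * dL)) * (x + 2 * dL - (x - 2 * dL)) by ring.
apply: (mvt_bound (f' := fun t => cos (Phi t) - cos (Phi0 t))); first lra.
  by move=> t tI; have h1 := dQ tI; have h0 := dQ0 tI; apply: is_derive_eq.
move=> t tI; apply: le_trans (DN t tI).
rewrite /D; have cosL (a b : R) : a <= b -> `|cos b - cos a| <= b - a.
  move=> ab; rewrite -[leRHS]mul1r.
  apply: (mvt_bound (f' := fun t => - sin t)) => // u _.
  by rewrite normrN ler_norml sin_geN1 sin_le1.
case: (orP (le_total (Phi t) (Phi0 t))) => h.
  by rewrite distrC [leRHS]distrC (le_trans (cosL _ _ h))// ler_norm.
by rewrite (le_trans (cosL _ _ h))// ler_norm.
Qed.

(** The boundary terms [sin Phi / w] telescope over the four quarters and agree with those of the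
    linear phase at the two ends of the block. What remains is the variation of [1 / w] on each
    quarter, the difference between [1 / theta] and [1 / (theta - N)] up to signs, which is at most
    [2 * N / theta ^ 2] as [2 * N <= |theta|]. *)
Lemma block_tail : 0 < `|theta| -> 2 * N <= `|theta| ->
  `|Y| <= 8 * N / theta ^+ 2.
Proof.
move=> th0 Nth; have d0 := delta_gt0 L.
have N0 : 0 <= N by rewrite mulr_ge0.
pose W t := n * A * cantor_bump L (t - x) - theta.
pose S t := (W t)^-1 * sin (Phi t).
have quart c tau s : quarter_data c tau s ->
    `|Q (c + tau * dL) - Q c - (S (c + tau * dL) - S c)| <= 2 * N / theta ^+ 2.
  move=> /[dup] qd [tau1 s1 inI bE].
  have [dP dPsi _] := quarter_transport qd.
  move: dP dPsi; set e := orientation s => dP dPsi.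
  have e1 : e ^+ 2 = 1 by exact: orientation_sq.
  have eth : `|e * theta| = `|theta|.
    by rewrite normrM; have [->|->] := sqr_eq1P e1; rewrite ?normrN normr1 mul1r.
  have wm u v : 0 <= u -> u <= v -> v <= dL ->
      N * psi L u - e * theta <= N * psi L v - e * theta.
    by move=> _ uv _; rewrite lerD2r ler_wpM2l// cantor_mono.
  have H := vdc_boundary dP dPsi wm (lexx 0) (ltW d0) (lexx dL).
  have sinE v : sin (e * tau * v) = e * tau * sin v.
    have /sqr_eq1P : (e * tau) ^+ 2 = 1 by rewrite exprMn e1 tau1 mulr1.
    by case=> ->; rewrite ?mul1r ?mulN1r ?sinN.
  have Ew u : 0 <= u <= dL -> N * psi L u - e * theta = e * W (c + tau * u).
    by move=> uL; rewrite /W bE// -(orientationE s1) -/e; ring.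
  have ein : e^-1 = e.
    by have [->|->] := sqr_eq1P e1; rewrite ?invrN invr1.
  have tau_n : `|tau| = 1.
    by have [->|->] := sqr_eq1P tau1; rewrite ?normrN normr1.
  have d0L : 0 <= (0 : R) <= dL by lra.
  have dLL : 0 <= dL <= dL by lra.
  rewrite (Ew _ d0L) (Ew _ dLL) in H.
  have E : tau * Q (c + tau * dL) - tau * Q (c + tau * 0) -
      ((e * W (c + tau * dL))^-1 * sin (e * tau * Phi (c + tau * dL)) -
       (e * W (c + tau * 0))^-1 * sin (e * tau * Phi (c + tau * 0))) =
      tau * (Q (c + tau * dL) - Q c - (S (c + tau * dL) - S c)).
    rewrite /S !invfM !sinE ein mulr0 addr0.
    have F (a b : R) : e * a * (e * tau * b) = tau * (a * b).
      transitivity (e ^+ 2 * (tau * (a * b))); first ring.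
      by rewrite e1 mul1r.
    by rewrite !F; ring.
  rewrite E normrM tau_n mul1r -(Ew _ d0L) -(Ew _ dLL) in H.
  rewrite cantor_eq0// cantor_eq1// mulr0 sub0r mulr1 in H.
  move: H; move: (e * theta) eth => z zth H.
  have z2 : theta ^+ 2 = z ^+ 2 by rewrite -(real_normK (num_real theta)) -zth real_normK ?num_real.
  rewrite z2.
  rewrite -zth in th0 Nth.
  have nz0 : z != 0 by rewrite -normr_gt0.
  have nzN : z - N != 0.
    apply/eqP => /eqP; rewrite subr_eq0 => /eqP zN.
    by move: th0 Nth; rewrite zN ger0_norm//; lra.
  have nNz : N - z != 0 by rewrite -opprB oppr_eq0.
  have nmz : - z != 0 by rewrite oppr_eq0.
  have [z0|z0] := lerP 0 z.
    rewrite ger0_norm// in th0 Nth.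
    have Nz : N - z < 0 by lra.
    apply: (le_trans (H _)); first by rewrite -mulrNN mulr_gt0; lra.
    have -> : (- z)^-1 - (N - z)^-1 = N / (z * (z - N)).
      by field; rewrite ?nz0 ?nzN ?nNz.
    have -> : 2 * N / z ^+ 2 = N / (z * (z / 2)).
      by field.
    rewrite ler_wpM2l// lef_pV2 ?posrE ?mulr_gt0 ?ler_pM2l//; lra.
  rewrite ltr0_norm// in th0 Nth.
  have Nz : 0 < N - z by lra.
  apply: (le_trans (H _)); first by rewrite mulr_gt0; lra.
  have -> : (- z)^-1 - (N - z)^-1 = N / (- z * (N - z)).
    by field; rewrite ?nz0 ?nzN ?nNz.
  have -> : 2 * N / z ^+ 2 = N / (- z * (- z / 2)).
    by field.
  rewrite ler_wpM2l// lef_pV2 ?posrE ?mulr_gt0 ?ler_pM2l//; lra.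
(* For the linear phase the slope is constant, so the error term of van der Corput vanishes and the
   formula is exact; the bump vanishes at both ends, hence its boundary terms there are values of
   [S]. *)
have flat : Q0 (x + 2 * dL) - Q0 (x - 2 * dL) = S (x + 2 * dL) - S (x - 2 * dL).
  have lr : x - 2 * dL <= x + 2 * dL by lra.
  have := @vdc_boundary R Q0 Phi0 (fun=> - theta) _ _ dQ0 dPhi0
    (fun _ _ _ _ _ => lexx _) _ _ (lexx _) lr (lexx _).
  rewrite subrr mulrNN -expr2 exprn_even_gt0//= -normr_gt0 => /(_ th0).
  rewrite normr_le0 subr_eq0 => /eqP ->.
  rewrite /S /W -Phi_l -Phi_r.
  have -> : x + 2 * dL - x = 2 * dL by ring.
  have -> : x - 2 * dL - x = - (2 * dL) by ring.
  rewrite cantor_bump_odd cantor_bump_out ?ger0_norm//; last by lra.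
  by rewrite oppr0 !mulr0 !sub0r.
have q1 := quart _ _ _ quarter_data1; have q2 := quart _ _ _ quarter_data2.
have q3 := quart _ _ _ quarter_data3; have q4 := quart _ _ _ quarter_data4.
have -> : Y = (Q (x - 2 * dL + 1 * dL) - Q (x - 2 * dL) -
    (S (x - 2 * dL + 1 * dL) - S (x - 2 * dL))) -
  (Q (x + -1 * dL) - Q x - (S (x + -1 * dL) - S x)) +
  (Q (x + 1 * dL) - Q x - (S (x + 1 * dL) - S x)) -
  (Q (x + 2 * dL + -1 * dL) - Q (x + 2 * dL) -
    (S (x + 2 * dL + -1 * dL) - S (x + 2 * dL))).
  rewrite flat block_split.
  have -> : x - 2 * dL + 1 * dL = x + -1 * dL by ring.
  have -> : x + 2 * dL + -1 * dL = x + 1 * dL by ring.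
  by ring.
move: q1 q2 q3 q4; set a1 := _ - _ - (S _ - S _); set a2 := _ - _ - (S _ - S _).
set a3 := _ - _ - (S _ - S _); set a4 := _ - _ - (S _ - S _); set b := 2 * N / _.
have -> : 8 * N / theta ^+ 2 = 4 * b by rewrite /b; ring.
rewrite !ler_norml; lra.
Qed.

End one_frequency.

End block.

Lemma powR_add_le (R : realType) (p a b : R) : 0 <= p -> 0 <= a -> 0 <= b ->
  (a + b) `^ p <= 2 `^ p * (a `^ p + b `^ p).
Proof.
move=> p0 a0 b0.
have H u v : 0 <= u -> u <= v -> (u + v) `^ p <= 2 `^ p * (u `^ p + v `^ p).
  move=> u0 uv; apply: (@le_trans _ _ ((2 * v) `^ p)).
    by rewrite ge0_ler_powR ?nnegrE//; lra.
  rewrite powRM//; last lra.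
  by rewrite ler_wpM2l ?powR_ge0// lerDr powR_ge0.
case: (orP (le_total a b)) => ab; first exact: H.
by rewrite addrC [X in _ * X]addrC; exact: H.
Qed.

(** * Summation of the block terms over the frequencies *)

Section block_sums.
Variables (R : realType) (delta : nat -> R).
Hypothesis delta_gt0 : forall k, 0 < delta k.
Hypothesis delta_half : forall k, 2 * delta k.+1 < delta k.
Hypothesis delta_le1 : forall k, delta k <= 1.
Local Notation psi := (cantor delta).

(* [y] is the change of the integral of [cos] of an affine phase over the block
   caused by the bump; integrals are increments of primitives. *)
Definition block_term (L : nat) (x n A theta y : R) : Prop :=
  let l := x - 2 * delta L in let r := x + 2 * delta L in
  exists Q Phi Q0 Phi0 : R -> R,
  [/\ (forall t, l <= t <= r -> is_derive t 1 Q (cos (Phi t))) /\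
      (forall t, l <= t <= r ->
        is_derive t 1 Phi (n * A * cantor_bump delta L (t - x) - theta)),
      (forall t, l <= t <= r -> is_derive t 1 Q0 (cos (Phi0 t))) /\
      (forall t, l <= t <= r -> is_derive t 1 Phi0 (- theta)),
      Phi l = Phi0 l, Phi r = Phi0 r &
      y = Q r - Q l - (Q0 r - Q0 l)].

Variables (L : nat) (x n A sigma : R) (ks : seq int) (y : int -> R).
Hypothesis A0 : 0 <= A.
Hypothesis uks : uniq ks.
Hypothesis yE : forall k, block_term L x n A (k%:~R - sigma) (y k).
Local Notation N := (`|n| * A).
Local Notation dL := (delta L).

Let N0 : 0 <= N. Proof. by rewrite mulr_ge0. Qed.

Section p_gt1.
Variable p : R.
Hypothesis p1 : 1 < p.
Variable I : nat.
Hypothesis NI : N / 2 ^+ I * delta (L + I)%N <= 1.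

(** The best generation and lattice point depend on the frequency; summing over all pairs [(i, l)]
    removes this dependence, so that the sum over frequencies can be carried out for each pair
    separately. *)
Let G theta := \sum_(i < I.+1) \sum_(l < (2 ^ i).+1)
  kap (delta (L + i.-1)%N) `|theta - N / 2 ^+ i * l%:R| `^ p.

Let kp0 e d : 0 <= (kap e d : R) `^ p. Proof. exact: powR_ge0. Qed.

Let G_ge (i l : nat) theta : (i <= I)%N -> (l <= 2 ^ i)%N ->
  kap (delta (L + i.-1)%N) `|theta - N / 2 ^+ i * l%:R| `^ p <= G theta.
Proof.
move=> iI li; rewrite /G (bigD1 (inord i))//= inordK//.
rewrite (bigD1 (inord l))//= inordK// -addrA lerDl addr_ge0//.
  by rewrite sumr_ge0.
by rewrite sumr_ge0// => j _; rewrite sumr_ge0.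
Qed.

Lemma block_powR_le theta z : block_term L x n A theta z ->
  `|z| `^ p <= 8 `^ p * 9 `^ p * 8 * (G theta + G (- theta)).
Proof.
move=> [Q [Phi [Q0 [Phi0 [[dQ dPhi] [dQ0 dPhi0] Pl Pr ->]]]]].
have p0 : 0 <= p by have := p1; lra.
have G0 u : 0 <= G u.
  by rewrite sumr_ge0// => i _; rewrite sumr_ge0.
have quart c tau s : s = 1 \/ s = -1 -> quarter_data delta L x c tau s ->
    `|Q (c + tau * dL) - Q c| `^ p <= 9 `^ p * (G theta + G (- theta)).
  move=> s1 qd; have [dP dPsi E] := quarter_transport dQ dPhi qd.
  have [i [l [iI li H]]] := quarter_multiscale delta_gt0 delta_half N0 dP dPsi NI.
  rewrite -E; apply: (@le_trans _ _ ((9 * kap (delta (L + i.-1)%N)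
     `|orientation n s * theta - N / 2 ^+ i * l%:R|) `^ p)).
    by rewrite ge0_ler_powR ?nnegrE// mulr_ge0// kap_ge0.
  rewrite powRM ?kap_ge0// ler_wpM2l ?powR_ge0//.
  rewrite (le_trans (G_ge _ iI li))//.
  (* The orientation differs from quarter to quarter, hence the bound keeps both [G theta] and
     [G (- theta)]. *)
  have [->|->] : orientation n s = 1 \/ orientation n s = -1.
      by rewrite /orientation; case: ifP; case: s1 => ->; rewrite ?opprK; auto.
    by rewrite mul1r lerDl.
  by rewrite mulN1r lerDr.
have q1 := quart _ _ _ (or_introl erefl) (quarter_data1 delta_gt0 delta_half L x).
have q2 := quart _ _ _ (or_introl erefl) (quarter_data2 delta_gt0 delta_half L x).
have q3 := quart _ _ _ (or_intror erefl) (quarter_data3 delta_gt0 delta_half L x).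
have q4 := quart _ _ _ (or_intror erefl) (quarter_data4 delta_gt0 delta_half L x).
have := block_le_quarters delta_gt0 Q dQ0 dPhi0 (delta_gt0 L) (lexx _).
have kG : (4 * kap dL `|theta|) `^ p <= 9 `^ p * (G theta + G (- theta)).
  rewrite powRM ?kap_ge0// ler_pM ?powR_ge0//.
    by rewrite ge0_ler_powR ?nnegrE//; lra.
  have := @G_ge 0%N 0%N theta (leq0n _) (leq0n _).
  by rewrite mulr0 subr0 addn0 => /le_trans; apply; rewrite lerDl.
move: q1 q2 q3 q4 kG.
set a := `|Q (x - _ + _) - _|; set b := `|Q (x + -1 * _) - _|.
set c := `|Q (x + 1 * _) - _|; set d := `|Q (x + _ + _) - _|.
set e := 4 * kap _ _; set B := 9 `^ p * _ => q1 q2 q3 q4 q5 H.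
have [a0 b0 c0 d0] : [/\ 0 <= a, 0 <= b, 0 <= c & 0 <= d] by split; exact: normr_ge0.
have e0 : 0 <= e by rewrite mulr_ge0 ?kap_ge0.
apply: (@le_trans _ _ ((a + b + c + d + e) `^ p)).
  by rewrite ge0_ler_powR ?nnegrE// !addr_ge0.
(* The four quarters and the linear term are combined by three nested levels of [powR_add_le], each
   costing [2 ^ p]; the second factor 8 counts the copies of [B], the linear term being weighted
   like four quarters. *)
have P8 : 8 `^ p = 2 `^ p * (2 `^ p * 2 `^ p) :> R.
  by rewrite -!powRM//; congr (_ `^ _); lra.
have p2 : 1 <= 2 `^ p :> R.
  rewrite -[leLHS](powRr0 2) ler_powR//; lra.
have h1 := powR_add_le p0 a0 b0; have h2 := powR_add_le p0 c0 d0.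
have h3 := powR_add_le p0 (addr_ge0 a0 b0) (addr_ge0 c0 d0).
have h4 := powR_add_le p0 (addr_ge0 (addr_ge0 a0 b0) (addr_ge0 c0 d0)) e0.
rewrite -(addrA (a + b)); apply: (le_trans h4).
have B0 : 0 <= B by rewrite mulr_ge0 ?powR_ge0 ?addr_ge0.
set t := 2 `^ p in h1 h2 h3 h4 P8 p2 *.
have t0 : 0 <= t by lra.
have h1' : (a + b) `^ p <= t * (2 * B).
  by rewrite (le_trans h1)// ler_wpM2l//; lra.
have h2' : (c + d) `^ p <= t * (2 * B).
  by rewrite (le_trans h2)// ler_wpM2l//; lra.
have h3' : (a + b + (c + d)) `^ p <= t * (t * (4 * B)).
  rewrite (le_trans h3)// ler_wpM2l//.
  by rewrite (_ : t * (4 * B) = t * (2 * B) + t * (2 * B)) ?lerD//; ring.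
have h5 : e `^ p <= t * (t * (4 * B)).
  rewrite (le_trans q5)//; have : 1 * (1 * (4 * B)) <= t * (t * (4 * B)).
    by rewrite ler_pM ?mul1r ?ler_peMl// mulr_ge0.
  lra.
rewrite (_ : 8 `^ p * _ * 8 * _ = t * (t * (t * (8 * B)))); last first.
  by rewrite P8 /B; ring.
rewrite ler_wpM2l//.
by rewrite (_ : t * (t * (8 * B)) = t * (t * (4 * B)) + t * (t * (4 * B))) ?lerD//; ring.
Qed.

Lemma sum_kap_shift (b q : R) (b1 : b = 1 \/ b = -1) i : (i <= I)%N ->
  \sum_(k <- ks) kap (delta (L + i.-1)%N)
    `|b * (k%:~R - sigma) - q| `^ p <=
  2 * (2 `^ p * (1 + (p - 1)^-1) * delta (L + i.-1)%N `^ (p - 1)).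
Proof.
move=> iI; set e := delta _.
have e01 : 0 < e <= 1 by rewrite delta_gt0 delta_le1.
have [e0 e1] := andP e01.
have E k : `|b * (k%:~R - sigma) - q| = `|k%:~R - (sigma + b * q)|.
  by case: b1 => ->; rewrite ?mul1r ?mulN1r; [|rewrite -normrN]; congr `|_|; ring.
under eq_bigr do rewrite E.
apply: (sum_int_le (f := fun d => kap e d `^ p)) => //.
  move=> d d' d0 dd; rewrite ge0_ler_powR ?nnegrE ?kap_ge0 ?kap_ninc//.
  by have := p1; lra.
by move=> m; exact: sum_kap_powR.
Qed.

(** For a fixed pair [(i, l)] the distances form a translate of the integers, so the sum over
    frequencies is [O(delta ^ (p - 1))]; generation [i] has [2 ^ i + 1] lattice points, at most
    [2 * 2 ^ i]. *)
Lemma block_sum_powR : \sum_(k <- ks) `|y k| `^ p <=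
  8 `^ p * 9 `^ p * 8 * (8 * (2 `^ p * (1 + (p - 1)^-1))) *
    \sum_(i < I.+1) 2 ^+ i * delta (L + i.-1)%N `^ (p - 1).
Proof.
set K := 2 `^ p * _; set S := \sum_(i < I.+1) _.
have K0 : 0 <= K.
  by rewrite mulr_ge0 ?powR_ge0// addr_ge0// invr_ge0; have := p1; lra.
have GS b : b = 1 \/ b = -1 ->
    \sum_(k <- ks) G (b * (k%:~R - sigma)) <= 4 * K * S.
  move=> b1; rewrite /G exchange_big/= mulr_sumr ler_sum// => i _.
  rewrite exchange_big/=.
  have iI : (i <= I)%N by rewrite -ltnS.
  apply: (@le_trans _ _ (\sum_(l < (2 ^ i).+1)
      2 * (K * delta (L + i.-1)%N `^ (p - 1)))).
    by rewrite ler_sum// => l _; exact: sum_kap_shift.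
  rewrite sumr_const card_ord -[leLHS]mulr_natl.
  have : (2 ^ i).+1%:R <= 2 * 2 ^+ i :> R.
    by rewrite -natrX -natrM ler_nat; have := expn_gt0 2 i; lia.
  have X0 : 0 <= 2 * (K * delta (L + i.-1)%N `^ (p - 1)).
    by rewrite mulr_ge0// (mulr_ge0 K0)// powR_ge0.
  move=> H; apply: (le_trans (ler_wpM2r X0 H)).
  by rewrite le_eqVlt; apply/orP; left; apply/eqP; ring.
apply: (@le_trans _ _ (\sum_(k <- ks) 8 `^ p * 9 `^ p * 8 *
    (G (1 * (k%:~R - sigma)) + G (-1 * (k%:~R - sigma))))).
  by rewrite ler_sum// => k _; rewrite mul1r mulN1r; exact: block_powR_le.
rewrite -mulr_sumr -[leRHS]mulrA ler_wpM2l ?mulr_ge0 ?powR_ge0//.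
rewrite big_split /=.
have := GS 1 (or_introl erefl); have := GS (-1) (or_intror erefl).
by rewrite (_ : 8 * K * S = 4 * K * S + 4 * K * S); [lra|ring].
Qed.

End p_gt1.

Section p_eq1.
Variable T : R.
Hypothesis T1 : 1 <= T.
Hypothesis TN : 2 * N <= T.

Lemma block_sum_tail :
  \sum_(k <- ks | T < `|k%:~R - sigma|) `|y k| <= 128 * N / T.
Proof.
apply: (@le_trans _ _ (8 * N * \sum_(k <- ks) Num.max T `|k%:~R - sigma| ^- 2)).
  rewrite mulr_sumr [leLHS]big_mkcond ler_sum// => k _.
  case: ifP => [Tk|_]; last first.
    have m0 : 0 <= Num.max T `|k%:~R - sigma| by rewrite le_max normr_ge0 orbT.
    by rewrite (mulr_ge0 (mulr_ge0 _ N0))// invr_ge0 exprn_ge0.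
  rewrite (max_idPr (ltW Tk)) real_normK ?num_real//.
  have [Q [Phi [Q0 [Phi0 [[dQ dPhi] [dQ0 dPhi0] Pl Pr ->]]]]] := yE k.
  have t0 : 0 < `|k%:~R - sigma| by have := T1; lra.
  apply: (block_tail delta_gt0 delta_half A0 dQ dPhi dQ0 dPhi0 Pl Pr t0).
  by have := TN; lra.
have T0 : 0 < T by have := T1; lra.
have : \sum_(k <- ks) Num.max T `|k%:~R - sigma| ^- 2 <= 2 * (8 / T).
  apply: (sum_int_le (f := fun d => Num.max T d ^- 2)) => //.
  - by move=> d; rewrite invr_ge0 exprn_ge0// le_max ltW.
  - move=> d d' d0 dd; rewrite lef_pV2 ?posrE ?exprn_gt0 ?lt_max ?T0//.
    have m0 u : 0 <= Num.max T u by rewrite le_max ltW.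
    rewrite lerXn2r ?nnegrE ?m0//.
    by rewrite ge_max !le_max lexx dd orbT.
  - by move=> m; apply: sum_invsq; have := T1.
have X0 : 0 <= 8 * N by rewrite mulr_ge0.
move=> H; apply: (le_trans (ler_wpM2l X0 H)).
by rewrite le_eqVlt; apply/orP; left; apply/eqP; field; rewrite gt_eqF.
Qed.

Lemma in_range_count (M z : R) : 0 <= M ->
  \sum_(k <- ks | `|k%:~R - z| <= M) 1 <= 2 * (M + 1).
Proof.
move=> M0; rewrite big_mkcond.
apply: (sum_int_le (f := fun d => if d <= M then 1 else 0)) => //.
- by move=> d; case: ifP.
- move=> d d' d0 dd; case: ifP => d'M; last by case: ifP.
  by rewrite (le_trans dd d'M).
- by move=> m; apply: sum_count.
Qed.

Lemma block_sum_trivial :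
  \sum_(k <- ks | `|k%:~R - sigma| <= T) `|y k| <= 64 * T * N.
Proof.
have T0 : 0 <= T by have := T1; lra.
apply: (@le_trans _ _ (\sum_(k <- ks | `|k%:~R - sigma| <= T) (16 * N) * 1)).
  rewrite ler_sum// => k _; rewrite mulr1.
  have [Q [Phi [Q0 [Phi0 [[dQ dPhi] [dQ0 dPhi0] Pl Pr ->]]]]] := yE k.
  apply: (le_trans (block_trivial delta_gt0 delta_half A0 dQ dPhi dQ0 dPhi0 Pl)).
  rewrite -mulrA ler_wpM2l// ler_piMl// exprn_ile1 ?delta_le1//.
  exact: ltW.
rewrite -mulr_sumr.
have := in_range_count sigma T0 => H.
have X0 : 0 <= 16 * N by rewrite mulr_ge0.
apply: (le_trans (ler_wpM2l X0 H)).
rewrite (_ : 64 * T * N = 16 * N * (4 * T)); last ring.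
by rewrite ler_wpM2l ?mulr_ge0//; have := T1; lra.
Qed.

Lemma sum_kap1_shift (b q : R) : b = 1 \/ b = -1 -> 0 <= q <= N ->
  \sum_(k <- ks | `|k%:~R - sigma| <= T) kap 1 `|b * (k%:~R - sigma) - q| <=
  2 * (2 + ln (2 * T)).
Proof.
move=> b1 /andP[q0 qN]; have T0 : 0 <= T by have := T1; lra.
have E k : `|b * (k%:~R - sigma) - q| = `|k%:~R - (sigma + b * q)|.
  by case: b1 => ->; rewrite ?mul1r ?mulN1r; [|rewrite -normrN]; congr `|_|; ring.
under eq_bigr do rewrite E.
apply: (@le_trans _ _ (\sum_(k <- ks)
   (fun d => if d <= 2 * T then kap 1 d else 0) `|k%:~R - (sigma + b * q)|)).
  rewrite [leLHS]big_mkcond ler_sum// => k _ /=.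
  case: ifP => [kT|_]; last by case: ifP => // _; exact: kap_ge0.
  rewrite ifT// -E (le_trans (ler_normB _ _))// normrM.
  have -> : `|b| = 1 by case: b1 => ->; rewrite ?normrN normr1.
  by rewrite mul1r (ger0_norm q0); have := TN; have := N0; lra.
apply: (sum_int_le (f := fun d => if d <= 2 * T then kap 1 d else 0)) => //.
- by move=> d; case: ifP => // _; exact: kap_ge0.
- move=> d d' d0 dd; case: ifP => d'M; last by case: ifP => // _; exact: kap_ge0.
  by rewrite (le_trans dd d'M) kap_ninc.
- by move=> m; apply: sum_kap1; have := T1; lra.
Qed.

(** The first term collects the kernels at the lattice points and the second the [4 / rho] of each
    of the [O(T)] frequencies. The third is a double count: a point [t] is resonant for at most
    [2 * (rho + 1) <= 4 * rho] frequencies, and only if it lies in an interval of generation [i];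
    these have total length [2 ^ i * delta (L + i)]. *)
Lemma quarter_sum i rho c tau s (Q Phi : int -> R -> R) :
  s = 1 \/ s = -1 -> quarter_data delta L x c tau s -> 1 <= rho ->
  (forall k t, x - 2 * dL <= t <= x + 2 * dL ->
    is_derive t 1 (Q k) (cos (Phi k t))) ->
  (forall k t, x - 2 * dL <= t <= x + 2 * dL -> is_derive t 1 (Phi k)
    (n * A * cantor_bump delta L (t - x) - (k%:~R - sigma))) ->
  \sum_(k <- ks | `|k%:~R - sigma| <= T) `|Q k (c + tau * dL) - Q k c| <=
  32 * 2 ^+ i * (2 + ln (2 * T)) + 16 * T / rho +
    4 * rho * 2 ^+ i * delta (L + i)%N.
Proof.
move=> s1 qd rho1 dQ dPhi.
have rho0 : 0 < rho by lra.
have T0 : 0 <= T by have := T1; lra.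
have p0 : 0 < 2 ^+ i :> R by rewrite exprn_gt0.
pose b := orientation n s.
have b1 : b = 1 \/ b = -1.
  by rewrite /b /orientation; case: ifP; case: s1 => ->; rewrite ?opprK; auto.
have H k : exists lt : nat * (R * R), [/\ (lt.1 <= 2 ^ i)%N, lt.2.1 <= lt.2.2,
    `|Q k (c + tau * dL) - Q k c| <=
      8 * kap 1 `|b * (k%:~R - sigma) - N / 2 ^+ i * lt.1%:R| + 4 / rho +
      (lt.2.2 - lt.2.1) &
    forall u, lt.2.1 < u < lt.2.2 ->
      `|N * psi L u - b * (k%:~R - sigma)| <= rho /\
      exists2 a, a \in cantor_ends delta L i & a <= u <= a + delta (L + i)%N].
  have [dP dPsi E] := quarter_transport (dQ k) (dPhi k) qd.
  have [l [t0 [t1 [li t01 DP near]]]] := quarter_single_scale delta_gt0 delta_half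
    N0 dP dPsi i rho0 (delta_le1 L).
  by exists (l, (t0, t1)); rewrite -E.
have [f fP] := choice H.
apply: (@le_trans _ _ (\sum_(k <- ks | `|k%:~R - sigma| <= T)
  (8 * (\sum_(l < (2 ^ i).+1)
     kap 1 `|b * (k%:~R - sigma) - N / 2 ^+ i * l%:R|) + 4 / rho * 1 +
   ((f k).2.2 - (f k).2.1)))).
  rewrite ler_sum// => k _; have [fi f01 fD _] := fP k.
  rewrite (le_trans fD)// lerD2r mulr1 lerD2r ler_wpM2l//.
  rewrite (bigD1 (inord (f k).1))//= inordK// lerDl sumr_ge0// => j _.
  exact: kap_ge0.
rewrite big_split/= [X in X + _]big_split/= -!mulr_sumr lerD//; last first.
  pose ks' := [seq k <- ks | `|k%:~R - sigma| <= T].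
  rewrite -big_filter -/ks'.
  have -> : 4 * rho * 2 ^+ i * delta (L + i)%N =
    4 * rho * \sum_(a <- cantor_ends delta L i) (a + delta (L + i)%N - a).
    rewrite (eq_bigr (fun=> delta (L + i)%N)); last by move=> a _; ring.
    rewrite big_const_seq count_predT size_cantor_ends iter_addr_0 -[X in _ = _ * X]mulr_natr natrX.
    by ring.
  apply: (@interval_count R int R ks' _ (fun k => (f k).2.1) (fun k => (f k).2.2)
     id (fun a => a + delta (L + i)%N)) => [||a|t].
  - by rewrite mulr_ge0// ltW.
  - by move=> k; have [_ ? _ _] := fP k.
  - by rewrite lerDl ltW.
  have [[a am at_]|nE] := pselect (exists2 a, a \in cantor_ends delta L i &
      a <= t <= a + delta (L + i)%N).
    have M1 : 1 <= \sum_(j <- cantor_ends delta L i)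
        \1_(`[id j, j + delta (L + i)%N]%classic) t :> R.
      rewrite (big_rem a)//= indicE mem_set/=; last by rewrite in_itv.
      by rewrite lerDl sumr_ge0.
    apply: (@le_trans _ _ (4 * rho * 1)); last by rewrite ler_wpM2l// mulr_ge0// ltW.
    apply: (@le_trans _ _ (\sum_(k <- ks |
        `|k%:~R - (sigma + b * (N * psi L t))| <= rho) 1)).
      rewrite [leRHS]big_mkcond /ks' big_filter [leLHS]big_mkcond ler_sum// => k _.
      case: ifP => _; last by case: ifP.
      rewrite indicE; case: (boolP (t \in _)) => [|_]; last by case: ifP.
      rewrite inE/= in_itv/= => tk; have [_ _ _ near] := fP k.
      have [h _] := near _ tk; rewrite ifT//.
      apply: le_trans h; rewrite le_eqVlt; apply/orP; left; apply/eqP.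
      by case: b1 => ->; rewrite ?mul1r ?mulN1r; [rewrite -normrN|]; congr `|_|; ring.
    have := in_range_count (sigma + b * (N * psi L t)) (ltW rho0).
    by lra.
  rewrite big1_seq ?mulr_ge0 ?sumr_ge0 1?ltW// => k _.
  rewrite indicE memNset//= in_itv/= => tk; have [_ _ _ near] := fP k.
  by have [_] := near _ tk.
rewrite lerD//.
  rewrite exchange_big/=.
  have lnT : 0 <= 2 + ln (2 * T).
    by rewrite addr_ge0// ln_ge0//; have := T1; lra.
  apply: (@le_trans _ _ (8 * \sum_(l < (2 ^ i).+1) (2 * (2 + ln (2 * T))))).
    rewrite ler_wpM2l// ler_sum// => l _; apply: sum_kap1_shift => //.
    rewrite mulr_ge0 ?divr_ge0 ?(ltW p0)//= mulrAC ler_pdivrMr//.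
    by rewrite ler_wpM2l// -natrX ler_nat -ltnS.
  rewrite sumr_const card_ord -[X in 8 * X]mulr_natl.
  have : (2 ^ i).+1%:R <= 2 * 2 ^+ i :> R.
    by rewrite -natrX -natrM ler_nat; have := expn_gt0 2 i; lia.
  move=> Hi; have := ler_wpM2r (mulr_ge0 (ler0n R 2) lnT) Hi.
  lra.
have := in_range_count sigma T0 => Hc.
have h4 : 0 <= 4 / rho by rewrite divr_ge0// ltW.
apply: (le_trans (ler_wpM2l h4 Hc)).
rewrite (_ : 16 * T / rho = 4 / rho * (4 * T)); last ring.
by rewrite ler_wpM2l//; have := T1; lra.
Qed.

Lemma block_sum_single_scale i rho : 1 <= rho ->
  \sum_(k <- ks | `|k%:~R - sigma| <= T) `|y k| <=
  4 * (34 * 2 ^+ i * (2 + ln (2 * T)) + 16 * T / rho +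
    4 * rho * 2 ^+ i * delta (L + i)%N).
Proof.
move=> rho1.
have [Q QP] := choice yE; have [Phi PhiP] := choice QP.
have [Q0 Q0P] := choice PhiP; have [Phi0 H] := choice Q0P => {QP PhiP Q0P}.
have dQ k := let: And5 (conj h _) _ _ _ _ := H k in h.
have dPhi k := let: And5 (conj _ h) _ _ _ _ := H k in h.
have dQ0 k := let: And5 _ (conj h _) _ _ _ := H k in h.
have dPhi0 k := let: And5 _ (conj _ h) _ _ _ := H k in h.
have yQ k := let: And5 _ _ _ _ h := H k in h.
have q1 := quarter_sum i (or_introl erefl)
  (quarter_data1 delta_gt0 delta_half L x) rho1 dQ dPhi.
have q2 := quarter_sum i (or_introl erefl)
  (quarter_data2 delta_gt0 delta_half L x) rho1 dQ dPhi.
have q3 := quarter_sum i (or_intror erefl)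
  (quarter_data3 delta_gt0 delta_half L x) rho1 dQ dPhi.
have q4 := quarter_sum i (or_intror erefl)
  (quarter_data4 delta_gt0 delta_half L x) rho1 dQ dPhi.
have T0 : 0 <= T by have := T1; lra.
have lnT : 0 <= 2 + ln (2 * T).
  by rewrite addr_ge0// ln_ge0//; have := T1; lra.
(* The contribution of the linear phase; a quarter of it is added to each 32 and makes the 34. *)
have q5 : \sum_(k <- ks | `|k%:~R - sigma| <= T) 4 * kap 1 `|k%:~R - sigma| <=
    8 * 2 ^+ i * (2 + ln (2 * T)).
  rewrite -mulr_sumr.
  have := @sum_kap1_shift 1 0 (or_introl erefl).
  rewrite lexx N0 => /(_ isT).
  under eq_bigr do rewrite mul1r subr0.
  have i1 : 1 <= 2 ^+ i :> R by rewrite exprn_ege1//; lra.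
  have := ler_wpM2r lnT i1.
  lra.
apply: (@le_trans _ _ (\sum_(k <- ks | `|k%:~R - sigma| <= T)
  (`|Q k (x - 2 * dL + 1 * dL) - Q k (x - 2 * dL)| +
   `|Q k (x + -1 * dL) - Q k x| + `|Q k (x + 1 * dL) - Q k x| +
   `|Q k (x + 2 * dL + -1 * dL) - Q k (x + 2 * dL)| +
   4 * kap 1 `|k%:~R - sigma|))).
  rewrite ler_sum// => k _; rewrite yQ.
  exact: (block_le_quarters delta_gt0 (Q k) (dQ0 k) (dPhi0 k) ltr01 (delta_le1 L)).
rewrite !big_split/=.
move: q1 q2 q3 q4 q5; lra.
Qed.

End p_eq1.
End block_sums.

Section monotone_integral.
Variable R : realType.
Local Notation mu := (@lebesgue_measure R).

Lemma nonincreasing_integrable (g : R -> R) (a b : R) :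
  {homo g : s t /~ s <= t} -> mu.-integrable `[a, b] (EFin \o g).
Proof.
move=> gm; apply: measurable_bounded_integrable => //.
- by rewrite [ltLHS]lebesgue_measure_itv /=; case: ifP => _; rewrite ?ltry// -EFinD ltry.
- by apply: nonincreasing_measurable => // s t st; exact: gm.
exists (`|g a| + `|g b|); split; first by rewrite realD ?num_real.
move=> M gM t /=; rewrite in_itv/= => /andP[at_ tb].
apply: le_trans (ltW gM); rewrite ler_norml.
have := gm _ _ at_; have := gm _ _ tb; have := ler_norm (g a); have := ler_norm (- g b).
by rewrite normrN; have := normr_ge0 (g a); have := normr_ge0 (g b); lra.
Qed.

Lemma nonincreasing_integral_ge (g : R -> R) (c a b : R) :
  {homo g : s t /~ s <= t} -> c <= a -> a <= b ->
  \int[mu]_(t in `[c, a]) g t + (b - a) * g b <= \int[mu]_(t in `[c, b]) g t.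
Proof.
move=> gm ca ab; rewrite addrC -lerBrDr.
rewrite (Rintegral_itvB (nonincreasing_integrable c b gm)) ?bnd_simp//.
have sub : `]a, b]%classic `<=` `[a, b]%classic.
  by move=> t /=; rewrite !in_itv/= => /andP[/ltW -> ->].
have gi : mu.-integrable `]a, b] (EFin \o g).
  by apply: integrableS (nonincreasing_integrable a b gm).
apply: (@le_trans _ _ (\int[mu]_(_ in `]a, b]) g b)).
  rewrite Rintegral_cst//.
  rewrite [X in fine X](_ : _ = (b - a)%:E); last first.
    rewrite [LHS]lebesgue_measure_itv /= lte_fin; case: ltP => // ba.
    by rewrite (_ : b = a) ?subrr//; apply/eqP; rewrite eq_le ab ba.
  by rewrite mulrC.
apply: le_Rintegral => //.
  by apply: integrableS (@nonincreasing_integrable (fun=> g b) a b _).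
by move=> t /=; rewrite in_itv/= => /andP[_ tb]; exact: gm.
Qed.

End monotone_integral.

(** * The moduli and the functions Theta *)

Section modulus.
Variables (R : realType) (w : R -> R).
Hypothesis w_cont : {within [set d : R | 0 <= d], continuous w}.
Hypothesis w_ndecr : forall d1 d2 : R, 0 <= d1 -> d1 <= d2 -> w d1 <= w d2.
Hypothesis w0 : w 0 = 0.
Hypothesis w_double : \forall d \near (0 : R)^'+, w (2 * d) < 2 * w d.

Lemma modulus_ge0 d : 0 <= d -> 0 <= w d.
Proof. by move=> d0; rewrite -w0 w_ndecr. Qed.

(** For small [e], [w e <= w (2 * e) < 2 * w e] forces [w e] to be positive; monotonicity carries
    this to all [d]. *)
Lemma modulus_gt0 d : 0 < d -> 0 < w d.
Proof.
move=> d0; near (0 : R)^'+ => e.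
have e0 : 0 < e by near: e; exact: nbhs_right_gt.
have ed : e < d by near: e; exact: nbhs_right_lt.
have H : w (2 * e) < 2 * w e by near: e.
have := w_ndecr (ltW e0) (_ : e <= 2 * e).
have := w_ndecr (ltW e0) (ltW ed).
have -> : e <= 2 * e by lra.
by move=> ? /(_ isT); lra.
Unshelve. all: by end_near. Qed.

Lemma modulus_ivt a v : 0 <= a -> 0 <= v <= w a ->
  exists2 d, 0 <= d <= a & w d = v.
Proof.
move=> a0 va; have [||d] := @IVT R w 0 a v a0.
- apply: continuous_subspaceW w_cont => t /=.
  by rewrite in_itv/= => /andP[].
- rewrite w0; have := modulus_ge0 a0 => wa.
  by rewrite (min_idPl wa) (max_idPr wa).
by rewrite in_itv/= => da <-; exists d.
Qed.

Lemma modulus_small e : 0 < e -> exists2 d, 0 < d & w d <= e.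
Proof.
move=> e0; have [e1|e1] := lerP e (w 1).
  have [|d /andP[d0 d1] wd] := @modulus_ivt 1 e ler01; first by rewrite e1 ltW.
  exists d; last by rewrite wd.
  by rewrite lt0r d0 andbT; apply: contraTneq e0 => dE; rewrite -wd dE w0 ltxx.
by exists 1 => //; exact: ltW.
Qed.

(** The values [c * 2 ^- k] are attained by the intermediate value theorem. If
    [delta k <= 2 * delta k.+1], then [w (delta k) <= w (2 * delta k.+1) < 2 * w (delta k.+1) = w
    (delta k)], a contradiction. *)
Lemma modulus_scales : exists (delta : nat -> R) (c : R),
  [/\ 0 < c <= 1, forall k, 0 < delta k, forall k, delta k <= 1,
    forall k, 2 * delta k.+1 < delta k & forall k, w (delta k) = c * 2 ^- k].
Proof.
have [e /= e0 He] := w_double.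
have [d1 d10 wd1] := modulus_small ltr01.
(* The three bounds give [c = w eta <= 1], scales at most 1, and validity of the doubling hypothesis
   at every scale. *)
pose eta := Num.min (Num.min d1 1) (e / 2).
have eta0 : 0 < eta by rewrite !lt_min d10 ltr01 divr_gt0.
have eta1 : eta <= 1 by rewrite !ge_min lexx orbT.
have etae : eta < e by rewrite !gt_min; apply/orP; right; lra.
have weta : w eta <= 1.
  apply: le_trans wd1; apply: w_ndecr; first exact: ltW.
  by rewrite !ge_min lexx.
have w_gt0 := modulus_gt0 eta0.
have H k : exists d, 0 <= d <= eta /\ w d = w eta * 2 ^- k.
  have [|d dE wd] := @modulus_ivt eta (w eta * 2 ^- k) (ltW eta0); last by exists d.
  rewrite mulr_ge0 ?invr_ge0 ?exprn_ge0 ?(ltW w_gt0)//=.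
  by rewrite ler_piMr ?(ltW w_gt0)// invf_le1 ?exprn_gt0// exprn_ege1// ler1n.
have [delta dP] := choice H.
have d0 k : 0 < delta k.
  have [/andP[d0 _] wd] := dP k; rewrite lt0r d0 andbT.
  apply: contra_eqN wd => /eqP ->; rewrite w0 eq_sym.
  by rewrite gt_eqF// mulr_gt0// invr_gt0 exprn_gt0.
exists delta, (w eta); split=> //.
- by rewrite w_gt0.
- by move=> k; have [/andP[_ ?] _] := dP k; rewrite (le_trans _ eta1).
- move=> k; rewrite ltNge; apply/negP => /(w_ndecr (ltW (d0 k))).
  have [/andP[_ dk] wd] := dP k.+1.
  have : w (2 * delta k.+1) < 2 * w (delta k.+1).
    apply: He => //=; rewrite sub0r normrN gtr0_norm//.
    exact: le_lt_trans etae.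
  have [_ ->] := dP k; rewrite wd exprS invfM.
  by lra.
- by move=> k; have [_] := dP k.
Qed.

Lemma chi_lt a b : 0 <= a -> a < b -> chi w a < chi w b.
Proof.
move=> a0 ab; have b0 : 0 < b by exact: le_lt_trans ab.
rewrite /chi (@le_lt_trans _ _ (a * w b))// ?ler_wpM2l ?w_ndecr// ?ltW//.
by rewrite ltr_pM2r ?modulus_gt0.
Qed.

Lemma chi_invP y : 0 <= y -> 0 <= chi_inv w y /\ chi w (chi_inv w y) = y.
Proof.
move=> y0; pose S := [set d : R | 0 <= d].
have yS : y \in chi w @` S.
  rewrite inE; pose M := y / w 1 + 1.
  have w1 := modulus_gt0 ltr01.
  have M1 : 1 <= M by rewrite lerDr divr_ge0// ltW.
  have M0 : 0 <= M by lra.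
  have cM : y <= chi w M.
    rewrite /chi (@le_trans _ _ (M * w 1))// ?ler_wpM2l// ?w_ndecr//.
    by rewrite mulrDl divfK ?gt_eqF// mul1r lerDl ltW.
  have [||d] := @IVT R (chi w) 0 M y M0.
  - have cw : {within `[0, M], continuous w}.
      apply: continuous_subspaceW w_cont => t /=.
      by rewrite in_itv/= => /andP[].
    have ci : {within `[0, M], continuous (@id R)}.
      by apply: continuous_subspaceT => t; exact: cvg_id.
    by move=> t; apply: continuousM; [exact: ci|exact: cw].
  - rewrite /chi mul0r -/(chi w M).
    by rewrite (min_idPl (le_trans y0 cM)) (max_idPr (le_trans y0 cM)) y0.
  by rewrite in_itv/= => /andP[d0 _] <-; exists d.
split; last exact: (@pinvK _ _ (fun=> 0) S (chi w) y yS).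
have surj : set_surj S (chi w @` S) (chi w) by [].
have := @surjpinv_image_sub _ _ (fun=> 0) S _ _ surj (chi_inv w y).
by apply; exists y => //; rewrite inE in yS.
Qed.

Lemma chi_inv_ge d y : 0 <= d -> chi w d <= y -> d <= chi_inv w y.
Proof.
move=> d0 dy; have y0 : 0 <= y.
  by apply: le_trans dy; rewrite /chi mulr_ge0 ?modulus_ge0.
have [c0 cy] := chi_invP y0; rewrite leNgt; apply/negP => /(chi_lt c0).
by rewrite cy ltNge dy.
Qed.

Lemma chi_inv_lt d y : 0 <= y -> 0 <= d -> y < chi w d -> chi_inv w y < d.
Proof.
move=> y0 d0 yd; have [c0 cy] := chi_invP y0; rewrite ltNge; apply/negP => dc.
have [dE|] := eqVneq d (chi_inv w y); first by move: yd; rewrite dE cy ltxx.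
move=> dn; have /(chi_lt d0) : d < chi_inv w y by rewrite lt_neqAle dn.
by rewrite cy; lra.
Qed.

Lemma chi_inv_mono y y' : 0 <= y -> y <= y' -> chi_inv w y <= chi_inv w y'.
Proof.
move=> y0 yy; have [c0 cy] := chi_invP y0.
by apply: chi_inv_ge => //; rewrite cy.
Qed.

Variables (delta : nat -> R) (c : R).
Hypothesis c01 : 0 < c <= 1.
Hypothesis delta_gt0 : forall k, 0 < delta k.
Hypothesis delta_le1 : forall k, delta k <= 1.
Hypothesis delta_half : forall k, 2 * delta k.+1 < delta k.
Hypothesis w_delta : forall k, w (delta k) = c * 2 ^- k.

Let c0 : 0 < c. Proof. by case/andP: c01. Qed.
Let c1 : c <= 1. Proof. by case/andP: c01. Qed.

Lemma delta_le_half k : delta k <= 2 ^- k.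
Proof.
have := delta_le_expn delta_half 0 k; rewrite add0n => /le_trans; apply.
by rewrite ler_piMl ?invr_ge0 ?exprn_ge0.
Qed.

(** From [D * w D = (ln y) ^ 2 / y]. In this form [Theta] can be compared with the values
    [w (delta j) = c * 2 ^- j]. *)
Lemma Theta1E y : 1 < y -> 0 < chi_inv w (ln y ^+ 2 / y) /\
  Theta w 1 y = ln y / w (chi_inv w (ln y ^+ 2 / y)).
Proof.
move=> y1; have l0 := ln_gt0 y1; have y0 : 0 < y by lra.
have x0 : 0 < ln y ^+ 2 / y by rewrite divr_gt0// exprn_gt0.
have [D0 DE] := chi_invP (ltW x0).
rewrite /Theta eqxx; set D := chi_inv w _ in D0 DE *.
have D1 : 0 < D.
  by rewrite lt0r D0 andbT; apply: contraTneq x0 => D_0; rewrite -DE D_0 /chi mul0r ltxx.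
split=> //; have wD := modulus_gt0 D1.
have -> : D = ln y ^+ 2 / y / w D by rewrite -DE /chi mulfK// gt_eqF.
(* The rewriting also reached the argument of [w] and is undone there. *)
have -> : w (ln y ^+ 2 / y / w D) = w D.
  by congr w; rewrite -DE /chi mulfK// gt_eqF.
by field; rewrite !gt_eqF.
Qed.

(** Let [D = chi^-1 ((ln y) ^ 2 / y)] and let [j] be the first index with [delta j <= D]. Then
    [w D <= w (delta j.-1)] bounds [Theta] from below, while [w D >= w (delta j)] bounds
    [y * D = (ln y) ^ 2 / w D] from above. *)
Lemma Theta1_scale m : exists2 Y, 2 <= Y & forall y, Y <= y ->
  exists j, [/\ (m <= j)%N, 2 ^+ j * ln y <= 2 * Theta w 1 y &
    y * 2 ^+ j * delta j <= (2 ^+ j * ln y) ^+ 2 / c].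
Proof.
pose X := chi w (delta m); have X0 : 0 < X by rewrite mulr_gt0 ?modulus_gt0.
(* As [ln y < 4 * y ^ (1 / 4)], the quotient [(ln y) ^ 2 / y] is below [16 / sqrt y], hence below
   [X] beyond this threshold. *)
exists (Num.max 2 ((16 / X) ^+ 2)); first by rewrite le_max lexx.
move=> y; rewrite ge_max => /andP[y2 yX].
have y1 : 1 < y by lra.
have y0 : 0 < y by lra.
have l0 := ln_gt0 y1.
have [] := Theta1E y1; set D := chi_inv w _ => D0 ThE.
have x0 : 0 <= ln y ^+ 2 / y by rewrite divr_ge0 ?exprn_ge0// ltW.
have xX : ln y ^+ 2 / y < X.
  pose s := Num.sqrt (Num.sqrt y).
  have s0 : 0 < s by rewrite !sqrtr_gt0.
  have s2 : s ^+ 2 = Num.sqrt y by rewrite sqr_sqrtr// sqrtr_ge0.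
  have s4 : s ^+ 4 = y by rewrite (exprM s 2 2) s2 sqr_sqrtr// ltW.
  have ly : ln y < 4 * s.
    by rewrite -s4 lnXn// -[ltLHS]mulr_natl ltr_pM2l ?ltr0n// ln_sublinear.
  have sX : 16 / X <= s ^+ 2.
    rewrite s2 -[leLHS]gtr0_norm ?divr_gt0// -sqrtr_sqr.
    by rewrite ler_sqrt// ltW.
  have l2 : ln y ^+ 2 < 16 * s ^+ 2.
    rewrite (_ : 16 * s ^+ 2 = (4 * s) ^+ 2); last ring.
    by rewrite ltrXn2r ?nnegrE ?ltW// ?mulr_gt0.
  rewrite ltr_pdivrMr// (lt_le_trans l2)// -s4 (exprM s 2 2) [leRHS]mulrA.
  rewrite ler_wpM2r ?exprn_ge0 ?(ltW s0)// mulrC.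
  by rewrite -ler_pdivrMr.
have Dm : D < delta m by apply: chi_inv_lt => //; exact: ltW.
have ex : exists j, delta j <= D.
  have [N N1] : exists N : nat, D^-1 < N%:R.
    by exists (Num.truncn D^-1).+1; exact: truncnS_gt.
  exists N; rewrite (le_trans (delta_le_half N))//.
  rewrite -[leRHS]invrK lef_pV2 ?posrE ?exprn_gt0 ?invr_gt0//.
  by rewrite (le_trans (ltW N1))// -natrX ler_nat ltnW// ltn_expl.
case: (ex_minnP ex) => j jD jmin.
have mj : (m < j)%N.
  rewrite ltnNge; apply/negP => jm.
  by have := delta_le delta_gt0 delta_half jm; lra.
exists j; split; first exact: ltnW.
  have j0 := leq_ltn_trans (leq0n m) mj; rewrite -(prednK j0).
  have jD' : D < delta j.-1.
    by rewrite ltNge; apply/negP => /jmin; rewrite -ltnS prednK// ltnn.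
  have wD : w D <= 2 ^- j.-1.
    rewrite (le_trans (w_ndecr (ltW D0) (ltW jD')))// w_delta.
    by rewrite ler_piMl ?invr_ge0 ?exprn_ge0.
  rewrite ThE exprS -mulrA ler_wpM2l// mulrC ler_wpM2l ?(ltW l0)//.
  by rewrite -[leLHS]invrK lef_pV2 ?posrE ?invr_gt0 ?exprn_gt0 ?modulus_gt0//.
have p0 : 0 < 2 ^+ j :> R by rewrite exprn_gt0.
have wD : c * 2 ^- j <= w D by rewrite -w_delta w_ndecr// ltW.
have wD0 := modulus_gt0 D0.
have DE : y * D = ln y ^+ 2 / w D.
  have [_] := chi_invP x0; rewrite -/D /chi => E.
  have -> : D = ln y ^+ 2 / y / w D by rewrite -E mulfK// gt_eqF.
  have -> : w (ln y ^+ 2 / y / w D) = w D.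
    by congr w; rewrite -E mulfK// gt_eqF.
  by field; rewrite !gt_eqF.
apply: (@le_trans _ _ (2 ^+ j * (y * D))).
  by rewrite mulrAC mulrC ler_wpM2l ?(ltW p0)// ler_wpM2l// ltW.
rewrite DE exprMn.
have -> : 2 ^+ j ^+ 2 * ln y ^+ 2 / c = 2 ^+ j * (ln y ^+ 2 / (c * 2 ^- j)).
  by field; rewrite !gt_eqF.
rewrite ler_wpM2l ?(ltW p0)// ler_wpM2l ?exprn_ge0 ?(ltW l0)//.
by rewrite lef_pV2 ?posrE// mulr_gt0// invr_gt0.
Qed.

End modulus.

(** * The integral in Theta for [p > 1] and sums over scales *)

Section theta_p.
Variables (R : realType) (w : R -> R).
Hypothesis w_cont : {within [set d : R | 0 <= d], continuous w}.
Hypothesis w_ndecr : forall d1 d2 : R, 0 <= d1 -> d1 <= d2 -> w d1 <= w d2.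
Hypothesis w0 : w 0 = 0.
Hypothesis w_double : \forall d \near (0 : R)^'+, w (2 * d) < 2 * w d.
Variables (delta : nat -> R) (c : R).
Hypothesis c01 : 0 < c <= 1.
Hypothesis delta_gt0 : forall k, 0 < delta k.
Hypothesis delta_le1 : forall k, delta k <= 1.
Hypothesis delta_half : forall k, 2 * delta k.+1 < delta k.
Hypothesis w_delta : forall k, w (delta k) = c * 2 ^- k.
Variable p : R.
Hypothesis p1 : 1 < p.
Local Notation mu := (@lebesgue_measure R).

Let c0 : 0 < c. Proof. by case/andP: c01. Qed.
Let p0 : 0 < p. Proof. exact: lt_trans p1. Qed.

(** The maximum makes the profile nonincreasing on the whole line without changing it on
    [[1, y]]. *)
Let g tau := chi_inv w (Num.max 1 tau)^-1 `^ p.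

Let J y := \int[mu]_(t in `[1, y]) g t.

Lemma scale_profile_mono : {homo g : s t /~ s <= t}.
Proof.
move=> s t ts; have m0 u : 0 < Num.max 1 u :> R by rewrite lt_max ltr01.
have i0 u : 0 <= (Num.max 1 u : R)^-1 by rewrite invr_ge0 ltW.
have [cs _] := chi_invP w_cont w_ndecr w_double (i0 s).
have [ct _] := chi_invP w_cont w_ndecr w_double (i0 t).
rewrite /g ge0_ler_powR ?nnegrE ?(ltW p0)// (chi_inv_mono w_cont w_ndecr w0 w_double)//.
rewrite lef_pV2 ?posrE//.
by rewrite ge_max !le_max lexx ts orbT.
Qed.

Lemma scale_profile_ge0 t : 0 <= g t. Proof. exact: powR_ge0. Qed.

Lemma scale_integral_ge0 y : 0 <= J y.
Proof. by apply: Rintegral_ge0 => t _; exact: scale_profile_ge0. Qed.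

Lemma scale_integral_mono y y' : 1 <= y -> y <= y' -> J y <= J y'.
Proof.
move=> y1 yy; have := nonincreasing_integral_ge scale_profile_mono y1 yy.
by apply: le_trans; rewrite lerDl mulr_ge0 ?subr_ge0 ?scale_profile_ge0.
Qed.

Lemma Theta_powR y : Theta w p y `^ p = J y.
Proof.
rewrite /Theta gt_eqF// -powRrM mulVf ?gt_eqF// powRr1; last first.
  by apply: Rintegral_ge0 => t _; exact: powR_ge0.
rewrite /J; apply: eq_Rintegral => t; rewrite inE/= in_itv/= => /andP[t1 _].
by rewrite /g (max_idPr t1).
Qed.

Lemma Theta_powR_gt0 : exists2 b, 0 < b & forall y, 2 <= y -> b <= J y.
Proof.
have h0 : 0 <= 2^-1 :> R by rewrite invr_ge0.
have [d0 dE] := chi_invP w_cont w_ndecr w_double h0.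
exists (g 2).
  rewrite /g (max_idPr _) ?ler1n// powR_gt0// lt0r d0 andbT.
  apply/eqP => dz; move: dE; rewrite dz /chi mul0r => /esym/eqP.
  by rewrite invr_eq0 pnatr_eq0.
move=> y y2; apply: le_trans (scale_integral_mono _ y2); last by rewrite ler1n.
have := nonincreasing_integral_ge scale_profile_mono (lexx 1) (ler1n R 2).
apply: le_trans; have -> : 2 - 1 = 1 :> R by lra.
by rewrite mul1r lerDr scale_integral_ge0.
Qed.

(* The inverse of [chi w (delta k)]. *)
Definition scale_time k := 2 ^+ k / (c * delta k).

Lemma scale_time_gt0 k : 0 < scale_time k.
Proof. by rewrite divr_gt0 ?exprn_gt0// mulr_gt0. Qed.

Lemma scale_timeS k : 4 * scale_time k <= scale_time k.+1.
Proof.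
rewrite /scale_time ler_pdivlMr ?mulr_gt0//.
have -> : 4 * (2 ^+ k / (c * delta k)) * (c * delta k.+1) =
  2 ^+ k.+1 * (2 * delta k.+1 / delta k).
  by rewrite exprS; field; rewrite !gt_eqF.
rewrite ler_piMr ?exprn_ge0// ler_pdivrMr// mul1r.
exact: (ltW (delta_half k)).
Qed.

Lemma scale_time_ge1 k : 1 <= scale_time k.
Proof.
elim: k => [|k IHk].
  have [_ c1] := andP c01; rewrite /scale_time expr0 mul1r invf_ge1 ?mulr_gt0//.
  by rewrite mulr_ile1 ?(ltW c0) ?(ltW (delta_gt0 _)).
by have := scale_timeS k; lra.
Qed.

Lemma scale_time_le i j : (i <= j)%N -> scale_time i <= scale_time j.
Proof.
move=> /subnK <-; elim: (j - i)%N => [|n IHn]; first by [].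
rewrite addSn (le_trans IHn)//.
by have := scale_timeS (n + i)%N; have := scale_time_gt0 (n + i)%N; lra.
Qed.

Lemma scale_time_unbounded y : exists K, y <= scale_time K.
Proof.
have H k : k%:R <= scale_time k.
  elim: k => [|k IHk]; first exact: (ltW (scale_time_gt0 _)).
  by rewrite -natr1; have := scale_timeS k; have := scale_time_ge1 k; lra.
by exists (Num.truncn y).+1; rewrite (le_trans _ (H _))// ltW// truncnS_gt.
Qed.

Lemma scale_profile_ge k : delta k `^ p <= g (scale_time k).
Proof.
rewrite /g (max_idPr (scale_time_ge1 k)).
have i0 : 0 <= (scale_time k)^-1 by rewrite invr_ge0 ltW// scale_time_gt0.
have [cs _] := chi_invP w_cont w_ndecr w_double i0.
rewrite ge0_ler_powR ?nnegrE ?(ltW p0) ?(ltW (delta_gt0 k))//.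
apply: (chi_inv_ge w_cont w_ndecr w0 w_double); first exact: ltW.
rewrite /chi w_delta /scale_time invf_div le_eqVlt; apply/orP; left.
by apply/eqP; ring.
Qed.

(** A lower Riemann sum on the intervals between consecutive scale times. These times grow at least
    fourfold, so the interval ending at [scale_time K.+1] is longer than half of it, and [scale_time
    k * delta k ^ p = 2 ^ k * delta k ^ (p - 1) / c]. *)
Lemma scale_integral_sum K :
  \sum_(j < K) 2 ^+ j.+1 * delta j.+1 `^ (p - 1) <= 2 * J (scale_time K).
Proof.
elim: K => [|K IHK]; first by rewrite big_ord0 mulr_ge0// scale_integral_ge0.
rewrite big_ord_recr /= (le_trans (lerD IHK (lexx _)))//.
have t4 := scale_timeS K; have t0 := scale_time_gt0 K.
have tK : scale_time K <= scale_time K.+1 by lra.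
have := nonincreasing_integral_ge scale_profile_mono (scale_time_ge1 K) tK.
rewrite -!/(J _) => H.
have pE : delta K.+1 `^ p = delta K.+1 `^ (p - 1) * delta K.+1.
  rewrite -[X in _ = _ * X]powRr1 ?(ltW (delta_gt0 _))// -powRD ?subrK//.
  by rewrite [delta _ == 0]gt_eqF// implybT.
have h1 : 0 <= delta K.+1 `^ p by exact: powR_ge0.
have h2 : scale_time K.+1 / 2 * delta K.+1 `^ p <=
    (scale_time K.+1 - scale_time K) * g (scale_time K.+1).
  by rewrite ler_pM// ?scale_profile_ge//; lra.
have h3 : 2 ^+ K.+1 * delta K.+1 `^ (p - 1) <= scale_time K.+1 * delta K.+1 `^ p.
  have -> : scale_time K.+1 * delta K.+1 `^ p =
      2 ^+ K.+1 * delta K.+1 `^ (p - 1) / c.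
    by rewrite pE /scale_time; field; rewrite !gt_eqF.
  rewrite ler_pdivlMr// ler_piMr ?mulr_ge0 ?powR_ge0 ?exprn_ge0//.
  by case/andP: c01.
lra.
Qed.

Lemma Theta_powR_sum : exists2 C, 0 <= C & forall y K, 2 <= y ->
  (forall j, (j < K)%N -> scale_time j <= y) ->
  1 + \sum_(j < K) 2 ^+ j * delta j `^ (p - 1) <= C * Theta w p y `^ p.
Proof.
have [b b0 bJ] := Theta_powR_gt0.
(* The Riemann sum misses [j = 0]; this term is at most 1 and, with the leading 1, is paid for by
   [2 <= 2 / b * J y]. *)
exists (2 / b + 2); first by rewrite addr_ge0// divr_ge0// ltW.
move=> y K y2 yK; rewrite Theta_powR.
have h1 : 2 <= 2 / b * J y.
  by rewrite mulrAC ler_pdivlMr// ler_wpM2l// bJ.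
have Jy := scale_integral_ge0 y.
case: K yK => [|K] yK; first by rewrite big_ord0; lra.
rewrite big_ord_recl expr0 mul1r.
have d1 : delta 0%N `^ (p - 1) <= 1.
  apply: (@le_trans _ _ (1 `^ (p - 1))); last by rewrite powR1.
  by rewrite ge0_ler_powR ?nnegrE ?subr_ge0 ?(ltW p1) ?(ltW (delta_gt0 _)).
have := scale_integral_sum K.
have := scale_integral_mono (scale_time_ge1 K) (yK K (ltnSn K)).
rewrite /bump /=; under [X in _ -> X <= _ -> _]eq_bigr do rewrite -add1n.
lra.
Qed.

End theta_p.

(** * Block sums in terms of Theta *)

Section block_theta.
Variables (R : realType) (w : R -> R).
Hypothesis w_cont : {within [set d : R | 0 <= d], continuous w}.
Hypothesis w_ndecr : forall d1 d2 : R, 0 <= d1 -> d1 <= d2 -> w d1 <= w d2.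
Hypothesis w0 : w 0 = 0.
Hypothesis w_double : \forall d \near (0 : R)^'+, w (2 * d) < 2 * w d.
Variables (delta : nat -> R) (c : R).
Hypothesis c01 : 0 < c <= 1.
Hypothesis delta_gt0 : forall k, 0 < delta k.
Hypothesis delta_le1 : forall k, delta k <= 1.
Hypothesis delta_half : forall k, 2 * delta k.+1 < delta k.
Hypothesis w_delta : forall k, w (delta k) = c * 2 ^- k.

Let c0 : 0 < c. Proof. by case/andP: c01. Qed.
Let c1 : c <= 1. Proof. by case/andP: c01. Qed.

(** Generation [i] of the block has scale index [L + i], so replacing [2 ^ i] by [2 ^ (L + i)] gains
    [2 ^- L], which is at most [2 ^ (- (p - 1) L)] because [p < 2]. The generation 0 term
    [delta L ^ (p - 1)] decays at the same rate. *)
Lemma block_sum_Theta_p p : 1 < p -> p < 2 -> exists2 C, 0 <= C &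
  forall n L x A sigma ks y, 2 <= `|n| -> 0 <= A <= c * 2 ^- L -> uniq ks ->
  (forall k, block_term delta L x n A (k%:~R - sigma) (y k)) ->
  \sum_(k <- ks) `|y k| `^ p <=
    C * (2 `^ (- (p - 1))) ^+ L * Theta w p `|n| `^ p.
Proof.
move=> p1 p2.
have [C C0 CP] := Theta_powR_sum w_cont w_ndecr w0 w_double c01 delta_gt0
  delta_le1 delta_half w_delta p1.
pose M := 8 `^ p * 9 `^ p * 8 * (8 * (2 `^ p * (1 + (p - 1)^-1))).
have M0 : 0 <= M.
  have q0 : 0 <= 1 + (p - 1)^-1 by rewrite addr_ge0// invr_ge0; lra.
  by rewrite /M !mulr_ge0 ?powR_ge0.
exists (M * (3 * C)); first by rewrite mulr_ge0// mulr_ge0.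
move=> n L x A sigma ks y n2 /andP[A0 Ac] uks yE.
have [K nK Kmin] : exists2 K, `|n| <= scale_time delta c K &
    forall j, (j < K)%N -> scale_time delta c j <= `|n|.
  have ex := scale_time_unbounded c01 delta_gt0 delta_le1 delta_half `|n|.
  case: (ex_minnP ex) => K nK Kmin; exists K => // j jK.
  by rewrite leNgt; apply/negP => /ltW/Kmin; rewrite leqNgt jK.
have := CP _ _ n2 Kmin; set S := \sum_(j < K) _; set Th := Theta _ _ _ `^ p => SC.
have S0 : 0 <= S.
  by rewrite sumr_ge0// => j _; rewrite mulr_ge0 ?exprn_ge0 ?powR_ge0.
(* Truncated subtraction: if [K <= L], then [I = 0] and only generation 0 is used. In all cases
   [L + I >= K], and [N / 2 ^ I * delta (L + I)] is at most [|n| / scale_time (L + I)]. *)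
pose I := (K - L)%N.
have NI : `|n| * A / 2 ^+ I * delta (L + I)%N <= 1.
  have KI : (K <= L + I)%N by rewrite /I -leq_subLR.
  have := le_trans nK (scale_time_le c01 delta_gt0 delta_half KI).
  have cd : 0 < c * delta (L + I)%N by rewrite mulr_gt0.
  have pLI : 0 < 2 ^+ L * 2 ^+ I :> R by rewrite mulr_gt0 ?exprn_gt0.
  rewrite /scale_time ler_pdivlMr// exprD => H.
  apply: (@le_trans _ _ (`|n| * (c * delta (L + I)%N) / (2 ^+ L * 2 ^+ I))).
    have -> : `|n| * (c * delta (L + I)%N) / (2 ^+ L * 2 ^+ I) =
       `|n| * (c / 2 ^+ L) / 2 ^+ I * delta (L + I)%N.
      by field; rewrite !gt_eqF ?exprn_gt0.
    rewrite ler_wpM2r ?(ltW (delta_gt0 _))// ler_wpM2r ?invr_ge0 ?exprn_ge0//.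
    by rewrite ler_wpM2l.
  by rewrite ler_pdivrMr// mul1r.
have := block_sum_powR delta_gt0 delta_half delta_le1 A0 uks yE p1 NI.
move/le_trans; apply; rewrite -/M.
rewrite (_ : M * (3 * C) * _ * Th = M * (3 * (C * ((2 `^ (- (p - 1))) ^+ L * Th))));
  last ring.
rewrite ler_wpM2l//.
have gE k : (2 `^ (- (p - 1))) ^+ k = (2 ^- k) `^ (p - 1) :> R.
  by rewrite -powR_mulrn ?powR_ge0// -powRrM mulNr powRN mulrC powRrM powR_mulrn// -powRN;
     rewrite -powR_inv1 ?powR_ge0// -!powRrM mulN1r.
have dL2 : delta L `^ (p - 1) <= (2 ^- L) `^ (p - 1).
  rewrite ge0_ler_powR ?nnegrE ?subr_ge0 ?(ltW p1) ?(ltW (delta_gt0 _)) ?invr_ge0 ?exprn_ge0//.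
  exact: delta_le_half.
have L2 : 2 ^- L <= (2 ^- L) `^ (p - 1) :> R.
  have q0 : 0 < 2 ^- L :> R by rewrite invr_gt0 exprn_gt0.
  rewrite ger1_powR//; last lra.
  by rewrite q0/= invf_le1 ?exprn_gt0// exprn_ege1// ler1n.
rewrite big_ord_recl /= expr0 mul1r addn0 gE; set G := (2 ^- L) `^ (p - 1) in dL2 L2 *.
have G0 : 0 <= G by exact: powR_ge0.
have tail : \sum_(i < I) 2 ^+ i.+1 * delta (L + i)%N `^ (p - 1) <= 2 * G * S.
  have q0 : 0 < 2 ^+ L :> R by rewrite exprn_gt0.
  apply: (@le_trans _ _ (2 * 2 ^- L * S)); last by rewrite ler_wpM2r// ler_wpM2l.
  rewrite /S mulr_sumr /I; case: (leqP K L) => KL.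
    rewrite (eqP KL) big_ord0 sumr_ge0// => j _.
    by rewrite !mulr_ge0 ?powR_ge0 ?invr_ge0 ?exprn_ge0.
  pose F k := 2 / 2 ^+ L * (2 ^+ k * delta k `^ (p - 1)).
  have F0 k : 0 <= F k.
    by rewrite mulr_ge0 ?divr_ge0 ?exprn_ge0// mulr_ge0 ?powR_ge0 ?exprn_ge0.
  rewrite -[leRHS](big_mkord xpredT F) (@big_cat_nat _ _ _ L)//=; last exact: ltnW.
  rewrite -[X in \sum_(X <= _ < K) _]add0n big_addn !big_mkord.
  rewrite ler_wpDl ?sumr_ge0// ler_sum// => i _; rewrite /F [(i + L)%N]addnC exprD exprS.
  by rewrite (_ : 2 / 2 ^+ L * _ = 2 * 2 ^+ i * delta (L + i)%N `^ (p - 1))//;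
     field; rewrite gt_eqF.
apply: (@le_trans _ _ (G + 2 * G * S)).
  apply: lerD => //; apply: le_trans tail; rewrite ler_sum.
have -> : 3 * (C * (G * Th)) = G * (3 * (C * Th)) by ring.
rewrite (_ : G + 2 * G * S = G * (1 + 2 * S)); last ring.
by rewrite ler_wpM2l//; lra.
Qed.

(* [cA L] makes the block negligible for those [n] for which the scale given by
   [Theta1_scale] is coarser than [delta L]. *)
Lemma block_sum_Theta_1 : exists C Y (cA : nat -> R),
  [/\ 0 <= C, 2 <= Y, (forall L, 0 < cA L) &
  forall n L x A sigma ks y, Y <= `|n| -> 0 <= A <= cA L -> uniq ks ->
  (forall k, block_term delta L x n A (k%:~R - sigma) (y k)) ->
  \sum_(k <- ks) `|y k| <= C * (Num.sqrt 2)^-1 ^+ L * Theta w 1 `|n|].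
Proof.
have scale := Theta1_scale w_cont w_ndecr w_double c01 delta_gt0 delta_le1
  delta_half w_delta.
have /choice[Ym YP] : forall m, exists Y, 2 <= Y /\ forall y, Y <= y ->
    exists j, [/\ (m <= j)%N, 2 ^+ j * ln y <= 2 * Theta w 1 y &
    y * 2 ^+ j * delta j <= (2 ^+ j * ln y) ^+ 2 / c].
  by move=> m; have [Y Y2 H] := scale m; exists Y.
pose Y0 := Ym 0%N; have [Y02 Y0P] := YP 0%N.
pose cA L : R := 2 ^- L / (Ym L) ^+ 2.
have p0 L : 0 < 2 ^+ L :> R by rewrite exprn_gt0.
have Ym0 L : 0 < Ym L by have [? _] := YP L; lra.
have cA0 L : 0 < cA L by rewrite divr_gt0 ?invr_gt0 ?exprn_gt0.
have l2 : 0 < ln 2 :> R by rewrite ln_gt0// ltr1n.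
(* The three summands serve the resonant range for large [n], the tail, and the trivial bound for
   small [n]; [2 / ln 2] appears because [1 <= 2 / ln 2 * Theta]. *)
pose D := 4 * (34 * (3 + 2 / ln 2) + 36 / Num.sqrt c) * 2 + 64 * 2 / ln 2
  + 192 * 2 / ln 2.
have sc0 : 0 < Num.sqrt c by rewrite sqrtr_gt0.
have il2 : 0 <= (ln 2)^-1 :> R by rewrite invr_ge0 ltW.
have isc : 0 <= (Num.sqrt c)^-1 by rewrite invr_ge0 ltW.
have D0 : 0 <= D by rewrite /D; lra.
exists D, Y0, cA; split=> //.
move=> n L x A sigma ks y nY /andP[A0 Ac] uks yE.
set N := `|n| in nY *; have N2 : 2 <= N := le_trans Y02 nY.
pose T := 2 * N; have T1 : 1 <= T by rewrite /T; lra.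
have A2 : A <= 2 ^- L.
  apply: (le_trans Ac); rewrite /cA ler_piMr ?invr_ge0 ?(ltW (p0 L))//.
  rewrite invf_le1 ?exprn_gt0// exprn_ege1//.
  by have [? _] := YP L; lra.
have A1 : A <= 1.
  rewrite (le_trans A2)// invf_le1 ?exprn_gt0// exprn_ege1//.
  by rewrite ler1n.
have TN : 2 * (N * A) <= T by rewrite /T ler_wpM2l// ler_piMr; lra.
(* The rate is only [2 ^ (- L / 2)]: the gain [2 ^- L] of the amplitude and generation enters one
   term under a square root. *)
pose s := (Num.sqrt 2)^-1 ^+ L : R.
have s2 : 0 < Num.sqrt 2 :> R by rewrite sqrtr_gt0.
have s0 : 0 < s by rewrite exprn_gt0// invr_gt0.
have ss : s ^+ 2 = 2 ^- L.
  by rewrite /s -exprM mulnC exprM exprVn sqr_sqrtr// exprVn.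
have s1 : s <= 1.
  rewrite exprn_ile1 ?invr_ge0 ?(ltW s2)// invf_le1//.
  by rewrite -[leLHS]sqrtr1 ler_sqrt//; lra.
have sL : 2 ^- L <= s by rewrite -ss expr2 ler_piMr// ltW.
set Th := Theta w 1 N.
have ThL : ln 2 <= 2 * Th.
  have [j [_ H _]] := Y0P _ nY; apply: le_trans H.
  have j1 : 1 <= 2 ^+ j :> R by rewrite exprn_ege1// ler1n.
  have lN : ln 2 <= ln N by rewrite ler_ln ?posrE//; lra.
  by rewrite (le_trans lN)// ler_peMl//; lra.
have Th1 : 1 <= 2 / ln 2 * Th by rewrite mulrAC ler_pdivlMr// mul1r.
have Th0 : 0 <= Th by lra.
rewrite (bigID (fun k => T < `|k%:~R - sigma|))/=.
have -> : \sum_(i <- ks | ~~ (T < `|i%:~R - sigma|)) `|y i| =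
    \sum_(i <- ks | `|i%:~R - sigma| <= T) `|y i|.
  by apply: eq_bigl => i; rewrite leNgt.
have tail : \sum_(k <- ks | T < `|k%:~R - sigma|) `|y k| <= 64 * 2 / ln 2 * s * Th.
  apply: (le_trans (block_sum_tail delta_gt0 delta_half A0 uks yE T1 TN)).
  have -> : 128 * (N * A) / T = 64 * A by rewrite /T; field; rewrite gt_eqF; lra.
  rewrite (_ : 64 * 2 / ln 2 * s * Th = 64 * (s * (2 / ln 2 * Th))); last ring.
  rewrite ler_wpM2l// (le_trans A2)// (le_trans sL)// ler_peMr//.
  exact: ltW.
have X0 : 0 <= 4 * (34 * (3 + 2 / ln 2) + 36 / Num.sqrt c) * 2 * s * Th.
  by apply: mulr_ge0 => //; apply: mulr_ge0; [lra|exact: ltW].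
have X1 : 0 <= 192 * 2 / ln 2 * s * Th.
  by apply: mulr_ge0 => //; apply: mulr_ge0; [lra|exact: ltW].
suff main : \sum_(i <- ks | `|i%:~R - sigma| <= T) `|y i| <=
    4 * (34 * (3 + 2 / ln 2) + 36 / Num.sqrt c) * 2 * s * Th
    + 192 * 2 / ln 2 * s * Th.
  rewrite -/s -/Th /D; move: tail main X0 X1.
  by rewrite !(mulrDl _ _ s) !(mulrDl _ _ Th); lra.
have [NL|NL] := ltrP N (Ym L).
  apply: (@le_trans _ _ (192 * 2 / ln 2 * s * Th)); last by rewrite lerDr.
  apply: (le_trans (block_sum_trivial delta_gt0 delta_half delta_le1 A0 uks yE T1)).
  have -> : 192 * 2 / ln 2 * s * Th = 192 * (s * (2 / ln 2 * Th)) by ring.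
  have -> : 64 * T * (N * A) = 128 * (N ^+ 2 * A) by rewrite /T; ring.
  apply: ler_pM => //; first by rewrite mulr_ge0// exprn_ge0//; lra.
    by rewrite ler_nat.
  apply: (@le_trans _ _ (2 ^- L)); last by rewrite (le_trans sL)// ler_peMr// ltW.
  apply: (@le_trans _ _ (Ym L ^+ 2 * cA L)).
    rewrite ler_pM// ?exprn_ge0//; first lra.
    by rewrite lerXn2r ?nnegrE//; lra.
  by rewrite /cA mulrC divfK// gt_eqF// exprn_gt0.
apply: (@le_trans _ _ (4 * (34 * (3 + 2 / ln 2) + 36 / Num.sqrt c) * 2 * s * Th)); last first.
  by rewrite lerDl.
have [j [Lj jTh jd]] := (YP L).2 _ NL.
pose i := (j - L)%N; have ji : j = (L + i)%N by rewrite subnKC.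
pose u := 2 ^+ i * delta j; have u0 : 0 < u by rewrite mulr_gt0.
have u1 : u <= 1.
  rewrite /u ji; apply: le_trans (delta_le1 L).
  by rewrite mulrC -ler_pdivlMr// delta_le_expn.
(* This balances [N / rho] against [rho * u], where [u] is the total length of the intervals of
   generation [i]; both become [v = sqrt (N * u)], whose square is controlled by the second bound of
   the scale lemma. *)
pose rho := Num.sqrt (N / u).
have N0 : 0 < N by lra.
have Nu0 : 0 < N / u by rewrite divr_gt0.
have rho1 : 1 <= rho.
  rewrite -[leLHS]sqrtr1 ler_sqrt ?(ltW Nu0)//.
  by rewrite ler_pdivlMr// mul1r; lra.
have rho0 : 0 < rho by lra.
have rho2 : rho ^+ 2 = N / u by rewrite sqr_sqrtr// ltW.
apply: (le_trans (block_sum_single_scale delta_gt0 delta_half delta_le1 A0 uks yE T1 TN i rho1)).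
rewrite -ji; pose v := rho * u.
have vE : N / rho = v.
  rewrite /v; have -> : N = rho ^+ 2 * u by rewrite rho2 divfK// gt_eqF.
  by field; rewrite gt_eqF.
have v0 : 0 < v by rewrite mulr_gt0.
pose Q := 2 ^+ j * ln N.
have lN : ln 2 <= ln N by rewrite ler_ln ?posrE//; lra.
have Q0 : 0 < Q by rewrite mulr_gt0//; lra.
have i2 : 2 ^+ i = 2 ^- L * 2 ^+ j :> R.
  by rewrite ji exprD mulKf// gt_eqF.
have v2 : v ^+ 2 <= (s * Q / Num.sqrt c) ^+ 2.
  have -> : v ^+ 2 = N * u by rewrite /v exprMn rho2 expr2; field; rewrite gt_eqF.
  rewrite /u i2.
  have -> : (s * Q / Num.sqrt c) ^+ 2 = s ^+ 2 * (Q ^+ 2 / Num.sqrt c ^+ 2).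
    by field; rewrite gt_eqF.
  rewrite ss sqr_sqrtr ?(ltW c0)//.
  rewrite (_ : N * _ = 2 ^- L * (N * 2 ^+ j * delta j)); last ring.
  by rewrite ler_wpM2l ?invr_ge0 ?(ltW (p0 L)).
have vs : v <= s * Q / Num.sqrt c.
  have hb : 0 <= s * Q / Num.sqrt c.
    by apply: mulr_ge0 => //; apply: mulr_ge0; exact: ltW.
  by rewrite -(@ler_pXn2r _ 2) ?nnegrE ?(ltW v0).
have lnT : 2 + ln (2 * T) <= (3 + 2 / ln 2) * ln N.
  have -> : 2 * T = 2 * 2 * N by rewrite /T; ring.
  rewrite lnM ?posrE ?mulr_gt0// lnM ?posrE//.
  have h : 2 <= 2 / ln 2 * ln N by rewrite mulrAC ler_pdivlMr// ler_wpM2l.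
  by lra.
have K0 : 0 <= 3 + 2 / ln 2 :> R by rewrite addr_ge0// divr_ge0// ltW.
have h1 : 2 ^+ i * (2 + ln (2 * T)) <= s * ((3 + 2 / ln 2) * Q).
  apply: (@le_trans _ _ (2 ^+ i * ((3 + 2 / ln 2) * ln N))).
    by rewrite ler_wpM2l// ltW.
  rewrite i2 (_ : _ * _ = 2 ^- L * ((3 + 2 / ln 2) * Q)); last by rewrite /Q; ring.
  by rewrite ler_wpM2r// mulr_ge0// ltW.
have h2 : 16 * T / rho = 32 * v by rewrite -vE /T; ring.
have h3 : 4 * rho * 2 ^+ i * delta j = 4 * v by rewrite /v /u; ring.
rewrite h2 h3 -[34 * _ * _]mulrA.
apply: (@le_trans _ _ (4 * (34 * (s * ((3 + 2 / ln 2) * Q)) + 36 * (s * Q / Num.sqrt c)))).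
  by rewrite ler_wpM2l//; lra.
pose K := 4 * (34 * (3 + 2 / ln 2) + 36 / Num.sqrt c) * s.
have -> : 4 * (34 * (s * ((3 + 2 / ln 2) * Q)) + 36 * (s * Q / Num.sqrt c)) = K * Q.
  by rewrite /K; ring.
have -> : 4 * (34 * (3 + 2 / ln 2) + 36 / Num.sqrt c) * 2 * s * Th = K * (2 * Th).
  by rewrite /K; ring.
rewrite ler_wpM2l//.
by apply: mulr_ge0; [lra|exact: ltW].
Qed.

End block_theta.

(** * Combination of geometrically decaying families *)

Section combination.
Variable R : realType.
Implicit Types (p r x y U gam : R).

(** Jensen's inequality for the points [x / (1 - r)] and [y / r] with weights [1 - r] and [r]. *)
Lemma powR_add_weighted p r x y : 1 <= p -> 0 < r < 1 -> 0 <= x -> 0 <= y ->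
  (x + y) `^ p <= (1 - r) `^ (1 - p) * x `^ p + r `^ (1 - p) * y `^ p.
Proof.
move=> p1 /andP[r0 r1] x0 y0.
have s0 : 0 < 1 - r by lra.
have E z t : 0 < t -> 0 <= z -> t * (z / t) `^ p = t `^ (1 - p) * z `^ p.
  move=> t0 z0; rewrite powRM ?invr_ge0 ?(ltW t0)//.
  rewrite -powR_inv1 ?(ltW t0)// -powRrM mulN1r mulrCA mulrC; congr (_ * _).
  by rewrite -[X in X * _]powRr1 ?(ltW t0)// -powRD// (gt_eqF t0) implybT.
rewrite -!E//.
have x0' : 0 <= x / (1 - r) by rewrite divr_ge0// ltW.
have y0' : 0 <= y / r by rewrite divr_ge0// ltW.
have r01 : 0 <= r <= 1 by lra.
have xI : x / (1 - r) \in (`[0, +oo[%classic : set R) by rewrite inE/= in_itv/= andbT.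
have yI : y / r \in (`[0, +oo[%classic : set R) by rewrite inE/= in_itv/= andbT.
have H := @convex_powR R p p1 (Itv01 (andP r01).1 (andP r01).2) _ _ yI xI.
rewrite convRE [X in X `^ _ <= _]convRE /= /unstable.onem in H.
move: H; have -> : r * (y / r) + (1 - r) * (x / (1 - r)) = x + y.
  by field; rewrite !gt_eqF.
by move=> h; rewrite (le_trans h)// [leLHS]addrC.
Qed.

Lemma powR_sum_weighted p r M (f : nat -> R) : 1 <= p -> 0 < r < 1 ->
  (forall m, 0 <= f m) ->
  (\sum_(m < M) f m) `^ p <=
  \sum_(m < M) (1 - r) `^ (1 - p) * (r `^ (1 - p)) ^+ m * f m `^ p.
Proof.
move=> p1 r01; elim: M f => [|M IHM] f f0.
  by rewrite !big_ord0 powR0// gt_eqF//; lra.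
rewrite !big_ord_recl expr0 mulr1.
have S0 : 0 <= \sum_(i < M) f (lift ord0 i) by rewrite sumr_ge0.
apply: (le_trans (powR_add_weighted p1 r01 (f0 _) S0)); rewrite lerD2l.
apply: (le_trans (ler_wpM2l (powR_ge0 _ _) (IHM (fun m => f m.+1) (fun m => f0 m.+1)))).
rewrite mulr_sumr ler_sum// => i _; rewrite lift0 exprS.
by rewrite le_eqVlt; apply/orP; left; apply/eqP; ring.
Qed.

Lemma geometric_sum_le r M : 0 < r < 1 -> \sum_(m < M) r ^+ m <= (1 - r)^-1.
Proof.
move=> /andP[r0 r1]; have s0 : 0 < 1 - r by lra.
rewrite -[leRHS]mul1r ler_pdivlMr//.
have -> S : S * (1 - r) = - ((r - 1) * S) by ring.
by rewrite -subrX1 opprB gerBl exprn_ge0// ltW.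
Qed.

(* Minkowski's inequality would do as well; the weights [sqrt gam ^ m] reduce
   it to Jensen's inequality for two terms. *)
Lemma geometric_minkowski p gam : 1 <= p <= 2 -> 0 < gam < 1 ->
  exists2 C, 0 <= C & forall (K : Type) (ks : seq K) M (f : nat -> K -> R) U,
    0 <= U -> (forall m k, 0 <= f m k) ->
    (forall m, (m < M)%N -> \sum_(k <- ks) f m k `^ p <= U * gam ^+ m) ->
    \sum_(k <- ks) (\sum_(m < M) f m k) `^ p <= C * U.
Proof.
move=> /andP[p1 p2] /andP[g0 g1]; pose r := Num.sqrt gam.
have r0 : 0 < r by rewrite sqrtr_gt0.
have rr : r ^+ 2 = gam by rewrite sqr_sqrtr// ltW.
have r1 : r < 1 by rewrite -sqrtr1 ltr_sqrt.
have r01 : 0 < r < 1 by rewrite r0.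
have s0 : 0 < 1 - r by lra.
exists ((1 - r) `^ (1 - p) * (1 - r)^-1).
  by rewrite mulr_ge0 ?powR_ge0// invr_ge0 ltW.
move=> K ks M f U U0 f0 fU.
apply: (@le_trans _ _ (\sum_(k <- ks) \sum_(m < M)
    (1 - r) `^ (1 - p) * (r `^ (1 - p)) ^+ m * f m k `^ p)).
  by rewrite ler_sum// => k _; exact: (@powR_sum_weighted p r M (f ^~ k)).
rewrite exchange_big/= -!mulrA.
apply: (@le_trans _ _ (\sum_(m < M) (1 - r) `^ (1 - p) * (r ^+ m * U))).
  rewrite ler_sum// => m _; rewrite -mulr_sumr -mulrA ler_wpM2l ?powR_ge0//.
  (* Since [p <= 2], the weights lose at most [r ^- m], while [gam ^ m = r ^ (2 * m)]; a factor
     [r ^ m] is left for summation. *)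
  have rp : r `^ (1 - p) <= r^-1.
    have r01' : 0 < r <= 1 by rewrite r0 ltW.
    have p1' : -1 <= 1 - p by lra.
    by rewrite -powR_inv1 ?(ltW r0)// (ger_powR r01' p1').
  apply: (@le_trans _ _ ((r `^ (1 - p)) ^+ m * (U * gam ^+ m))).
    by rewrite ler_wpM2l ?exprn_ge0 ?powR_ge0// fU.
  have -> : r ^+ m * U = (r^-1) ^+ m * (U * gam ^+ m).
    have E : r^-1 ^+ m * gam ^+ m = r ^+ m.
      by rewrite -exprMn -rr expr2 mulKf// gt_eqF.
    by rewrite mulrCA E mulrC.
  rewrite ler_wpM2r ?mulr_ge0 ?exprn_ge0 ?(ltW g0)//.
  by rewrite lerXn2r ?nnegrE ?powR_ge0 ?invr_ge0 ?(ltW r0).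
rewrite -mulr_sumr -mulr_suml ler_wpM2l ?powR_ge0// ler_wpM2r//.
exact: geometric_sum_le.
Qed.

End combination.

(** * Construction of the diffeomorphism *)

Section primitives.
Variable R : realType.
Local Notation mu := (@lebesgue_measure R).
Implicit Types (f F : R -> R) (a b t : R).

Lemma continuous_itv_integrable f a b : continuous f ->
  mu.-integrable `[a, b] (EFin \o f).
Proof.
move=> cf; apply: continuous_compact_integrable; first exact: segment_compact.
exact: continuous_subspaceT.
Qed.

Lemma exists_primitive f : continuous f ->
  exists F, (forall t, is_derive t 1 F (f t)) /\ F 0 = 0.
Proof.
move=> cf.
pose H a t := \int[mu]_(s in `[a, t]) f s.
(* The base point must lie to the left of both [t] and 0, so it moves with [t]; the difference of
   the two integrals does not depend on it, and near [t0] the fixed base point [b] gives the same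
   function. *)
pose F t := H (- (`|t| + 1)) t - H (- (`|t| + 1)) 0.
have HB b a t : b <= a -> a <= t -> H b t - H b a = H a t.
  move=> ba at_; rewrite /H.
  have -> : \int[mu]_(s in `[a, t]) f s = \int[mu]_(s in `]a, t]) f s.
    rewrite Rintegral_itv_obnd_cbnd//.
    apply: integrableS (continuous_itv_integrable a t cf) => //.
    by move=> s /=; rewrite !in_itv/= => /andP[/ltW -> ->].
  rewrite -(Rintegral_itvB (continuous_itv_integrable b t cf)) ?bnd_simp//.
exists F; split; last by rewrite /F subrr.
move=> t0; pose b := - (`|t0| + 2).
have n0 := normr_ge0 t0.
have bt0 : b < t0 by have := ler_norm (- t0); rewrite normrN /b; lra.
have t01 : t0 < t0 + 1 by lra.
have [dH H'] := continuous_FTC1_closed t01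
  (continuous_itv_integrable b (t0 + 1) cf) bt0 (cf t0).
have dG : is_derive t0 1 (fun t => H b t - H b 0) (f t0).
  have dHt : is_derive t0 1 (H b) (f t0).
    by split; [exact: dH | rewrite -derive1E; exact: H'].
  by apply: is_derive_eq; rewrite subr0.
apply: near_eq_is_derive dG.
near=> t.
have tt0 : `|t| < `|t0| + 1.
  have d1 : `|t - t0| < 1.
    by rewrite distrC; near: t; exact: nbhsx_ballx.
  have := ler_normD (t - t0) t0; rewrite subrK; lra.
rewrite /F; set a := - (`|t| + 1).
have ba : b <= a by rewrite /b /a; lra.
have at_ : a <= t by have := ler_norm (- t); rewrite normrN /a; lra.
have a0 : a <= 0 by have := normr_ge0 t; rewrite /a; lra.
by rewrite -(HB b a t)// -(HB b a 0)//; ring.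
Unshelve. all: by end_near. Qed.

Lemma Rintegral_primitive f F a b : a < b -> continuous f ->
  (forall t, is_derive t 1 F (f t)) -> \int[mu]_(t in `[a, b]) f t = F b - F a.
Proof.
move=> ab cf dF; have cF t : {for t, continuous F}.
  exact: is_derive_continuous (dF t).
rewrite /Rintegral (continuous_FTC2 (F := F))//.
- exact: continuous_subspaceT.
- split; first by move=> t _; case: (dF t).
  + by apply: cvg_at_right_filter; exact: cF.
  + by apply: cvg_at_left_filter; exact: cF.
- by move=> t _; rewrite derive1E; case: (dF t).
Qed.

Lemma primitive_diff f1 f2 F1 F2 a b : a <= b ->
  (forall t, is_derive t 1 F1 (f1 t)) -> (forall t, is_derive t 1 F2 (f2 t)) ->
  (forall t, a <= t <= b -> f1 t = f2 t) -> F1 b - F1 a = F2 b - F2 a.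
Proof.
move=> ab d1 d2 f12; have E : F1 a - F2 a = F1 b - F2 b.
  apply: (@mvt_cst R (fun t => F1 t - F2 t)) => // t tab.
  have h1 := d1 t; have h2 := d2 t.
  by apply: is_derive_eq; rewrite f12// subrr.
lra.
Qed.

End primitives.

(** * Periodic extension *)

Section periodize.
Variables (R : realType) (T : R).
Hypothesis T0 : 0 < T.

Definition periodize (f : R -> R) (t : R) : R :=
  f (t - T * (Num.floor (t / T))%:~R).

Lemma floor_mul_itv t :
  T * (Num.floor (t / T))%:~R <= t < T * (Num.floor (t / T))%:~R + T.
Proof.
have /andP[h1 h2] := floor_itv (t / T).
rewrite mulrC -ler_pdivlMr// h1/= -ltrBlDr.
rewrite ler_pdivlMr// in h1; rewrite ltr_pdivrMr// intrD mulrDl mul1r in h2.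
by lra.
Qed.

Lemma floor_mul_uniq (z : int) t :
  T * z%:~R <= t < T * z%:~R + T -> Num.floor (t / T) = z.
Proof.
move=> /andP[h1 h2]; apply: floor_def.
rewrite ler_pdivlMr// ltr_pdivrMr// intrD mulrDl mul1r; lra.
Qed.

Lemma periodize_id f t : 0 <= t < T -> periodize f t = f t.
Proof.
move=> tT; rewrite /periodize (@floor_mul_uniq 0) ?mulr0 ?subr0//.
by rewrite add0r.
Qed.

Lemma periodize_shift f t (z : int) : periodize f (t + T * z%:~R) = periodize f t.
Proof.
rewrite /periodize (@floor_mul_uniq (Num.floor (t / T) + z)); last first.
  by have := floor_mul_itv t; rewrite intrD; lra.
by rewrite intrD; congr f; ring.
Qed.

(** The floor jumps at multiples of [T]. Near any point the extension is nevertheless a sum of two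
    translates of [G], at most one of which is nonzero at each point, and this sum is
    differentiable. *)
Lemma periodize_derive (G g : R -> R) (t : R) :
  (forall t : R, is_derive t (1 : R) G (g t)) ->
  (forall t, t <= 0 -> G t = 0) -> (forall t, T <= t -> G t = 0) ->
  (forall t, T <= t -> g t = 0) ->
  is_derive t 1 (periodize G) (periodize g t).
Proof.
move=> dG Gl Gr gr; set z := Num.floor (t / T).
have /andP[zt tz] := floor_mul_itv t; rewrite -/z in zt tz.
have dS c : is_derive t (1 : R) (fun u : R => G (u - c)) (g (t - c)).
  have dl : is_derive t (1 : R) (fun u : R => u - c) 1.
    by apply: is_derive_eq; rewrite subr0.
  have := @is_derive1_comp R G (fun u => u - c) t _ _ (dG (t - c)) dl.
  by rewrite mulr1.
have d1 := dS (T * z%:~R); have d2 := dS (T * z%:~R - T).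
have dP : is_derive t (1 : R)
    (fun u : R => G (u - T * z%:~R) + G (u - (T * z%:~R - T))) (periodize g t).
  apply: is_derive_eq; rewrite /periodize -/z [X in _ + X]gr ?addr0//; lra.
apply: near_eq_is_derive dP.
near=> u.
have uz1 : u < T * z%:~R + T by near: u; exact: lt_nbhsl.
have uz2 : T * z%:~R - T < u by near: u; apply: lt_nbhsr; lra.
rewrite /periodize; have [uz|uz] := lerP (T * z%:~R) u.
  rewrite (@floor_mul_uniq z) ?uz// [X in _ + X]Gr ?addr0//; lra.
rewrite (@floor_mul_uniq (z - 1)); last by rewrite intrB; lra.
by rewrite [X in X + _]Gl ?add0r; [rewrite intrB mulrBr mulr1|lra].
Unshelve. all: by end_near. Qed.

(** As [d < T], at most one period boundary separates the two points; [g] vanishes there, so passing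
    through it costs [M] on each side. *)
Lemma periodize_modulus (g : R -> R) d M s t :
  (forall t, t <= 0 -> g t = 0) -> (forall t, T <= t -> g t = 0) ->
  d < T -> (forall s t, `|s - t| <= d -> `|g s - g t| <= M) ->
  `|s - t| <= d -> `|periodize g s - periodize g t| <= 2 * M.
Proof.
move=> gl gr dT gM.
wlog st : s t / s <= t.
  move=> H sd; have [st|ts] := leP s t; first exact: H.
  by rewrite distrC; apply: H; [exact: ltW|rewrite distrC].
rewrite distrC ger0_norm ?subr_ge0// => std.
have d0 : 0 <= d by lra.
have M0 : 0 <= M.
  by have := gM 0 0; rewrite !subrr normr0; apply.
have /andP[s1 s2] := floor_mul_itv s; have /andP[t1 t2] := floor_mul_itv t.
rewrite /periodize; set a := Num.floor (s / T) in s1 s2 *.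
set b := Num.floor (t / T) in t1 t2 *.
have [ab|ab] : b = a \/ b = a + 1.
  have ab1 : a <= b.
    by apply: le_floor; rewrite ler_pM2r// invr_gt0.
  have ab2 : b < a + 2.
    rewrite /b floor_lt_int ltr_pdivrMr// intrD mulrDl; lra.
  by move: a b ab1 ab2 {s1 s2 t1 t2} => a b; clear; lia.
- rewrite ab; apply: (@le_trans _ _ M); last by lra.
  by apply: gM; rewrite distrC ger0_norm; lra.
rewrite ab intrD mulrDr mulr1 in t1 t2 *.
have h1 : `|g (s - T * a%:~R) - g T| <= M.
  by apply: gM; rewrite distrC ger0_norm; lra.
have h2 : `|g 0 - g (t - (T * a%:~R + T))| <= M.
  by apply: gM; rewrite distrC ger0_norm; lra.
rewrite [g T]gr// subr0 in h1; rewrite [g 0]gl// sub0r normrN in h2.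
by rewrite (le_trans (ler_normB _ _))//; lra.
Qed.

End periodize.

(** * Functions constant on a dense family of intervals *)

Section densely_locally_constant.
Variable R : realType.
Implicit Types (f g : R -> R) (a b c : R).

Definition cst_on f a b := forall s t, a < s < b -> a < t < b -> f s = f t.

(** Stated by shrinking intervals: closure under linear combinations then amounts to shrinking
    twice, with no dense open set to intersect. *)
Definition densely_cst f := forall a b, a < b ->
  exists a' b', [/\ a <= a', a' < b', b' <= b & cst_on f a' b'].

Lemma cst_onS f a b a' b' : a <= a' -> b' <= b -> cst_on f a b -> cst_on f a' b'.
Proof.
by move=> aa bb H s t /andP[? ?] /andP[? ?]; apply: H; apply/andP; split; lra.
Qed.

Lemma densely_cst_comb f g (u v : R) : densely_cst f -> densely_cst g ->
  densely_cst (fun t => u * f t + v * g t).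
Proof.
move=> df dg a b ab; have [a1 [b1 [aa1 ab1 bb1 cf]]] := df _ _ ab.
have [a2 [b2 [aa2 ab2 bb2 cg]]] := dg _ _ ab1.
exists a2, b2; split; [lra|by []|lra|] => s t sab tab.
by rewrite (cg s t)// (cst_onS aa2 bb2 cf sab tab).
Qed.

Lemma densely_cst_shift f c : densely_cst f -> densely_cst (fun t => f (t + c)).
Proof.
move=> df a b ab; have abc : a + c < b + c by lra.
have [a1 [b1 [aa1 ab1 bb1 cf]]] := df _ _ abc.
exists (a1 - c), (b1 - c); split; [lra|lra|lra|] => s t sab tab.
by apply: cf; lra.
Qed.

Lemma densely_cst_opp f : densely_cst f -> densely_cst (fun t => f (- t)).
Proof.
move=> df a b ab; have abc : - b < - a by lra.
have [a1 [b1 [aa1 ab1 bb1 cf]]] := df _ _ abc.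
exists (- b1), (- a1); split; [lra|lra|lra|] => s t sab tab.
by apply: cf; lra.
Qed.

Lemma densely_cst_norm f : densely_cst f -> densely_cst (fun t => f `|t|).
Proof.
move=> df a b ab; have [b0|b0] := ltrP 0 b.
  have ab' : Num.max a 0 < b by rewrite gt_max ab.
  have [a1 [b1 [aa1 ab1 bb1 cf]]] := df _ _ ab'.
  move: aa1; rewrite ge_max => /andP[aa1 a10].
  exists a1, b1; split=> // s t /andP[s1 s2] /andP[t1 t2].
  by rewrite !ger0_norm; [apply: cf; lra|lra|lra].
have [a1 [b1 [aa1 ab1 bb1 cf]]] := densely_cst_opp df ab.
exists a1, b1; split=> // s t /andP[s1 s2] /andP[t1 t2].
by rewrite !ler0_norm; [apply: cf; lra|lra|lra].
Qed.

Lemma densely_cst_cst c : densely_cst (fun=> c).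
Proof. by move=> a b ab; exists a, b; split. Qed.

End densely_locally_constant.

Section bump.
Variables (R : realType) (delta : nat -> R).
Hypothesis delta_gt0 : forall k, 0 < delta k.
Hypothesis delta_half : forall k, 2 * delta k.+1 < delta k.

Lemma delta_small k e : 0 < e -> exists i, delta (k + i)%N < e.
Proof.
move=> e0; have H : delta k * 2 ^- i @[i --> \oo] --> delta k * 0.
  apply: cvgMl_tmp; under eq_fun do rewrite -exprVn.
  by apply: cvg_expr; rewrite ger0_norm; lra.
rewrite mulr0 in H; have /cvgrPdist_lt /(_ e e0) [i _ /(_ i (leqnn i))] := H.
rewrite /= sub0r normrN ger0_norm => [ie|]; last first.
  by rewrite mulr_ge0 ?invr_ge0 ?exprn_ge0// ltW.
by exists i; exact: le_lt_trans (delta_le_expn delta_half k i) ie.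
Qed.

Lemma densely_cst_cantor k : densely_cst (cantor delta k).
Proof.
move=> a b ab; have [i di] : exists i, delta (k + i)%N < b - a.
  by apply: delta_small; lra.
exact: cantor_locally_cst di.
Qed.

Lemma densely_cst_bump L : densely_cst (cantor_bump delta L).
Proof.
have dt : densely_cst (cantor_tent delta L).
  apply: (@densely_cst_norm R (fun y => cantor delta L (delta L - y))).
  have := densely_cst_opp (densely_cst_shift (delta L) (densely_cst_cantor L)).
  move=> H a b ab; have [a' [b' [? ? ? cf]]] := H _ _ ab.
  exists a', b'; split=> // s t sab tab; have := cf s t sab tab.
  by rewrite ![- _ + _]addrC.
have d1 := densely_cst_shift (delta L) dt.
have d2 := densely_cst_shift (- delta L) dt.
have := densely_cst_comb 1 (-1) d1 d2.
move=> H a b ab; have [a' [b' [? ? ? cf]]] := H _ _ ab.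
exists a', b'; split=> // s t sab tab; have := cf s t sab tab.
by rewrite !mul1r !mulN1r.
Qed.

Lemma cantor_tent_mod L i s t : `|s - t| <= delta (L + i)%N ->
  `|cantor_tent delta L s - cantor_tent delta L t| <= 2 * 2 ^- i.
Proof.
move=> st; apply: cantor_mod => //.
have -> : delta L - `|s| - (delta L - `|t|) = `|t| - `|s| by ring.
by rewrite (le_trans (ler_dist_dist _ _))// distrC.
Qed.

Lemma cantor_bump_mod L i s t : `|s - t| <= delta (L + i)%N ->
  `|cantor_bump delta L s - cantor_bump delta L t| <= 4 * 2 ^- i.
Proof.
move=> st; rewrite /cantor_bump.
set a := cantor_tent _ _ _; set b := cantor_tent _ _ _.
set c := cantor_tent _ _ _; set d := cantor_tent _ _ _.
have h1 : `|a - c| <= 2 * 2 ^- i.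
  by apply: cantor_tent_mod; rewrite (_ : _ - _ = s - t)//; ring.
have h2 : `|b - d| <= 2 * 2 ^- i.
  by apply: cantor_tent_mod; rewrite (_ : _ - _ = s - t)//; ring.
have -> : a - b - (c - d) = (a - c) - (b - d) by ring.
by rewrite (le_trans (ler_normB _ _))//; lra.
Qed.

Lemma cantor_tent_continuous L : continuous (cantor_tent delta L).
Proof.
move=> y; apply: (@continuous_comp _ _ _ (fun y : R => delta L - `|y|) (cantor delta L)).
  by apply: cvgB; [exact: cvg_cst|apply: cvg_norm; exact: cvg_id].
exact: cantor_continuous.
Qed.

(** Outside the support of the tent its primitive [S] is constant on each side; for
    [|y| >= 2 * delta L] both shifted arguments lie on the same side, so their values cancel. *)
Lemma cantor_bump_primitive L : exists B : R -> R,
  (forall y, is_derive y (1 : R) B (cantor_bump delta L y)) /\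
  (forall y, 2 * delta L <= `|y| -> B y = 0).
Proof.
have [S [dS _]] := exists_primitive (@cantor_tent_continuous L).
have d0 := delta_gt0 L.
exists (fun y => S (y + delta L) - S (y - delta L)); split.
  move=> y.
  have dl1 : is_derive y (1 : R) (fun u : R => u + delta L) 1.
    by apply: is_derive_eq; rewrite addr0.
  have dl2 : is_derive y (1 : R) (fun u : R => u - delta L) 1.
    by apply: is_derive_eq; rewrite subr0.
  have d1 : is_derive y (1 : R) (fun u : R => S (u + delta L)) _ :=
    @is_derive1_comp R S (fun u => u + delta L) y _ _ (dS _) dl1.
  have d2 : is_derive y (1 : R) (fun u : R => S (u - delta L)) _ :=
    @is_derive1_comp R S (fun u => u - delta L) y _ _ (dS _) dl2.
  by apply: is_derive_eq; rewrite !mulr1.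
have Scst a b : a <= b -> (forall t, a <= t <= b -> delta L <= `|t|) -> S a = S b.
  move=> ab H; apply: (mvt_cst ab) => t tab.
  by rewrite -(cantor_tent_eq0 delta_gt0 delta_half (H t tab)).
move=> y; have [y0|y0] := lerP 0 y.
  rewrite ger0_norm// => yd; apply/eqP; rewrite subr_eq0; apply/eqP/esym.
  apply: Scst => [|t /andP[t1 t2]]; first lra.
  by rewrite ger0_norm; lra.
rewrite ltr0_norm// => yd; apply/eqP; rewrite subr_eq0; apply/eqP/esym.
apply: Scst => [|t /andP[t1 t2]]; first lra.
by rewrite ler0_norm; lra.
Qed.

End bump.

Lemma interval_enumeration (R : realType) (T : R) : 0 < T ->
  exists a b : nat -> R, (forall m, [/\ 0 <= a m, a m < b m & b m <= T]) /\
  forall u v, 0 <= u -> u < v -> v <= T -> exists m, u <= a m /\ b m <= v.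
Proof.
move=> T0.
(* Codes that give no admissible pair of rationals are sent to [(0, T)], so that every index names a
   nonempty interval. *)
pose ab m : R * R := if @unpickle (rat * rat)%type m is Some pq then
    if (0 <= ratr pq.1 :> R) && ((ratr pq.1 < ratr pq.2 :> R) && (ratr pq.2 <= T))
    then (ratr pq.1, ratr pq.2) else (0, T) else (0, T).
exists (fun m => (ab m).1), (fun m => (ab m).2); split.
  move=> m; rewrite /ab; case: unpickle => [pq|] /=; last by split=> //; exact: ltW.
  by case: ifP => [/and3P[]|_] //=; split=> //; exact: ltW.
move=> u v u0 uv vT.
have uz : u < (u + v) / 2 by lra.
have zv : (u + v) / 2 < v by lra.
have [p] := rat_in_itvoo uz; rewrite in_itv/= => /andP[up pz].
have [q] := rat_in_itvoo zv; rewrite in_itv/= => /andP[zq qv].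
exists (pickle (p, q)); rewrite /ab pickleK /=.
rewrite ifT/=; first by split; exact: ltW.
by apply/and3P; split; lra.
Qed.

(** * Recursive choice of the blocks *)

Section bump_sequence.
Variables (R : realType) (delta : nat -> R).
Hypothesis delta_gt0 : forall k, 0 < delta k.
Hypothesis delta_half : forall k, 2 * delta k.+1 < delta k.
Variables (a b : nat -> R) (cB : nat -> nat -> R).
Hypothesis ab : forall m, a m < b m.
Hypothesis cB0 : forall L m, 0 < cB L m.

Definition bump_sum (x : nat -> R) (L : nat -> nat) (A : nat -> R) (m : nat)
  (t : R) : R := \sum_(i < m) A i * cantor_bump delta (L i) (t - x i).

Lemma bump_step m (g : R -> R) e : densely_cst g -> 0 < e ->
  exists d : R * nat * R * R, let: (x, L, A, v) := d in
  [/\ (m <= L)%N, 0 < A <= e, A <= cB L m,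
    a m <= x - 2 * delta L /\ x + 2 * delta L <= b m &
    forall t, x - 2 * delta L <= t <= x + 2 * delta L -> g t = v].
Proof.
move=> dg e0; have [u [v [au uv vb cg]]] := dg _ _ (ab m).
(* The block has length [4 * delta (m + i)] and must fit into the interval of constancy. Starting at
   index [m] gives [m <= L], which turns decay in [L] into decay in [m]. *)
have [i di] := @delta_small R delta delta_gt0 delta_half m ((v - u) / 4) ltac:(lra).
exists ((u + v) / 2, (m + i)%N, Num.min e (cB (m + i)%N m), g ((u + v) / 2)).
have d0 := delta_gt0 (m + i)%N.
split.
- exact: leq_addr.
- by rewrite lt_min e0 cB0 ge_min lexx.
- by rewrite ge_min lexx orbT.
- by split; lra.
- by move=> t tI; apply: cg; lra.
Qed.

Lemma exists_bump_sequence : exists x L A v,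
  forall m, [/\ (m <= L m)%N, 0 < A m <= cB (L m) m, A m.+1 <= A m / 8,
    a m <= x m - 2 * delta (L m) /\ x m + 2 * delta (L m) <= b m &
    forall t, x m - 2 * delta (L m) <= t <= x m + 2 * delta (L m) ->
      bump_sum x L A m t = v m].
Proof.
(* The choice function is total: states violating the invariants get a default value, and [stP]
   shows that the states reached satisfy them. *)
have /choice[F FP] : forall ms : nat * ((R -> R) * R),
    exists d : R * nat * R * R, densely_cst ms.2.1 -> 0 < ms.2.2 ->
    let: (x, L, A, v) := d in
    [/\ (ms.1 <= L)%N, 0 < A <= ms.2.2, A <= cB L ms.1,
      a ms.1 <= x - 2 * delta L /\ x + 2 * delta L <= b ms.1 &
      forall t, x - 2 * delta L <= t <= x + 2 * delta L -> ms.2.1 t = v].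
  move=> [m [g e]] /=; have [dg|ndg] := pselect (densely_cst g); last first.
    by exists (0, 0%N, 0, 0).
  have [e0|e0] := ltrP 0 e; last by exists (0, 0%N, 0, 0).
  by have [d dP] := bump_step m dg e0; exists d.
pose xx m s := (F (m, s)).1.1.1; pose LL m s := (F (m, s)).1.1.2.
pose AA m s := (F (m, s)).1.2; pose vv m s := (F (m, s)).2.
(* A state consists of the partial sum and the upper bound for the next amplitude. *)
pose st := fix st (m : nat) : (R -> R) * R := if m is m'.+1 then
   (fun t => (st m').1 t + AA m' (st m') *
       cantor_bump delta (LL m' (st m')) (t - xx m' (st m')),
    AA m' (st m') / 8) else (fun=> 0, 1).
have stP m : densely_cst (st m).1 /\ 0 < (st m).2.
  elim: m => [|m [dm sm]]; first by split=> //; exact: densely_cst_cst.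
  have := FP (m, st m) dm sm => /=.
  rewrite /AA /LL /xx; case: (F (m, st m)) => [[[x L] A] v] /= [_ /andP[A0 _] _ _ _].
  split; last by rewrite divr_gt0.
  have := densely_cst_comb 1 A dm (densely_cst_shift (- x) (densely_cst_bump delta_gt0 delta_half L)).
  move=> H u1 u2 uu; have [a' [b' [? ? ? cf]]] := H _ _ uu.
  exists a', b'; split=> // s t sab tab; have := cf s t sab tab.
  by rewrite !mul1r.
have stE m : (st m).1 = bump_sum (fun m => xx m (st m)) (fun m => LL m (st m))
    (fun m => AA m (st m)) m.
  elim: m => [|m IHm]; first by apply/funext => t; rewrite /bump_sum big_ord0.
  by apply/funext => t; rewrite /bump_sum big_ord_recr /= IHm.
exists (fun m => xx m (st m)), (fun m => LL m (st m)), (fun m => AA m (st m)),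
  (fun m => vv m (st m)) => m.
have [dm sm] := stP m; have [dm1 sm1] := stP m.+1.
have := FP (m, st m) dm sm; have := FP (m.+1, st m.+1) dm1 sm1.
rewrite -stE /= /AA /LL /xx /vv.
case: (F (m, st m)) => [[[x L] A] v] /=.
set q := F _; case: q => [[[x1 L1] A1] v1] /=.
by move=> [_ /andP[_ A1A] _ _ _] [mL /andP[A0 _] AB xI gv]; split=> //; rewrite A0.
Qed.

End bump_sequence.

Section bump_series.
Variables (R : realType) (delta : nat -> R) (c T : R).
Hypothesis c01 : 0 < c <= 1.
Hypothesis T0 : 0 < T.
Hypothesis delta_gt0 : forall k, 0 < delta k.
Hypothesis delta_half : forall k, 2 * delta k.+1 < delta k.
Variables (x : nat -> R) (L : nat -> nat) (A v : nat -> R) (B : nat -> R -> R).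
Hypothesis A0 : forall m, 0 < A m.
Hypothesis Ac : forall m, A m <= c * 2 ^- L m * 2 ^- m.+2.
Hypothesis A8 : forall m, A m.+1 <= A m / 8.
Hypothesis xl : forall m, 0 <= x m - 2 * delta (L m).
Hypothesis xr : forall m, x m + 2 * delta (L m) <= T.
Hypothesis vE : forall m t, x m - 2 * delta (L m) <= t <= x m + 2 * delta (L m) ->
  bump_sum delta x L A m t = v m.
Hypothesis dB : forall k y, is_derive y (1 : R) (B k) (cantor_bump delta k y).
Hypothesis B0 : forall k y, 2 * delta k <= `|y| -> B k y = 0.

Local Notation gam m := (bump_sum delta x L A m).

Definition bump_limit (t : R) : R := limn (fun m => gam m t).

Definition bump_sum_primitive (m : nat) (t : R) : R :=
  \sum_(i < m) A i * B (L i) (t - x i).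

Lemma bump_sumS m t : gam m.+1 t = gam m t + A m * cantor_bump delta (L m) (t - x m).
Proof. by rewrite /bump_sum big_ord_recr. Qed.

Lemma bump_sum_step m t : `|gam m.+1 t - gam m t| <= A m.
Proof.
rewrite bump_sumS addrC addKr normrM (gtr0_norm (A0 m)) ler_piMr ?(ltW (A0 m))//.
exact: cantor_bump_le1.
Qed.

(** Bounding by a difference lets the induction telescope: [A m.+1 <= A m / 8] gives
    [A m <= 8 / 7 * (A m - A m.+1)]. *)
Lemma bump_sum_tail m M t : (m <= M)%N ->
  `|gam M t - gam m t| <= 8 / 7 * (A m - A M).
Proof.
move=> /subnK <-; elim: (M - m)%N => [|n IHn].
  by rewrite add0n !subrr normr0 mulr0.
rewrite addSn; have := bump_sum_step (n + m) t; have := A8 (n + m).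
set g2 := gam (n + m).+1 t; set g1 := gam (n + m) t in IHn *; set g0 := gam m t in IHn *.
have -> : g2 - g0 = (g2 - g1) + (g1 - g0) by ring.
by have := ler_normD (g2 - g1) (g1 - g0); lra.
Qed.

Lemma amplitude_le m : A m <= 2 ^- m.+2.
Proof.
have [c0 c1] := andP c01; apply: (le_trans (Ac m)).
rewrite ler_piMl ?invr_ge0 ?exprn_ge0// mulr_ile1 ?(ltW c0) ?invr_ge0 ?exprn_ge0//.
by rewrite invf_le1 ?exprn_gt0// exprn_ege1// ler1n.
Qed.

Lemma cvg_amplitude : A m @[m --> \oo] --> (0 : R).
Proof.
apply: (@squeeze_cvgr _ _ _ _ (fun=> 0) (fun m => 2 ^- m)).
- near=> m; rewrite (ltW (A0 m))/= (le_trans (amplitude_le m))//.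
  by rewrite lef_pV2 ?posrE ?exprn_gt0// ler_eXn2l ?ltr1n//; lia.
- exact: cvg_cst.
- under eq_fun do rewrite -exprVn.
  by apply: cvg_expr; rewrite ger0_norm; lra.
Unshelve. all: by end_near. Qed.

Lemma cvg_bump_sum t : gam m t @[m --> \oo] --> bump_limit t.
Proof.
(* The correction compensates the largest possible next increment, so [u] is nonincreasing and
   monotone convergence applies. *)
pose u m := gam m t + 8 / 7 * A m.
have cu : cvgn u.
  apply: nonincreasing_is_cvgn.
    apply/nonincreasing_seqP => m; rewrite /u.
    have := bump_sum_step m t; rewrite ler_norml => /andP[_].
    by have := A8 m; lra.
  exists (gam 0 t - 8 / 7 * A 0) => _ [m _ <-].
  have := bump_sum_tail t (leq0n m); rewrite ler_norml => /andP[+ _].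
  by have := A0 m; rewrite /u; lra.
have ca : (8 / 7 * A m @[m --> \oo] --> (8 / 7 : R) * 0).
  by apply: cvgMl_tmp; exact: cvg_amplitude.
have : cvgn (fun m => gam m t).
  have -> : (fun m => gam m t) = (fun m => u m - 8 / 7 * A m).
    by apply/funext => m; rewrite /u addrK.
  by apply: is_cvgB => //; apply/cvg_ex; eexists; exact: ca.
by [].
Qed.

Lemma bump_limit_tail m t : `|bump_limit t - gam m t| <= 8 / 7 * A m.
Proof.
have cv : `|gam M t - gam m t| @[M --> \oo] --> `|bump_limit t - gam m t|.
  apply: cvg_norm; apply: cvgB; [exact: cvg_bump_sum|exact: cvg_cst].
apply: (cvgr_to_le cv); near=> M.
have mM : (m <= M)%N by near: M; exact: nbhs_infty_ge.
by have := bump_sum_tail t mM; have := A0 M; lra.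
Unshelve. all: by end_near. Qed.

(** From [A 0 <= 1 / 4], as [8 / 7 * 1 / 4 < 1 / 2]. It keeps the derivative of the circle map at
    least [1 / 2]. *)
Lemma bump_limit_le t : `|bump_limit t| <= 2^-1.
Proof.
have := bump_limit_tail 0 t; have := amplitude_le 0.
rewrite /bump_sum big_ord0 subr0 (_ : 2 ^- 2 = 4^-1 :> R); first lra.
by congr (_^-1); rewrite expr2; lra.
Qed.

(** A bump with [L i <= j] is estimated at its generation [j - L i], where the factor [2 ^- L i] of
    its amplitude restores [2 ^- j]; for [L i > j] its size alone is small enough. The factors
    [2 ^- i.+2] add up to less than [1 / 2]. *)
Lemma bump_sum_mod m j s t : `|s - t| <= delta j ->
  `|gam m s - gam m t| <= 2 * c * 2 ^- j.
Proof.
move=> st; have [c0 c1] := andP c01.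
have p0 i : 0 < 2 ^- i :> R by rewrite invr_gt0 exprn_gt0.
have term i : `|A i * cantor_bump delta (L i) (s - x i) -
    A i * cantor_bump delta (L i) (t - x i)| <= 4 * (c * 2 ^- j) * 2 ^- i.+2.
  rewrite -mulrBr normrM (gtr0_norm (A0 i)).
  have [Lj|jL] := leqP (L i) j.
    have st' : `|s - x i - (t - x i)| <= delta (L i + (j - L i))%N.
      by rewrite subnKC// (_ : _ - _ = s - t)//; ring.
    have := cantor_bump_mod delta_gt0 delta_half st' => H.
    apply: le_trans (ler_pM (ltW (A0 i)) (normr_ge0 _) (Ac i) H) _.
    have -> : 2 ^- j = 2 ^- L i * 2 ^- (j - L i) :> R.
      by rewrite -invfM -exprD subnKC.
    by rewrite le_eqVlt; apply/orP; left; apply/eqP; ring.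
  have b2 : `|cantor_bump delta (L i) (s - x i) - cantor_bump delta (L i) (t - x i)| <= 2.
    rewrite (le_trans (ler_normB _ _))//.
    have := cantor_bump_le1 delta_gt0 delta_half (L i) (s - x i).
    have := cantor_bump_le1 delta_gt0 delta_half (L i) (t - x i).
    lra.
  apply: le_trans (ler_pM (ltW (A0 i)) (normr_ge0 _) (Ac i) b2) _.
  have h : 2 ^- L i <= 2 ^- j :> R.
    by rewrite lef_pV2 ?posrE ?exprn_gt0// ler_eXn2l ?ltr1n// ltnW.
  have -> : c / 2 ^+ L i / 2 ^+ i.+2 * 2 = c * 2 ^- i.+2 * 2 * 2 ^- L i by ring.
  have -> : 4 * (c / 2 ^+ j) / 2 ^+ i.+2 = c * 2 ^- i.+2 * 2 * (2 * 2 ^- j) by ring.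
  rewrite ler_wpM2l ?mulr_ge0 ?(ltW c0) ?(ltW (p0 _))//.
  by have := p0 j; lra.
have sum : `|gam m s - gam m t| <= 4 * (c * 2 ^- j) * (2^-1 - 2 ^- m.+1).
  elim: m => [|m IHm].
    by rewrite /bump_sum !big_ord0 subrr normr0 expr1 subrr mulr0.
  rewrite !bump_sumS.
  have -> (p q r z : R) : p + q - (r + z) = (p - r) + (q - z) by ring.
  rewrite (le_trans (ler_normD _ _))// (le_trans (lerD IHm (term m)))//.
  have -> : 2 ^- m.+2 = 2 ^- m.+1 / 2 :> R by rewrite [2 ^+ m.+2]exprS invfM mulrC.
  by rewrite le_eqVlt; apply/orP; left; apply/eqP; move: (2 ^- m.+1) => q; field.
apply: (le_trans sum).
have cj : 0 <= c * 2 ^- j by rewrite mulr_ge0 ?(ltW c0) ?(ltW (p0 _)).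
rewrite (_ : 2 * c * _ = 4 * (c * 2 ^- j) * 2^-1); last by field; rewrite gt_eqF ?exprn_gt0.
by apply: ler_wpM2l; [rewrite mulr_ge0|rewrite gerBl ltW].
Qed.

Lemma bump_limit_mod j s t : `|s - t| <= delta j ->
  `|bump_limit s - bump_limit t| <= 2 * c * 2 ^- j.
Proof.
move=> st.
have cv : `|gam M s - gam M t| @[M --> \oo] --> `|bump_limit s - bump_limit t|.
  by apply: cvg_norm; apply: cvgB; exact: cvg_bump_sum.
apply: (cvgr_to_le cv); near=> M; exact: bump_sum_mod.
Unshelve. all: by end_near. Qed.

Lemma bump_limit_continuous : continuous bump_limit.
Proof.
move=> t; apply/cvgrPdist_lt => e e0; have [c0 c1] := andP c01.
have [i ie] : exists i, 2 * 2 ^- i < e.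
  have H : (2 * 2 ^- i @[i --> \oo] --> (2 : R) * 0).
    apply: cvgMl_tmp; under eq_fun do rewrite -exprVn.
    by apply: cvg_expr; rewrite ger0_norm; lra.
  rewrite mulr0 in H; have /cvgrPdist_lt /(_ e e0) [i _ /(_ i (leqnn i))] := H.
  rewrite /= sub0r normrN ger0_norm; first by exists i.
  by rewrite mulr_ge0// invr_ge0 exprn_ge0.
exists (delta i) => //= s ts; apply: le_lt_trans ie.
apply: (le_trans (bump_limit_mod (ltW ts))).
by rewrite -mulrA ler_wpM2l// ler_piMl// invr_ge0 exprn_ge0.
Qed.

Lemma bump_out m t : t <= 0 \/ T <= t -> 2 * delta (L m) <= `|t - x m|.
Proof.
have := xl m; have := xr m; have := delta_gt0 (L m) => ? ? ? [tT|tT].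
  by rewrite ler0_norm; lra.
by rewrite ger0_norm; lra.
Qed.

Lemma bump_limit_out t : t <= 0 \/ T <= t -> bump_limit t = 0.
Proof.
move=> tT; rewrite /bump_limit.
have -> : (fun m => gam m t) = (fun=> 0).
  apply/funext => m; rewrite /bump_sum big1// => i _.
  by rewrite cantor_bump_out ?mulr0//; exact: bump_out.
exact: lim_cst.
Qed.

Lemma bump_sum_primitive_out m t : t <= 0 \/ T <= t -> bump_sum_primitive m t = 0.
Proof.
move=> tT; rewrite /bump_sum_primitive big1// => i _.
by rewrite B0 ?mulr0//; exact: bump_out.
Qed.

Lemma bump_sum_primitive_derive m (t : R) :
  is_derive t (1 : R) (bump_sum_primitive m) (gam m t).
Proof.
elim: m => [|m IHm].
  have -> : bump_sum_primitive 0 = cst 0.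
    by apply/funext => u; rewrite /bump_sum_primitive big_ord0.
  by rewrite /bump_sum big_ord0; exact: is_derive_cst.
have dl : is_derive t (1 : R) (fun u : R => u - x m) 1.
  by apply: is_derive_eq; rewrite subr0.
have d1 : is_derive t (1 : R) (fun u : R => B (L m) (u - x m)) _ :=
  @is_derive1_comp R (B (L m)) (fun u => u - x m) t _ _ (dB _ _) dl.
have -> : bump_sum_primitive m.+1 = (fun u => bump_sum_primitive m u +
    A m * B (L m) (u - x m)).
  by apply/funext => u; rewrite /bump_sum_primitive big_ord_recr.
by apply: is_derive_eq; rewrite bump_sumS mulr1 /GRing.scale.
Qed.

Variable G : R -> R.
Hypothesis dG : forall t, is_derive t (1 : R) G (bump_limit t).
Hypothesis G00 : G 0 = 0.

Lemma bump_primitive_tail m t : 0 <= t <= T ->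
  `|G t - bump_sum_primitive m t| <= 8 / 7 * A m * T.
Proof.
move=> /andP[t0 tT]; pose D u := G u - bump_sum_primitive m u.
have D0 : D 0 = 0.
  by rewrite /D G00 bump_sum_primitive_out ?subrr//; left.
have := @mvt_bound R D (fun u => bump_limit u - gam m u) 0 t (8 / 7 * A m) t0.
rewrite D0 !subr0 => H; apply: (@le_trans _ _ (8 / 7 * A m * t)).
  apply: H => u _; last exact: bump_limit_tail.
  have h1 := dG u; have h2 := bump_sum_primitive_derive m u.
  exact: is_deriveB.
by rewrite ler_wpM2l// mulr_ge0 ?(ltW (A0 m))//; lra.
Qed.

(** Beyond [T] this says that the limit has zero integral: the primitives of the partial sums vanish
    at [T] and approximate [G T] with an error proportional to [A m]. *)
Lemma bump_primitive_out t : t <= 0 \/ T <= t -> G t = 0.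
Proof.
case=> tT.
  rewrite -G00; apply: (mvt_cst tT) => u /andP[_ u0].
  by rewrite -(bump_limit_out (or_introl u0)).
have -> : G t = G T.
  apply/esym/(mvt_cst tT) => u /andP[u0 _].
  by rewrite -(bump_limit_out (or_intror u0)).
have GT m : `|G T| <= 8 / 7 * A m * T.
  have := @bump_primitive_tail m T; rewrite (ltW T0) lexx => /(_ isT).
  by rewrite bump_sum_primitive_out ?subr0//; right.
have ca : (8 / 7 * A m * T @[m --> \oo] --> (8 / 7 : R) * 0 * T).
  by apply: cvgMr_tmp; apply: cvgMl_tmp; exact: cvg_amplitude.
rewrite mulr0 mul0r in ca.
have : `|G T| <= 0 by apply: (cvgr_to_ge ca); near=> m; exact: GT.
by rewrite normr_le0 => /eqP.
Unshelve. all: by end_near. Qed.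

(* On the m-th interval, the earlier bumps contribute a constant and the later
   ones at most [A m / 7], while the m-th one takes the values [A m] and [- A m]. *)
Lemma bump_limit_not_cst m u1 u2 : u1 <= x m - 2 * delta (L m) ->
  x m + 2 * delta (L m) <= u2 ->
  ~ (forall s t, u1 < s < u2 -> u1 < t < u2 -> bump_limit s = bump_limit t).
Proof.
move=> u1x xu2 H; have d0 := delta_gt0 (L m).
pose s := x m - delta (L m); pose t := x m + delta (L m).
have E : bump_limit s = bump_limit t by apply: H; rewrite /s /t; lra.
have gs : gam m s = v m by apply: vE; rewrite /s; lra.
have gt : gam m t = v m by apply: vE; rewrite /t; lra.
have dd : 0 <= delta (L m) <= delta (L m) by lra.
have bs : cantor_bump delta (L m) (s - x m) = 1.
  have -> : s - x m = - delta (L m) by rewrite /s; ring.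
  by rewrite cantor_bump2// cantor_eq1.
have bt : cantor_bump delta (L m) (t - x m) = -1.
  have -> : t - x m = delta (L m) by rewrite /t; ring.
  by rewrite cantor_bump3// cantor_eq1.
have := bump_limit_tail m.+1 s; have := bump_limit_tail m.+1 t.
rewrite !bump_sumS gs gt bs bt E !ler_norml.
by have := A0 m; have := A8 m; lra.
Qed.

End bump_series.

(** * Circle diffeomorphisms with derivative bounded below *)

Section diffeo.
Variable R : realType.
Variables (h dh : R -> R).
Hypothesis dhE : forall t, is_derive t (1 : R) h (dh t).
Hypothesis dhc : continuous dh.
Hypothesis dh_ge : forall t, 2^-1 <= dh t.
Hypothesis h_shift : forall t (z : int), h (t + z%:~R * (2 * pi)) = h t + z%:~R * (2 * pi).

Lemma derive1_is_derive (f df : R -> R) :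
  (forall t, is_derive t (1 : R) f (df t)) -> derive1 f = df.
Proof. by move=> H; apply/funext => t; rewrite derive1E; case: (H t). Qed.

Lemma expanding s t : s <= t -> (t - s) / 2 <= h t - h s.
Proof.
move=> st; have [u _ ->] := mvt_ex st (fun t _ => dhE t).
by rewrite mulrC ler_wpM2r ?subr_ge0.
Qed.

Lemma expanding_inj s t : h s = h t -> s = t.
Proof.
move=> st; apply/eqP; rewrite eq_le; apply/andP; split; rewrite leNgt; apply/negP.
  by move=> /[dup] ts /ltW/expanding; lra.
by move=> /[dup] ts /ltW/expanding; lra.
Qed.

Lemma expanding_surj y : exists t, h t = y.
Proof.
pose K := 2 * `|y - h 0|; have K0 : 0 <= K by rewrite mulr_ge0.
have KK : - K <= K by lra.
have [] := @IVT R h (- K) K y KK.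
- by apply: continuous_subspaceT => t; exact: is_derive_continuous (dhE t).
- have h1 := expanding K0; have NK : - K <= 0 by lra.
  have h2 := expanding NK; have := ler_norm (y - h 0).
  have := ler_norm (- (y - h 0)); rewrite normrN => n1 n2.
  rewrite ge_min le_max; apply/andP; split; apply/orP; [left|right].
    by move: h2 n1; rewrite /K; lra.
  by move: h1 n2; rewrite /K; lra.
by move=> t _ ty; exists t.
Qed.

Lemma circle_diffeo_expanding : circle_diffeo h.
Proof.
have dE := derive1_is_derive dhE.
have ch : continuous h by move=> t; exact: is_derive_continuous (dhE t).
have shift1 t : h (t + 2 * pi) = h t + 2 * pi.
  by have := h_shift t 1; rewrite mul1r.
split.
- split=> //; first by move=> t; exists 1; rewrite mul1r shift1.
  move=> s t [z]; rewrite -h_shift => /expanding_inj ->.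
  by exists z.
- by split; [move=> t; case: (dhE t)|rewrite dE].
have [g gK] := choice expanding_surj.
have hK t : g (h t) = t by apply: expanding_inj; rewrite gK.
have dg y : is_derive y (1 : R) g (dh (g y))^-1.
  have n1 : {near g y, cancel h g} by near=> t; exact: hK.
  have n2 : {near g y, continuous h} by near=> t; exact: ch.
  have n3 : dh (g y) != 0 by rewrite gt_eqF//; have := dh_ge (g y); lra.
  by have := is_derive_inverse n1 n2 (dhE (g y)) n3; rewrite gK.
have cg : continuous g by move=> y; exact: is_derive_continuous (dg y).
exists g; split.
- move=> t; exists 1; rewrite mul1r; apply: expanding_inj.
  by rewrite shift1 !gK.
- by split=> t; exists 0; rewrite ?hK ?gK mul0r addr0.
split; first by move=> y; case: (dg y).
rewrite (derive1_is_derive dg) => y; apply: cvgV.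
  by rewrite gt_eqF//; have := dh_ge (g y); lra.
by apply: continuous_comp; [exact: cg|exact: dhc].
Unshelve. all: by end_near. Qed.

End diffeo.

Section perturbed_identity.
Variable R : realType.
Variables (G g : R -> R).
Local Notation T := (2 * pi : R).
Hypothesis dG : forall t, is_derive t (1 : R) G (g t).
Hypothesis gc : continuous g.
Hypothesis Gout : forall t, t <= 0 \/ T <= t -> G t = 0.
Hypothesis gout : forall t, t <= 0 \/ T <= t -> g t = 0.
Hypothesis g_le : forall t, `|g t| <= 2^-1.

Definition perturbed_id (t : R) : R := t + periodize T G t.

Let T0 : 0 < T. Proof. by rewrite mulr_gt0// pi_gt0. Qed.

Lemma perturbed_id_derive (t : R) :
  is_derive t (1 : R) perturbed_id (1 + periodize T g t).
Proof.
have := @periodize_derive R T T0 G g t dG (fun t H => Gout (or_introl H))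
  (fun t H => Gout (or_intror H)) (fun t H => gout (or_intror H)).
by move=> d1; exact: is_deriveD.
Qed.

Lemma periodize_continuous : continuous (periodize T g).
Proof.
move=> t; have /andP[t1 t2] := floor_mul_itv T0 t.
set z := Num.floor (t / T) in t1 t2.
pose F u := g (u - T * z%:~R) + g (u - (T * z%:~R - T)).
have E : \forall u \near t, F u = periodize T g u.
  near=> u.
  have s1 : u < T * z%:~R + T by near: u; exact: lt_nbhsl.
  have s2 : T * z%:~R - T < u by near: u; apply: lt_nbhsr; have := T0; lra.
  rewrite /periodize /F; have [zs|sz] := leP (T * z%:~R) u.
    rewrite (floor_mul_uniq T0 (z := z)) ?zs//.
    by rewrite [X in _ + X]gout ?addr0//; right; lra.
  rewrite (floor_mul_uniq T0 (z := z - 1)); last by rewrite intrB; lra.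
  by rewrite [X in X + _]gout; [rewrite add0r intrB mulrBr mulr1|left; lra].
rewrite /continuous_at -(nbhs_singleton E).
apply: (cvg_trans (near_eq_cvg E)).
have sc a : {for t, continuous (fun u => g (u - a))}.
  apply: (@continuous_comp _ _ _ (fun u : R => u - a) g); last exact: gc.
  by apply: cvgB; [exact: cvg_id|exact: cvg_cst].
by apply: cvgD; exact: sc.
Unshelve. all: by end_near. Qed.

Lemma perturbed_id_shift t (z : int) :
  perturbed_id (t + z%:~R * T) = perturbed_id t + z%:~R * T.
Proof. by rewrite /perturbed_id mulrC (periodize_shift T0) addrAC. Qed.

Lemma perturbed_id_diffeo : circle_diffeo perturbed_id.
Proof.
apply: (circle_diffeo_expanding perturbed_id_derive).
- by move=> t; apply: cvgD; [exact: cvg_cst|exact: periodize_continuous].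
- move=> t; have := g_le (t - T * (Num.floor (t / T))%:~R).
  by rewrite ler_norml -/(periodize T g t); lra.
- exact: perturbed_id_shift.
Qed.

Lemma perturbed_id_nowhere_linear :
  (forall u v, 0 <= u -> u < v -> v <= T ->
    ~ forall s t, u < s < v -> u < t < v -> g s = g t) ->
  nowhere_linear perturbed_id.
Proof.
move=> gn a b ab [c0 [c1 H]].
pose z := Num.floor (a / T); have /andP[za az] := floor_mul_itv T0 a.
rewrite -/z in za az.
have dcst t : a < t < b -> periodize T g t = c1 - 1.
  move=> tab; have d1 := perturbed_id_derive t.
  have d2 : is_derive t (1 : R) perturbed_id c1.
    have dl : is_derive t (1 : R) (fun u : R => c1 * u + c0) c1.
      by apply: is_derive_eq; rewrite /GRing.scale /= mulr1 addr0.
    have /andP[ta tb] := tab.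
    apply: near_eq_is_derive dl; near=> u; apply/esym/H; rewrite in_itv/=.
    by apply/andP; split; near: u; [exact: lt_nbhsr|exact: lt_nbhsl].
  case: d1 => _; case: d2 => _ -> ->; ring.
(* The part of the translated interval that remains within one period. *)
pose v := Num.min (b - T * z%:~R) T.
have := gn (a - T * z%:~R) v; apply.
- lra.
- by rewrite lt_min; apply/andP; split; lra.
- by rewrite ge_min lexx orbT.
have gE s : a - T * z%:~R < s < v -> g s = c1 - 1.
  rewrite lt_min => /andP[s1 /andP[s2 s3]].
  rewrite -(dcst (s + T * z%:~R)); last lra.
  by rewrite (periodize_shift T0) (periodize_id T0)//; apply/andP; split; lra.
by move=> s t /gE -> /gE ->.
Unshelve. all: by end_near. Qed.

Lemma perturbed_id_C1w (w : R -> R) (delta : nat -> R) (c : R) :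
  (forall d1 d2 : R, 0 <= d1 -> d1 <= d2 -> w d1 <= w d2) -> 0 <= c ->
  (forall k, 0 < delta k) -> (forall k, delta k <= 1) ->
  (forall k, 2 * delta k.+1 < delta k) ->
  (forall k, w (delta k) = c * 2 ^- k) ->
  (forall j s t, `|s - t| <= delta j -> `|g s - g t| <= 2 * c * 2 ^- j) ->
  C1w_smooth w perturbed_id.
Proof.
move=> w_nd c0 d0 d1 dh wd gm; split; first by move=> t; case: (perturbed_id_derive t).
(* For the first [j] with [delta j < d <= delta j.-1], the bound at scale [j.-1] is
   [2 * c * 2 ^- j.-1], doubled by the periodic extension; this equals [8 * w (delta j)], which is
   at most [8 * w d]. *)
exists 8; near=> d.
have dd0 : 0 < d by near: d; exact: nbhs_right_gt.
have dd1 : d < delta 0 by near: d; exact: nbhs_right_lt.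
have ex : exists j, delta j < d.
  have [i di] := delta_small d0 dh 0 dd0; exists i; by rewrite add0n in di.
case: (ex_minnP ex) => j jd jmin.
have j0 : (0 < j)%N.
  by rewrite lt0n; apply: contraTneq jd => ->; rewrite -leNgt ltW.
have dj : d <= delta j.-1.
  by rewrite leNgt; apply/negP => /jmin; rewrite -ltnS prednK// ltnn.
rewrite (derive1_is_derive perturbed_id_derive).
apply: ge_ereal_sup => _ [u /= ud <-]; rewrite lee_fin.
rewrite opprD addrACA subrr add0r.
have dT : delta j.-1 < T.
  by apply: (le_lt_trans (d1 _)); have := pi_ge2 R; lra.
have := @periodize_modulus R T T0 g (delta j.-1) (2 * c * 2 ^- j.-1) u.1 u.2
  (fun t H => gout (or_introl H)) (fun t H => gout (or_intror H)) dT
  (gm j.-1) (le_trans ud dj).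
move/le_trans; apply.
have -> : 2 * (2 * c * 2 ^- j.-1) = 8 * w (delta j).
  by rewrite wd -[in RHS](prednK j0) exprS invfM; field; rewrite gt_eqF// exprn_gt0.
by rewrite ler_wpM2l// w_nd// ltW.
Unshelve. all: by end_near. Qed.

End perturbed_identity.

(** * Fourier coefficients *)

Section oscillatory_integral.
Variable R : realType.
Local Notation mu := (@lebesgue_measure R).
Local Notation T := (2 * pi : R).

Definition osc (f : R -> R) : R := \int[mu]_(t in `[0, T]) cos (f t).

Lemma twopi_gt0 : 0 < T. Proof. by rewrite mulr_gt0// pi_gt0. Qed.

Lemma continuous_cos_comp (f : R -> R) : continuous f -> continuous (cos \o f).
Proof. by move=> cf t; apply: continuous_comp; [exact: cf|exact: continuous_cos]. Qed.

Lemma oscE (f : R -> R) : continuous f ->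
  exists2 F, (forall t, is_derive t (1 : R) F (cos (f t))) & osc f = F T - F 0.
Proof.
move=> cf; have [F [dF _]] := exists_primitive (continuous_cos_comp cf).
by exists F => //; apply: (Rintegral_primitive twopi_gt0 _ dF); exact: continuous_cos_comp.
Qed.

Lemma osc_le (f : R -> R) : continuous f -> `|osc f| <= T.
Proof.
move=> /oscE[F dF ->]; have T0 := ltW twopi_gt0.
have := @mvt_bound R F (fun t => cos (f t)) 0 T 1 T0 (fun t _ => dF t).
by rewrite subr0 mul1r; apply => t _; rewrite ler_norml cos_geN1 cos_le1.
Qed.

Lemma cos_lipschitz (a b : R) : `|cos a - cos b| <= `|a - b|.
Proof.
wlog ba : a b / b <= a.
  move=> H; have /orP[ab|/H//] := le_total a b.
  by rewrite (distrC (cos a)) (distrC a); exact: H.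
have := @mvt_bound R cos (fun t => - sin t) b a 1 ba (fun t _ => is_derive_cos t).
rewrite mul1r (ger0_norm (x := a - b)) ?subr_ge0//; apply => t _.
by rewrite normrN ler_norml sin_geN1 sin_le1.
Qed.

Lemma osc_lipschitz (f g : R -> R) e : continuous f -> continuous g ->
  (forall t, 0 <= t <= T -> `|f t - g t| <= e) -> `|osc f - osc g| <= e * T.
Proof.
move=> /oscE[F dF ->] /oscE[G dG ->] fg.
have -> (a b c d : R) : a - b - (c - d) = (a - c) - (b - d) by ring.
have := @mvt_bound R (fun t => F t - G t) (fun t => cos (f t) - cos (g t)) 0 T e
  (ltW twopi_gt0).
rewrite subr0; apply => t tT.
exact: le_trans (cos_lipschitz _ _) (fg t tT).
Qed.

Lemma sin_period (a : R) (z : int) : sin (a + z%:~R * T) = sin a.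
Proof.
have pr (b : R) (n : nat) : sin (b + n%:R * T) = sin b.
  elim: n => [|n IHn]; first by rewrite mul0r addr0.
  rewrite -natr1 mulrDl mul1r addrA [X in _ + X]mulr_natl sinD2pi.
  exact: IHn.
case: z => n; first by rewrite pmulrn pr.
by rewrite NegzE mulrNz -pmulrn -(pr (a + - n.+1%:R * T) n.+1); congr sin; ring.
Qed.

Lemma osc_linear (z : int) (a : R) : z != 0 -> osc (fun t => z%:~R * t + a) = 0.
Proof.
move=> z0; have zr : z%:~R != 0 :> R by rewrite intr_eq0.
have cf : continuous (fun t : R => z%:~R * t + a).
  by move=> t; apply: cvgD; [apply: cvgMl_tmp; exact: cvg_id|exact: cvg_cst].
have dF (t : R) : is_derive t (1 : R) (fun u : R => z%:~R^-1 * sin (z%:~R * u + a))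
    (cos (z%:~R * t + a)).
  have dl : is_derive t (1 : R) (fun u : R => z%:~R * u + a) z%:~R.
    by apply: is_derive_eq; rewrite /GRing.scale /= mulr1 addr0.
  have d1 : is_derive t (1 : R) (fun u : R => sin (z%:~R * u + a)) _ :=
    @is_derive1_comp R sin (fun u => z%:~R * u + a) t _ _ (is_derive_sin _) dl.
  by apply: is_derive_eq; rewrite /GRing.scale /=; field.
rewrite /osc (Rintegral_primitive twopi_gt0 (continuous_cos_comp cf) dF).
by rewrite mulr0 add0r [z%:~R * _ + a]addrC sin_period subrr.
Qed.

End oscillatory_integral.

(** * Telescoping over the successive maps *)

Section telescoping.
Variables (R : realType) (delta : nat -> R) (c : R).
Local Notation T := (2 * pi : R).
Hypothesis c01 : 0 < c <= 1.
Hypothesis delta_gt0 : forall k, 0 < delta k.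
Hypothesis delta_half : forall k, 2 * delta k.+1 < delta k.
Variables (x : nat -> R) (L : nat -> nat) (A v : nat -> R) (B : nat -> R -> R).
Hypothesis A0 : forall m, 0 < A m.
Hypothesis Ac : forall m, A m <= c * 2 ^- L m * 2 ^- m.+2.
Hypothesis A8 : forall m, A m.+1 <= A m / 8.
Hypothesis xl : forall m, 0 <= x m - 2 * delta (L m).
Hypothesis xr : forall m, x m + 2 * delta (L m) <= T.
Hypothesis vE : forall m t, x m - 2 * delta (L m) <= t <= x m + 2 * delta (L m) ->
  bump_sum delta x L A m t = v m.
Hypothesis dB : forall k y, is_derive y (1 : R) (B k) (cantor_bump delta k y).
Hypothesis B0 : forall k y, 2 * delta k <= `|y| -> B k y = 0.
Variable G : R -> R.
Hypothesis dG : forall t, is_derive t (1 : R) G (bump_limit delta x L A t).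
Hypothesis G00 : G 0 = 0.

(** The offset [a] is 0 for the real part of a Fourier coefficient and [- pi / 2] for the imaginary
    part, so that only cosines have to be treated. *)
Definition phase (g : R -> R) (n k a t : R) : R := n * (t + g t) - k * t + a.

Lemma phase_derive (g dg : R -> R) (n k a : R) (t : R) :
  (forall t, is_derive t (1 : R) g (dg t)) ->
  is_derive t (1 : R) (phase g n k a) (n * (1 + dg t) - k).
Proof.
move=> dgE; have d1 : is_derive t (1 : R) g (dg t) := dgE t.
by apply: is_derive_eq; rewrite /GRing.scale /=; ring.
Qed.

Lemma phase_continuous (g : R -> R) (n k a : R) : continuous g ->
  continuous (phase g n k a).
Proof.
move=> cg t; apply: cvgD; last exact: cvg_cst.
apply: cvgB; apply: cvgMl_tmp; last exact: cvg_id.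
by apply: cvgD; [exact: cvg_id|exact: cg].
Qed.

Local Notation Gm := (bump_sum_primitive x L A B).

Lemma bump_sum_primitive_continuous m : continuous (Gm m).
Proof. by move=> t; exact: is_derive_continuous (bump_sum_primitive_derive x L A dB m t). Qed.

(** Off the block the two phases coincide and the integrals cancel. On it the earlier map has slope
    [1 + v m], hence the frequencies are shifted by [n * (1 + v m)]. *)
Lemma osc_block m (n k a : R) :
  block_term delta (L m) (x m) n (A m) (k - n * (1 + v m))
    (osc (phase (Gm m.+1) n k a) - osc (phase (Gm m) n k a)).
Proof.
have d0 := delta_gt0 (L m); have xl' := xl m; have xr' := xr m.
have GmS t : Gm m.+1 t = Gm m t + A m * B (L m) (t - x m).
  by rewrite /bump_sum_primitive big_ord_recr.
have eqG t : t <= x m - 2 * delta (L m) \/ x m + 2 * delta (L m) <= t ->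
    phase (Gm m.+1) n k a t = phase (Gm m) n k a t.
  move=> h; rewrite /phase GmS B0 ?mulr0 ?addr0//.
  by case: h => h; [rewrite ler0_norm|rewrite ger0_norm]; lra.
have [Q dQ QE] := oscE (@phase_continuous _ n k a (@bump_sum_primitive_continuous m.+1)).
have [Q0 dQ0 Q0E] := oscE (@phase_continuous _ n k a (@bump_sum_primitive_continuous m)).
exists Q, (phase (Gm m.+1) n k a), Q0, (phase (Gm m) n k a).
have dp j (t : R) := phase_derive n k a t (bump_sum_primitive_derive x L A dB j).
split.
- split=> [t _|t tI]; first exact: dQ.
  apply: (is_derive_eq (dp m.+1 t)); rewrite bump_sumS vE//; ring.
- split=> [t _|t tI]; first exact: dQ0.
  apply: (is_derive_eq (dp m t)); rewrite vE//; ring.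
- by apply: eqG; left.
- by apply: eqG; right.
have e1 : Q (x m - 2 * delta (L m)) - Q 0 = Q0 (x m - 2 * delta (L m)) - Q0 0.
  by apply: (primitive_diff xl' dQ dQ0) => t /andP[_ tl]; rewrite eqG//; left.
have e2 : Q T - Q (x m + 2 * delta (L m)) = Q0 T - Q0 (x m + 2 * delta (L m)).
  by apply: (primitive_diff xr' dQ dQ0) => t /andP[tl _]; rewrite eqG//; right.
rewrite QE Q0E; lra.
Qed.

(** The initial map is the identity, so by orthogonality only [k = n] contributes. *)
Lemma osc_phase0_sum (n : int) (a p : R) (ks : seq int) : 0 < p -> uniq ks ->
  \sum_(k <- ks) `|osc (phase (Gm 0) n%:~R k%:~R a)| `^ p <= T `^ p.
Proof.
move=> p0 uks.
have E (k : int) : phase (Gm 0) n%:~R k%:~R a = fun t => (n - k)%:~R * t + a.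
  apply/funext => t; rewrite /phase /bump_sum_primitive big_ord0 intrB; ring.
have [nk|nk] := boolP (n \in ks); last first.
  rewrite big_seq big1 ?powR_ge0// => k kks.
  rewrite E osc_linear ?normr0 ?powR0 ?(gt_eqF p0)//.
  by rewrite subr_eq0; apply: contraNneq nk => ->.
rewrite (bigD1_seq n)//= [X in _ + X]big1 ?addr0.
  rewrite ge0_ler_powR ?(ltW p0)// ?nnegrE ?normr_ge0 ?(ltW (twopi_gt0 R))//.
  by apply: osc_le; apply: phase_continuous; exact: bump_sum_primitive_continuous.
by move=> k kn; rewrite E osc_linear ?normr0 ?powR0 ?(gt_eqF p0)// subr_eq0 eq_sym.
Qed.

Lemma osc_primitive_sum (n : int) (a p C U gam : R) : 1 <= p ->
  (forall (K : Type) (ks : seq K) (M : nat) (f : nat -> K -> R) (U : R),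
    0 <= U -> (forall m k, 0 <= f m k) ->
    (forall m, (m < M)%N -> \sum_(k <- ks) f m k `^ p <= U * gam ^+ m) ->
    \sum_(k <- ks) (\sum_(m < M) f m k) `^ p <= C * U) ->
  0 <= U ->
  (forall m ks (y : int -> R), uniq ks ->
    (forall k, block_term delta (L m) (x m) n%:~R (A m) (k%:~R - n%:~R * (1 + v m)) (y k)) ->
    \sum_(k <- ks) `|y k| `^ p <= U * gam ^+ m) ->
  forall ks, uniq ks ->
  \sum_(k <- ks) `|osc (phase G n%:~R k%:~R a)| `^ p <=
    2 `^ p * (2 `^ p * (T `^ p + C * U) + 1).
Proof.
move=> p1 geo U0 blk ks uks.
have p0 : 0 < p by lra.
have T0 := twopi_gt0 R.
pose X (j : nat) (k : int) := osc (phase (Gm j) n%:~R k%:~R a).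
have cG : continuous G by move=> t; exact: is_derive_continuous (dG t).
pose e j := `|n%:~R : R| * (8 / 7 * A j * T) * T.
have e0 j : 0 <= e j.
  rewrite /e mulr_ge0 ?(ltW T0)// mulr_ge0// mulr_ge0 ?(ltW T0)//.
  by rewrite mulr_ge0 ?(ltW (A0 j)).
have eE j k : `|osc (phase G n%:~R k%:~R a) - X j k| <= e j.
  apply: osc_lipschitz.
  - exact: phase_continuous.
  - by apply: phase_continuous; exact: bump_sum_primitive_continuous.
  - move=> t tT; rewrite /phase.
    rewrite (_ : _ - _ = n%:~R * (G t - Gm j t)); last by ring.
    rewrite normrM ler_wpM2l//.
    exact: (bump_primitive_tail c01 T0 delta_gt0 delta_half A0 Ac A8 xl xr dB B0 dG G00).
(* The truncation index may depend on [n] and [ks], since the final bound does not involve it. The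
   two conditions give [e M ^ p <= e M] and a total truncation error of at most 1. *)
have [M [eM1 eMs]] : exists M, e M <= 1 /\ (size ks)%:R * e M <= 1.
  have ce (q : R) : q * e M @[M --> \oo] --> q * (`|n%:~R : R| * (8 / 7 * 0 * T) * T).
    apply: cvgMl_tmp; apply: cvgMr_tmp; apply: cvgMl_tmp; apply: cvgMr_tmp.
    apply: cvgMl_tmp; exact: (cvg_amplitude c01 T0 A0 Ac).
  have z (q : R) : q * (`|n%:~R : R| * (8 / 7 * 0 * T) * T) = 0 by ring.
  have near1 (q : R) : \forall M \near \oo, q * e M <= 1.
    have h := ce q; rewrite z in h.
    by apply: (cvgr_le _ h); exact: ltr01.
  have h1 := near1 1; have h2 := near1 (size ks)%:R.
  have [M _ HM] : \forall M \near \oo, e M <= 1 /\ (size ks)%:R * e M <= 1.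
    by near=> M; split; [rewrite -[e M]mul1r; near: M|near: M].
  by exists M; apply: HM => /=.
pose f m k := `|X m.+1 k - X m k|.
have fs : \sum_(k <- ks) (\sum_(m < M) f m k) `^ p <= C * U.
  apply: geo => // [m k|m mM]; first exact: normr_ge0.
  by apply: (blk m ks (fun k => X m.+1 k - X m k) uks) => k; exact: osc_block.
have tri k : `|osc (phase G n%:~R k%:~R a)| <= `|X 0 k| + \sum_(m < M) f m k + e M.
  have h : `|X M k| <= `|X 0 k| + \sum_(m < M) f m k.
    elim: (M) => [|j IHj]; first by rewrite big_ord0 addr0.
    rewrite big_ord_recr /=; have := ler_normD (X j k) (X j.+1 k - X j k).
    by rewrite subrKC /f; lra.
  have := ler_normD (X M k) (osc (phase G n%:~R k%:~R a) - X M k).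
  by rewrite subrKC; have := eE M k; lra.
have fk0 k : 0 <= \sum_(m < M) f m k by apply: sumr_ge0 => i _; exact: normr_ge0.
have step k : `|osc (phase G n%:~R k%:~R a)| `^ p <= 2 `^ p *
    (2 `^ p * (`|X 0 k| `^ p + (\sum_(m < M) f m k) `^ p) + e M).
  apply: (@le_trans _ _ ((`|X 0 k| + \sum_(m < M) f m k + e M) `^ p)).
    by rewrite ge0_ler_powR ?nnegrE ?addr_ge0 ?(ltW p0).
  apply: le_trans (powR_add_le (ltW p0) _ (e0 M)) _; first by rewrite addr_ge0.
  rewrite ler_wpM2l ?powR_ge0// lerD//; first by rewrite powR_add_le// ltW.
  have [->|eM0] := eqVneq (e M) 0; first by rewrite powR0 ?gt_eqF.
  by apply: ge1r_powR => //; rewrite eM1 andbT lt_def eM0 e0.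
apply: (le_trans (ler_sum _ (fun k _ => step k))).
rewrite -mulr_sumr ler_wpM2l ?powR_ge0// big_split/= lerD//.
  rewrite -mulr_sumr ler_wpM2l ?powR_ge0// big_split/= lerD//.
  exact: osc_phase0_sum.
by rewrite big_const_seq count_predT iter_addr_0 -mulr_natl.
Unshelve. all: by end_near. Qed.

End telescoping.

(** * From oscillatory integrals to Fourier coefficients *)

Section fourier_bounds.
Local Open Scope complex_scope.
Local Open Scope ring_scope.
Variable R : realType.
Local Notation mu := (@lebesgue_measure R).
Local Notation T := (2 * pi : R).

Lemma normc_le (a b : R) : ComplexField.Normc.normc (a +i* b) <= `|a| + `|b|.
Proof.
rewrite -[leRHS]ger0_norm ?addr_ge0// -sqrtr_sqr; apply: ler_wsqrtr.
rewrite sqrrD !real_normK ?num_real//.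
by rewrite addrAC lerDl mulrn_wge0// mulr_ge0.
Qed.

Lemma perturbed_idE (G : R -> R) t : G 0 = G T -> 0 <= t <= T ->
  perturbed_id G t = t + G t.
Proof.
move=> G0T /andP[t0]; rewrite le_eqVlt => /orP[/eqP ->|tT].
  have := periodize_shift (twopi_gt0 R) G 0 1.
  rewrite /perturbed_id add0r mulr1 => ->; rewrite periodize_id ?G0T//.
    exact: twopi_gt0.
  by rewrite lexx twopi_gt0.
by rewrite /perturbed_id periodize_id ?t0//; exact: twopi_gt0.
Qed.

Lemma fourier_coeff_le (G : R -> R) (n k : int) : G 0 = G T ->
  ComplexField.Normc.normc (fourier_coeff (exp_i n (perturbed_id G)) k) <=
  `|osc (phase G n%:~R k%:~R 0)| + `|osc (phase G n%:~R k%:~R (- (pi / 2)))|.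
Proof.
move=> G0T; have T0 := twopi_gt0 R.
have E1 : \int[mu]_(t in `[0, T]) complex.Re
    (exp_i n (perturbed_id G) t * cis (- (k%:~R * t))) = osc (phase G n%:~R k%:~R 0).
  apply: eq_Rintegral => t; rewrite inE/= in_itv/= => tT.
  by rewrite perturbed_idE// -cosD /phase addr0.
have E2 : \int[mu]_(t in `[0, T]) complex.Im
    (exp_i n (perturbed_id G) t * cis (- (k%:~R * t))) =
    osc (phase G n%:~R k%:~R (- (pi / 2))).
  apply: eq_Rintegral => t; rewrite inE/= in_itv/= => tT.
  by rewrite perturbed_idE// addrC -sinD /phase cosBpihalf.
rewrite /fourier_coeff /cintegral E1 E2.
set a := osc _; set b := osc _.
have -> : (T^-1)%:C * (a +i* b) = (T^-1 * a) +i* (T^-1 * b).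
  by congr (_ +i* _) => /=; rewrite mul0r ?subr0 ?addr0.
apply: (le_trans (normc_le _ _)).
have T1 : T^-1 <= 1 by rewrite invf_le1//; have := pi_ge2 R; lra.
rewrite !normrM (ger0_norm (x := T^-1)) ?invr_ge0 ?(ltW T0)//.
by rewrite lerD// ler_piMl.
Qed.

Lemma A_norm_le (f : R -> R[i]) (p V : R) : 0 < p ->
  (forall ks : seq int, uniq ks -> \sum_(k <- ks)
     ComplexField.Normc.normc (fourier_coeff f k) `^ p <= V) ->
  (A_norm p f <= (V `^ p^-1)%:E)%E.
Proof.
move=> p0 H; have V0 : 0 <= V by have := H [::] isT; rewrite big_nil.
rewrite /A_norm -poweR_EFin.
have S0 : (0%E <= \esum_(k in [set: int])
    (ComplexField.Normc.normc (fourier_coeff f k) `^ p)%:E)%E.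
  by apply: esum_ge0 => k _; rewrite lee_fin powR_ge0.
apply: gt0_ler_poweR; rewrite ?invr_ge0 ?(ltW p0)//.
- by rewrite in_itv/= S0 leey.
- by rewrite in_itv/= lee_fin V0 leey.
apply: ge_ereal_sup => _ [S [finS _] <-].
rewrite fsbig_finite//= sumEFin lee_fin; apply: H; exact: finmap.fset_uniq.
Qed.

End fourier_bounds.

(** * Uniform bounds for the family of blocks *)

Section block_family.
Variables (R : realType) (w : R -> R).
Hypothesis w_cont : {within [set d : R | 0 <= d], continuous w}.
Hypothesis w_ndecr : forall d1 d2 : R, 0 <= d1 -> d1 <= d2 -> w d1 <= w d2.
Hypothesis w0 : w 0 = 0.
Hypothesis w_double : \forall d \near (0 : R)^'+, w (2 * d) < 2 * w d.
Variables (delta : nat -> R) (c : R).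
Hypothesis c01 : 0 < c <= 1.
Hypothesis delta_gt0 : forall k, 0 < delta k.
Hypothesis delta_le1 : forall k, delta k <= 1.
Hypothesis delta_half : forall k, 2 * delta k.+1 < delta k.
Hypothesis w_delta : forall k, w (delta k) = c * 2 ^- k.

(** The common form of the cases [p = 1] and [p > 1]. The lower bound on [Theta] absorbs the
    contributions that do not decay with the blocks: the identity map and the truncation error. *)
Definition block_family_bound (p : R) (L : nat -> nat) (A : nat -> R) : Prop :=
  exists C Y gam : R, [/\ 0 <= C, 0 < gam < 1,
    forall y, Y <= y -> 0 <= Theta w p y /\ 1 <= C * Theta w p y `^ p &
    forall n, Y <= `|n| -> forall m ks x sigma (y : int -> R), uniq ks ->
      (forall k, block_term delta (L m) x n (A m) (k%:~R - sigma) (y k)) ->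
      \sum_(k <- ks) `|y k| `^ p <= C * Theta w p `|n| `^ p * gam ^+ m].

Lemma block_family_bound_gt1 (p : R) (L : nat -> nat) (A : nat -> R) :
  1 < p -> p < 2 -> (forall m, (m <= L m)%N) ->
  (forall m, 0 <= A m <= c * 2 ^- L m) -> block_family_bound p L A.
Proof.
move=> p1 p2 mL AL.
have [C1 C10 H1] := block_sum_Theta_p w_cont w_ndecr w0 w_double c01 delta_gt0
  delta_le1 delta_half w_delta p1 p2.
have [C2 C20 H2] := Theta_powR_sum w_cont w_ndecr w0 w_double c01 delta_gt0
  delta_le1 delta_half w_delta p1.
have g01 : 0 < (2 : R) `^ (- (p - 1)) < 1.
  rewrite powR_gt0//= powRN invf_lt1 ?powR_gt0//.
  have := @gt0_ltr_powR R (p - 1) _ 1 2; rewrite powR1 !nnegrE subr_gt0.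
  by apply => //; rewrite ?ler0n ?ler01 ?ltr1n.
exists (C1 + C2), 2, (2 `^ (- (p - 1))); split=> //.
- exact: addr_ge0.
- move=> y y2; split; first by rewrite /Theta gt_eqF// powR_ge0.
  have := H2 y 0%N y2 (fun j h => False_ind _ (notF h)).
  rewrite big_ord0 addr0 => /le_trans; apply.
  by rewrite ler_wpM2r ?powR_ge0// lerDr.
move=> n n2 m ks x sigma y uks hy.
apply: (le_trans (H1 n (L m) x (A m) sigma ks y n2 (AL m) uks hy)).
have [g0 g1] := andP g01.
rewrite mulrAC ler_pM ?mulr_ge0 ?powR_ge0 ?exprn_ge0//.
  by rewrite ler_wpM2r ?powR_ge0// lerDl.
by apply: ler_wiXn2l => //; exact: ltW.
Qed.

(** The threshold [cA] is produced before the blocks are given, because their construction has to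
    respect it. *)
Lemma block_family_bound_1 : exists2 cA : nat -> R, (forall L, 0 < cA L) &
  forall (L : nat -> nat) (A : nat -> R), (forall m, (m <= L m)%N) ->
  (forall m, 0 <= A m <= cA (L m)) -> block_family_bound 1 L A.
Proof.
have [C1 [Y1 [cA [C10 Y12 cA0 H1]]]] := block_sum_Theta_1 w_cont w_ndecr w_double c01
  delta_gt0 delta_le1 delta_half w_delta.
have [Y2 Y22 H2] := Theta1_scale w_cont w_ndecr w_double c01 delta_gt0 delta_le1
  delta_half w_delta 0.
exists cA => // L A mL AL.
have s2 : 1 < Num.sqrt 2 :> R by rewrite -[ltLHS]sqrtr1 ltr_sqrt ?ltr1n ?ltr0n.
have g01 : 0 < (Num.sqrt (2 : R))^-1 < 1.
  by rewrite invr_gt0 invf_lt1 ?(lt_trans ltr01 s2)//.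
have l2 : 0 < ln 2 :> R by apply: ln_gt0; rewrite ltr1n.
pose C2 : R := 2 / ln 2; have C20 : 0 <= C2 by rewrite divr_ge0// ltW.
have TH y : Y2 <= y -> 0 <= Theta w 1 y /\ 1 <= C2 * Theta w 1 y.
  move=> yY; have [j [_ h _]] := H2 y yY.
  have ly : ln 2 <= ln y by rewrite ler_ln ?posrE; lra.
  have h2 : ln 2 <= 2 * Theta w 1 y.
    apply: (le_trans ly); apply: le_trans h.
    by rewrite ler_peMl// ?exprn_ege1 ?ler1n// (le_trans (ltW l2) ly).
  split; first by lra.
  by rewrite /C2 mulrAC ler_pdivlMr// mul1r.
exists (C1 + C2), (Num.max Y1 Y2), (Num.sqrt 2)^-1; split=> //.
- exact: addr_ge0.
- move=> y; rewrite ge_max => /andP[_ /TH[t0 t1]]; split=> //.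
  rewrite powRr1// (le_trans t1)// ler_wpM2r// lerDr//.
move=> n; rewrite ge_max => /andP[nY1 /TH[t0 _]] m ks x sigma y uks hy.
under eq_bigr do rewrite powRr1//.
apply: (le_trans (H1 n (L m) x (A m) sigma ks y nY1 (AL m) uks hy)).
have [g0 g1] := andP g01.
rewrite powRr1// mulrAC ler_pM ?mulr_ge0 ?exprn_ge0 ?(ltW g0)//.
  by rewrite ler_wpM2r// lerDl.
by apply: ler_wiXn2l => //; exact: ltW.
Qed.

End block_family.

Section A_norm_bound.
Variables (R : realType) (w : R -> R) (delta : nat -> R) (c : R).
Local Notation T := (2 * pi : R).
Hypothesis c01 : 0 < c <= 1.
Hypothesis delta_gt0 : forall k, 0 < delta k.
Hypothesis delta_half : forall k, 2 * delta k.+1 < delta k.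
Variables (x : nat -> R) (L : nat -> nat) (A v : nat -> R) (B : nat -> R -> R).
Hypothesis A0 : forall m, 0 < A m.
Hypothesis Ac : forall m, A m <= c * 2 ^- L m * 2 ^- m.+2.
Hypothesis A8 : forall m, A m.+1 <= A m / 8.
Hypothesis xl : forall m, 0 <= x m - 2 * delta (L m).
Hypothesis xr : forall m, x m + 2 * delta (L m) <= T.
Hypothesis vE : forall m t, x m - 2 * delta (L m) <= t <= x m + 2 * delta (L m) ->
  bump_sum delta x L A m t = v m.
Hypothesis dB : forall k y, is_derive y (1 : R) (B k) (cantor_bump delta k y).
Hypothesis B0 : forall k y, 2 * delta k <= `|y| -> B k y = 0.
Variable G : R -> R.
Hypothesis dG : forall t, is_derive t (1 : R) G (bump_limit delta x L A t).
Hypothesis G00 : G 0 = 0.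

Lemma A_norm_perturbed_id (p : R) : 1 <= p -> p < 2 ->
  block_family_bound w delta p L A ->
  exists C N : R, forall n : int, N <= `|n%:~R : R| ->
    (A_norm p (exp_i n (perturbed_id G)) <= (C * Theta w p `|n%:~R|)%:E)%E.
Proof.
move=> p1 p2 [C [Y [gam [C0 g01 HY Hblk]]]].
have p0 : 0 < p by lra.
have pp : 1 <= p <= 2 by lra.
have [Cg Cg0 geo] := geometric_minkowski pp g01.
have T0 := twopi_gt0 R.
pose W := (2 : R) `^ p * (2 `^ p * (T `^ p + Cg) + 1).
have W0 : 0 <= W.
  rewrite mulr_ge0 ?powR_ge0// addr_ge0// mulr_ge0 ?powR_ge0//.
  by rewrite addr_ge0 ?powR_ge0.
pose D := (2 : R) `^ p * (2 * W * C).
have D0 : 0 <= D by rewrite mulr_ge0 ?powR_ge0// mulr_ge0// mulr_ge0.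
exists (D `^ p^-1), Y => n nY.
have [Th0 Th1] := HY _ nY.
set Th := Theta _ _ _ in Th0 Th1 *.
have -> : D `^ p^-1 * Th = (D * Th `^ p) `^ p^-1.
  by rewrite powRM ?powR_ge0// -powRrM mulfV ?gt_eqF// powRr1.
apply: A_norm_le => // ks uks.
pose U := C * Th `^ p; have U0 : 0 <= U by rewrite mulr_ge0 ?powR_ge0.
have HX a : \sum_(k <- ks) `|osc (phase G n%:~R k%:~R a)| `^ p <= W * U.
  have := @osc_primitive_sum R delta c c01 delta_gt0 delta_half x L A v B A0 Ac A8 xl xr
    vE dB B0 G dG G00 n a p Cg U gam p1 geo U0 _ ks uks.
  move=> h; apply: (le_trans (h _)).
    by move=> m ks' y uks' hy; exact: Hblk hy.
  rewrite /W -mulrA ler_wpM2l ?powR_ge0// [leRHS]mulrDl mul1r lerD//.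
  rewrite -mulrA ler_wpM2l ?powR_ge0// [leRHS]mulrDl lerD//.
  by rewrite ler_peMr ?powR_ge0.
have G0T : G 0 = G T.
  rewrite G00 (bump_primitive_out c01 T0 delta_gt0 delta_half A0 Ac A8 xl xr dB B0 dG G00)//.
  by right.
apply: (@le_trans _ _ (\sum_(k <- ks) 2 `^ p *
    (`|osc (phase G n%:~R k%:~R 0)| `^ p +
     `|osc (phase G n%:~R k%:~R (- (pi / 2)))| `^ p))).
  apply: ler_sum => k _; apply: le_trans (powR_add_le (ltW p0) _ _) => //.
  rewrite ge0_ler_powR ?nnegrE ?addr_ge0 ?(ltW p0)//; last exact: fourier_coeff_le.
  by case: (fourier_coeff _ _) => u1 u2; exact: sqrtr_ge0.
rewrite -mulr_sumr big_split/= /D -mulrA ler_wpM2l ?powR_ge0//.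
have -> : 2 * W * C * Th `^ p = W * U + W * U by rewrite /U; ring.
by rewrite lerD.
Qed.

End A_norm_bound.

Theorem theorem4 (R : realType) (w : R -> R)
  (w_cont : {within [set d : R | 0 <= d], continuous w})
  (w_ndecr : forall d1 d2 : R, 0 <= d1 -> d1 <= d2 -> w d1 <= w d2)
  (w0 : w 0 = 0)
  (w_double : \forall d \near (0 : R)^'+, w (2 * d) < 2 * w d) :
  exists h : R -> R,
    [/\ nowhere_linear h,
        circle_C1w_diffeo w h
      & forall p : R, 1 <= p -> p < 2 ->
          exists C N : R, forall n : int, N <= `|n%:~R : R| ->
            (A_norm p (exp_i n h) <= (C * Theta w p `|n%:~R|)%:E)%E].
Proof.
have T0 := twopi_gt0 R.
have [delta [c [c01 d0 d1 dh wd]]] := modulus_scales w_cont w_ndecr w0 w_double.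
have [c0 c1] := andP c01.
have [cA cA0 HcA] := block_family_bound_1 w_cont w_ndecr w_double c01 d0 d1 dh wd.
have [a [b [abI abE]]] := interval_enumeration T0.
(* The first bound makes the moduli of the bumps add up to [O(w)] and contains the condition
   [A m <= c * 2 ^- L m] used for every [p > 1]; the second is the one required for [p = 1]. *)
pose cB L m := Num.min (c * 2 ^- L * 2 ^- m.+2) (cA L).
have ab m : a m < b m by case: (abI m).
have cB0 L m : 0 < cB L m.
  by rewrite lt_min cA0 andbT !mulr_gt0 ?invr_gt0 ?exprn_gt0.
have [x [L [A [v H]]]] := exists_bump_sequence d0 dh ab cB0.
have mL m : (m <= L m)%N by case: (H m).
have A0 m : 0 < A m by case: (H m) => _ /andP[].
have AcB m : A m <= cB (L m) m by case: (H m) => _ /andP[].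
have Ac m : A m <= c * 2 ^- L m * 2 ^- m.+2.
  by apply: (le_trans (AcB m)); rewrite ge_min lexx.
have AcA m : 0 <= A m <= cA (L m).
  by rewrite (ltW (A0 m)); apply: (le_trans (AcB m)); rewrite ge_min lexx orbT.
have Acc m : 0 <= A m <= c * 2 ^- L m.
  rewrite (ltW (A0 m)); apply: (le_trans (Ac m)); rewrite ler_piMr//.
    by rewrite mulr_ge0 ?(ltW c0)// invr_ge0 exprn_ge0.
  by rewrite invf_le1 ?exprn_gt0// exprn_ege1// ler1n.
have A8 m : A m.+1 <= A m / 8 by case: (H m).
have ax m : a m <= x m - 2 * delta (L m) by case: (H m) => _ _ _ [].
have xb m : x m + 2 * delta (L m) <= b m by case: (H m) => _ _ _ [].
have xl m : 0 <= x m - 2 * delta (L m) by case: (abI m) => h _ _; exact: le_trans (ax m).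
have xr m : x m + 2 * delta (L m) <= 2 * pi.
  by case: (abI m) => _ _ h; exact: le_trans h.
have vE m t : x m - 2 * delta (L m) <= t <= x m + 2 * delta (L m) ->
    bump_sum delta x L A m t = v m by case: (H m) => _ _ _ _; exact.
have /choice[B HB] := cantor_bump_primitive d0 dh.
have dB k (y : R) : is_derive y (1 : R) (B k) (cantor_bump delta k y) by case: (HB k).
have B0 k (y : R) : 2 * delta k <= `|y| -> B k y = 0 by case: (HB k) => _; exact.
have gc : continuous (bump_limit delta x L A).
  by move=> t; exact: (bump_limit_continuous c01 T0 d0 dh A0 Ac A8).
have [G [dG G00]] := exists_primitive gc.
have Gout t : t <= 0 \/ 2 * pi <= t -> G t = 0.
  exact: (bump_primitive_out c01 T0 d0 dh A0 Ac A8 xl xr dB B0 dG G00).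
have gout t : t <= 0 \/ 2 * pi <= t -> bump_limit delta x L A t = 0.
  exact: (bump_limit_out d0 dh A xl xr).
exists (perturbed_id G); split.
- apply: (perturbed_id_nowhere_linear dG Gout gout) => u1 u2 u10 u12 u2T.
  have [m [h1 h2]] := abE u1 u2 u10 u12 u2T.
  apply: (bump_limit_not_cst c01 T0 d0 dh A0 Ac A8 vE).
    exact: le_trans h1 (ax m).
  exact: le_trans (xb m) h2.
- split.
    apply: (perturbed_id_diffeo dG gc Gout gout).
    exact: (bump_limit_le c01 T0 d0 dh x A0 Ac A8).
  apply: (perturbed_id_C1w dG Gout gout w_ndecr (ltW c0) d0 d1 dh wd) => j s t.
  exact: (bump_limit_mod c01 T0 d0 dh x A0 Ac A8).
move=> p p1 p2.
apply: (A_norm_perturbed_id c01 d0 dh A0 Ac A8 xl xr vE dB B0 dG G00 p1 p2).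
have [p1'|p1'] := ltrP 1 p; last first.
  have -> : p = 1 by apply/eqP; rewrite eq_le p1 p1'.
  exact: (HcA L A mL AcA).
exact: (block_family_bound_gt1 w_cont w_ndecr w0 w_double c01 d0 d1 dh wd p1' p2 mL Acc).
Qed.
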